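(* Let $\Gamma$ be a finitely generated discrete group. Then the algebras $l^1(\Gamma)$, $\mathcal{S}(\Gamma)$, $\mathcal{O}(\Gamma)$ and $\mathcal{S}^\omega(\Gamma)$, with the convolution product and with the comultiplication and Haar functional obtained by continuous extension from the complex group ring $\mathbb{C}\Gamma$, are bornological quantum groups.
   Context: Conventions. Vector spaces are complex. A bornological vector space is a vector space with a convex bornology, whose members are called small sets; it is always assumed complete (every small set lies in a small disk $T$ whose linear span $\langle T\rangle$ is a Banach space for the Minkowski gauge of $T$). $\mathrm{Hom}(V,W)$ is the space of bounded linear maps (those mapping small sets to small sets) with the equibounded bornology; all linear maps considered are bounded and isomorphisms are bounded with bounded inverse. $\hat\otimes$ is the completed bornological tensor product (universal for bounded bilinear maps). $V$ has the approximation property if for each compact disk $S\subset V$ (i.e. compact in some Banach space $\langle T\rangle$, $T$ a small disk) there is a sequence of bounded finite rank operators $f_n:V\to V$ with $f_n\to\mathrm{id}$ in $\mathrm{Hom}(\langle S\rangle,V)$. A bornological algebra is a bornological vector space $H$ with a bounded associative multiplication $\mu:H\hat\otimes H\to H$ (no unit required). For a right $H$-module $M$ and a left $H$-module $V$, $M\hat\otimes_H V$ is the quotient of $M\hat\otimes V$ by the closure of the span of all $mh\otimes v-m\otimes hv$. A left $H$-module $V$ is essential if the action induces an isomorphism $H\hat\otimes_H V\cong V$ (similarly for right modules); $H$ is essential if it is nonzero and $\mu$ induces an isomorphism $H\hat\otimes_H H\cong H$ (unital algebras are essential). The multiplier algebra $M(H)$ consists of pairs $(L,R)$ of bounded linear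 maps $H\to H$ with $L(fg)=L(f)g$, $R(fg)=fR(g)$, $fL(g)=R(f)g$. A homomorphism $f:H\to M(K)$ is essential if it turns $K$ into an essential left and right $H$-module; for essential $K$ it extends uniquely to a unital homomorphism $M(H)\to M(K)$, denoted by the same letter. A bounded functional $\omega$ on $H$ is faithful if ($\omega(fg)=0$ for all $g$) implies $f=0$ and ($\omega(fg)=0$ for all $f$) implies $g=0$. Bornological quantum groups. Let $H$ be an essential bornological algebra with the approximation property and a faithful bounded functional; then $H\subset M(H)$, and similarly for tensor powers. A comultiplication is an essential homomorphism $\Delta:H\to M(H\hat\otimes H)$ with $(\Delta\hat\otimes\mathrm{id})\Delta=(\mathrm{id}\hat\otimes\Delta)\Delta$. Its Galois maps $H\hat\otimes H\to M(H\hat\otimes H)$ are $\gamma_l(f\otimes g)=\Delta(f)(g\otimes 1)$, $\gamma_r(f\otimes g)=\Delta(f)(1\otimes g)$, $\rho_l(f\otimes g)=(f\otimes 1)\Delta(g)$, $\rho_r(f\otimes g)=(1\otimes f)\Delta(g)$. If these are bounded maps into $H\hat\otimes H$, then for a bounded functional $\omega$ the multiplier $(\mathrm{id}\hat\otimes\omega)\Delta(f)\in M(H)$ is defined by $(\mathrm{id}\hat\otimes\omega)\Delta(f)\cdot g=(\mathrm{id}\hat\otimes\omega)\gamma_l(f\otimes g)$, $g\cdot(\mathrm{id}\hat\otimes\omega)\Delta(f)=(\mathrm{id}\hat\otimes\omega)\rho_l(g\otimes f)$. A bounded functional $\phi$ is left invariant if $(\mathrm{id}\hat\otimes\phi)\Delta(f)=\phi(f)1$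 for all $f$. A bornological quantum group is an essential bornological algebra with the approximation property together with a comultiplication all of whose four Galois maps are isomorphisms of $H\hat\otimes H$ onto itself, and a faithful left invariant functional. The examples. Let $L$ be the length function on $\Gamma$ of a word metric, so $L(e)=0$, $L(t)=L(t^{-1})$, $L(st)\le L(s)+L(t)$. On $\mathbb{C}\Gamma$ put $\|f\|^k=\sum_t|f(t)|(1+L(t))^k$ and, for $\alpha>1$, $\|f\|_\alpha=\sum_t|f(t)|\alpha^{L(t)}$. $l^1(\Gamma)$ is the Banach space completion for $\|\cdot\|^0$; $\mathcal{S}(\Gamma)$ is the Fréchet completion for all $\|\cdot\|^k$, $k\in\mathbb{N}$; $\mathcal{O}(\Gamma)$ is the Fréchet completion for all $\|\cdot\|_n$, $n\in\mathbb{N}$; $l^1(\Gamma,\alpha)$ is the Banach completion for $\|\cdot\|_\alpha$ and $\mathcal{S}^\omega(\Gamma)$ is the bornological direct limit of the Banach spaces $l^1(\Gamma,\alpha)$, $\alpha>1$ (as $\alpha\downarrow1$). The Banach and Fréchet spaces carry the bornology of bounded subsets (for $\mathcal{S}(\Gamma)$ and $\mathcal{O}(\Gamma)$ this equals the precompact bornology). On $\mathbb{C}\Gamma$, with $\delta_t$ the characteristic function of $t$: $\delta_s\delta_t=\delta_{st}$, $\Delta(\delta_t)=\delta_t\otimes\delta_t$, and the Haar functional is $\phi(f)=f(e)$. *)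

(* Defs.v *)
From HB Require Import structures.
From mathcomp Require Import all_boot all_order all_algebra.
From mathcomp Require Import generic_quotient ring_quotient finmap.
From mathcomp Require Import boolp classical_sets functions cardinality fsbigop.
From mathcomp Require Import reals ereal topology normedtype sequences esum.
From mathcomp Require Import complex.

Set Implicit Arguments.
Unset Strict Implicit.
Unset Printing Implicit Defensive.

Import Order.TTheory GRing.Theory Num.Theory.
Import numFieldNormedType.Exports.

Local Open Scope classical_set_scope.
Local Open Scope ring_scope.
Local Open Scope quotient_scope.

Notation cabs := ComplexField.Normc.normc.

(* The element satisfying P, with a default value x0 if there is none. It is used
   for objects that exist and are unique (up to isomorphism for tensor
   products), so that x0 plays no role. *)
Definition the (T : Type) (x0 : T) (P : T -> Prop) : T :=
  match pselect (exists x, P x) with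
  | left h => sval (cid h)
  | right _ => x0
  end.

Lemma theP (T : Type) (x0 : T) (P : T -> Prop) :
  (exists x, P x) -> P (the x0 P).
Proof. by move=> h; rewrite /the; case: pselect => // h'; case: cid. Qed.

Section Subspaces.
Variables (R : realType) (V : lmodType R[i]).

Record subspace := Subspace {
  ss_set :> V -> Prop;
  ss0 : ss_set 0;
  ssP : forall a x y, ss_set x -> ss_set y -> ss_set (a *: x + y) }.

Definition ss_pred (P : subspace) : {pred V} := fun x => `[< P x >].

Lemma ss_pred_closed P : GRing.submod_closed (ss_pred P).
Proof.
split=> [|a x y /asboolP Px /asboolP Py]; apply/asboolP; first exact: ss0.
exact: ssP.
Qed.

HB.instance Definition _ P :=
  GRing.isSubmodClosed.Build R[i] V (ss_pred P) (ss_pred_closed P).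

Definition ss_type (P : subspace) := {x : V | x \in ss_pred P}.
HB.instance Definition _ P := SubChoice.on (ss_type P).
HB.instance Definition _ P := [SubChoice_isSubLmodule of ss_type P by <:].

Lemma ss_valP P : linear (fun x : ss_type P => val x).
Proof. by move=> a x y; rewrite linearP. Qed.

Lemma ss_valD P (x y : ss_type P) : val (x + y) = val x + val y.
Proof. by rewrite raddfD. Qed.

Lemma ss_valZ P a (x : ss_type P) : val (a *: x) = a *: val x.
Proof. by rewrite linearZ. Qed.

Definition ss_in (P : subspace) (x : V) : ss_type P := insubd 0 x.

Definition ss_quot (P : subspace) := Quotient.quot (ss_pred P).
HB.instance Definition _ P := GRing.Zmodule.on (ss_quot P).
HB.instance Definition _ P := EqQuotient.on (ss_quot P).

Definition ss_pi (P : subspace) (x : V) : ss_quot P := \pi_(ss_quot P) x.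

Lemma ss_piE (P : subspace) x y : (ss_pi P x == ss_pi P y) = `[< P (x - y) >].
Proof. by rewrite -Quotient.idealrBE. Qed.

Definition ss_scale (P : subspace) (a : R[i]) (q : ss_quot P) : ss_quot P :=
  ss_pi P (a *: repr q).

Lemma ss_piZ P a x : ss_pi P (a *: x) = ss_scale a (ss_pi P x).
Proof.
apply/eqP; rewrite ss_piE; apply/asboolP.
rewrite -scalerBr -[_ *: _]addr0; apply: ssP; last exact: ss0.
by apply/asboolP; rewrite -ss_piE /ss_pi reprK.
Qed.

Lemma ss_piD P x y : ss_pi P (x + y) = ss_pi P x + ss_pi P y.
Proof. exact: (Quotient.pi_add _ x y). Qed.

Lemma ss_piK P (q : ss_quot P) : ss_pi P (repr q) = q.
Proof. exact: reprK. Qed.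

Lemma ss_scaleA P a b (q : ss_quot P) :
  ss_scale a (ss_scale b q) = ss_scale (a * b) q.
Proof. by rewrite -[q]ss_piK -!ss_piZ scalerA. Qed.

Lemma ss_scale1 P : left_id 1 (@ss_scale P).
Proof. by move=> q; rewrite -[q]ss_piK -!ss_piZ scale1r. Qed.

Lemma ss_scaleDr P : right_distributive (@ss_scale P) +%R.
Proof.
by move=> a p q; rewrite -[p]ss_piK -[q]ss_piK -!(ss_piZ, ss_piD) scalerDr.
Qed.

Lemma ss_scaleDl P (q : ss_quot P) :
  {morph (@ss_scale P)^~ q : a b / a + b}.
Proof.
by move=> a b /=; rewrite -[q]ss_piK -!(ss_piZ, ss_piD) scalerDl.
Qed.

HB.instance Definition _ P := GRing.Zmodule_isLmodule.Build R[i] (ss_quot P)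
  (@ss_scaleA P) (@ss_scale1 P) (@ss_scaleDr P) (@ss_scaleDl P).

Lemma ss_pi_linear P : linear (ss_pi P).
Proof. by move=> a x y; rewrite ss_piD ss_piZ. Qed.

Lemma lspan0 (A : set V) :
  [set x | forall P : subspace, A `<=` P -> P x] 0.
Proof. by move=> P _; apply: ss0. Qed.

Lemma lspanP (A : set V) a x y :
  let B := [set x | forall P : subspace, A `<=` P -> P x] in
  B x -> B y -> B (a *: x + y).
Proof. by move=> B Bx By P AP; apply: ssP; [apply: Bx|apply: By]. Qed.

Definition lspan (A : set V) : subspace := Subspace (@lspan0 A) (@lspanP A).

End Subspaces.

Section Disks.
Variables (R : realType) (V : lmodType R[i]).

Definition disk (D : set V) : Prop :=
  D 0 /\ forall (a b : R[i]) x y,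
    cabs a + cabs b <= 1 -> D x -> D y -> D (a *: x + b *: y).

Definition hull (A : set V) : set V :=
  [set x | forall D, disk D -> A `<=` D -> D x].

Definition gauge (T : set V) (x : V) : R :=
  inf [set r : R | 0 < r /\ exists2 t, T t & x = r%:C%C *: t].

Definition banach_disk (T : set V) : Prop :=
  [/\ disk T,
      forall x, lspan T x -> gauge T x = 0 -> x = 0
    & forall u : nat -> V, (forall n, lspan T (u n)) ->
        (forall e : R, 0 < e -> exists N, forall m n, (N <= m)%N -> (N <= n)%N ->
            gauge T (u m - u n) < e) ->
        exists2 x, lspan T x & (fun n => gauge T (u n - x)) @ \oo --> (0 : R)].

Lemma hull_disk A : disk (hull A).
Proof.
split=> [D [D0 _] //|a b x y ab hx hy D dD AD].
by case: (dD) => _; apply=> //; [apply: hx|apply: hy].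
Qed.

Lemma sub_hull A : A `<=` hull A.
Proof. by move=> x Ax D _; apply. Qed.

Lemma diskZ D a x : disk D -> cabs a <= 1 -> D x -> D (a *: x).
Proof.
move=> [D0 dD] a1 Dx; rewrite -[_ *: _]addr0 -(scaler0 _ 0).
by apply: dD => //; rewrite ComplexField.Normc.normc0 addr0.
Qed.

End Disks.

Section Bornology.
Variable R : realType.

(* Convex bornologies. Completeness is the separate predicate bcomplete. *)
Record bornSpace := BornSpace {
  bs_car :> lmodType R[i];
  small : set (set bs_car);
  small1 : forall x, small [set x];
  sub_small : forall A B, A `<=` B -> small B -> small A;
  smallU : forall A B, small A -> small B -> small (A `|` B);
  smallD : forall A B, small A -> small B -> small [set a + b | a in A & b in B];
  smallZ : forall c A, small A -> small [set c *: a | a in A];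
  small_hull : forall A, small A -> small (hull A) }.

Definition bcomplete (V : bornSpace) : Prop :=
  forall S : set V, small S -> exists T, [/\ small T, banach_disk T & S `<=` T].

Definition bcvg (V : bornSpace) (u : nat -> V) (x : V) : Prop :=
  exists T : set V, [/\ small T, disk T, forall n, lspan T (u n), lspan T x
    & (fun n => gauge T (u n - x)) @ \oo --> (0 : R)].

Definition bclosed (V : bornSpace) (A : set V) : Prop :=
  forall u x, (forall n, A (u n)) -> bcvg u x -> A x.

Definition blin (V W : bornSpace) (f : V -> W) : Prop :=
  linear f /\ forall A, small A -> small (f @` A).

Definition bbilin (V W Z : bornSpace) (b : V -> W -> Z) : Prop :=
  [/\ forall w, linear (b^~ w), forall v, linear (b v)
    & forall A B, small A -> small B -> small [set b x y | x in A & y in B]].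

Definition biso (V W : bornSpace) (f : V -> W) : Prop :=
  blin f /\ exists g : W -> V, [/\ blin g, cancel f g & cancel g f].

Definition equibounded (V W : bornSpace) (F : set (V -> W)) : Prop :=
  forall A, small A -> small [set f x | f in F & x in A].

Lemma blin0 (V W : bornSpace) : blin (fun _ : V => 0 : W).
Proof.
split=> [a x y|A _]; first by rewrite scaler0 addr0.
by apply: sub_small (small1 0) => _ [x _ <-].
Qed.

Lemma bbilin0 (V W Z : bornSpace) : bbilin (fun (_ : V) (_ : W) => 0 : Z).
Proof.
split=> [w a x y|v a x y|A B _ _]; try by rewrite scaler0 addr0.
by apply: sub_small (small1 0) => _ [x _ [y _ <-]].
Qed.

Lemma blin_comb (V W : bornSpace) (a : R[i]) (f g : V -> W) :
  blin f -> blin g -> blin (a *: f + g).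
Proof.
move=> [lf bf] [lg bg]; split=> [b x y|A sA].
  rewrite !fctE lf lg !scalerDr !scalerA addrACA (mulrC a b).
  by [].
apply: sub_small (smallD (smallZ a (bf _ sA)) (bg _ sA)) => _ [x Ax <-].
by exists (a *: f x); [exists (f x) => //; exists x|exists (g x) => //; exists x].
Qed.

Lemma blin_comp (V W Z : bornSpace) (g : W -> Z) (f : V -> W) :
  blin g -> blin f -> blin (g \o f).
Proof.
move=> [lg bg] [lf bf]; split=> [b x y|A sA]; first by rewrite /= lf lg.
by rewrite -image_comp; apply: bg; apply: bf.
Qed.

Lemma blin_id (V : bornSpace) : blin (@idfun V).
Proof. by split=> // A; rewrite image_id. Qed.

Lemma linear_disk (V W : lmodType R[i]) (f : V -> W) (D : set V) :
  linear f -> disk D -> disk (f @` D).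
Proof.
move=> lf [D0 dD].
have f0 : f 0 = 0 by have := lf (-1) 0 0; rewrite !scaleN1r !addNr.
split; first by exists 0.
move=> a b _ _ ab [x Dx <-] [y Dy <-]; exists (a *: x + b *: y); first exact: dD.
by rewrite lf -[b *: y]addr0 lf f0 addr0.
Qed.

Lemma preimage_disk (V W : lmodType R[i]) (f : V -> W) (D : set W) :
  linear f -> disk D -> disk (f @^-1` D).
Proof.
move=> lf [D0 dD].
have f0 : f 0 = 0 by have := lf (-1) 0 0; rewrite !scaleN1r !addNr.
split; first by rewrite /preimage /= f0.
move=> a b x y ab Dx Dy; rewrite /preimage /=.
by rewrite lf -[b *: y]addr0 lf f0 addr0; apply: dD.
Qed.

Lemma equibounded1 (V W : bornSpace) (f : V -> W) :
  blin f -> equibounded [set f].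
Proof.
move=> [_ bf] A sA; apply: sub_small (bf _ sA) => _ [_ -> [x Ax <-]].
by exists x.
Qed.

Lemma sub_equibounded (V W : bornSpace) (F G : set (V -> W)) :
  F `<=` G -> equibounded G -> equibounded F.
Proof.
move=> FG eG A sA; apply: sub_small (eG _ sA) => _ [f Ff [x Ax <-]].
by exists f; [exact: FG|exists x].
Qed.

Lemma equiboundedU (V W : bornSpace) (F G : set (V -> W)) :
  equibounded F -> equibounded G -> equibounded (F `|` G).
Proof.
move=> eF eG A sA; apply: sub_small (smallU (eF _ sA) (eG _ sA)).
by move=> _ [f [Ff|Gf] [x Ax <-]]; [left|right]; exists f => //; exists x.
Qed.

Lemma equiboundedD (V W : bornSpace) (F G : set (V -> W)) :
  equibounded F -> equibounded G -> equibounded [set f + g | f in F & g in G].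
Proof.
move=> eF eG A sA; apply: sub_small (smallD (eF _ sA) (eG _ sA)).
move=> _ [_ [f Ff [g Gg <-]] [x Ax <-]].
by exists (f x); [exists f => //; exists x|exists (g x) => //; exists g => //; exists x].
Qed.

Lemma equiboundedZ (V W : bornSpace) c (F : set (V -> W)) :
  equibounded F -> equibounded [set c *: f | f in F].
Proof.
move=> eF A sA; apply: sub_small (smallZ c (eF _ sA)).
by move=> _ [_ [f Ff <-] [x Ax <-]]; exists (f x) => //; exists f => //; exists x.
Qed.

Lemma equibounded_hull (V W : bornSpace) (F : set (V -> W)) :
  equibounded F -> equibounded (hull F).
Proof.
move=> eF A sA; apply: sub_small (small_hull (eF _ sA)).
move=> _ [f hf [x Ax <-]].
apply: (hf [set g : V -> W | hull [set f x | f in F & x in A] (g x)]) => [|g Fg].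
  by apply: (@preimage_disk _ _ (fun g : V -> W => g x)) => //; exact: hull_disk.
by apply: sub_hull; exists g => //; exists x.
Qed.

Section Quotient.
Variables (V : bornSpace) (P : subspace V).

Definition quot_small : set (set (ss_quot P)) :=
  [set B | exists2 A : set V, small A & B `<=` ss_pi P @` A].

Lemma quot_small1 x : quot_small [set x].
Proof.
exists [set repr x]; first exact: small1.
by move=> _ ->; exists (repr x) => //; rewrite ss_piK.
Qed.

Lemma quot_sub_small A B : A `<=` B -> quot_small B -> quot_small A.
Proof. by move=> AB [C sC BC]; exists C => //; apply: subset_trans BC. Qed.

Lemma quot_smallU A B : quot_small A -> quot_small B -> quot_small (A `|` B).
Proof.
move=> [A' sA AA] [B' sB BB]; exists (A' `|` B'); first exact: smallU.
by rewrite image_setU; apply: setUSS.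
Qed.

Lemma quot_smallD A B : quot_small A -> quot_small B ->
  quot_small [set a + b | a in A & b in B].
Proof.
move=> [A' sA AA] [B' sB BB].
exists [set a + b | a in A' & b in B']; first exact: smallD.
move=> _ [_ /AA[a Aa <-] [_ /BB[b Bb <-] <-]]; exists (a + b); last exact: ss_piD.
by exists a => //; exists b.
Qed.

Lemma quot_smallZ c A : quot_small A -> quot_small [set c *: a | a in A].
Proof.
move=> [A' sA AA]; exists [set c *: a | a in A']; first exact: smallZ.
by move=> _ [_ /AA[a Aa <-] <-]; exists (c *: a); [exists a|exact: ss_piZ].
Qed.

Lemma quot_small_hull A : quot_small A -> quot_small (hull A).
Proof.
move=> [A' sA AA]; exists (hull A'); first exact: small_hull.
move=> x; apply.
  by apply: linear_disk (hull_disk _); exact: ss_pi_linear.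
by move=> y /AA[a Aa <-]; exists a => //; exact: sub_hull.
Qed.

Definition quotB : bornSpace := BornSpace quot_small1 quot_sub_small quot_smallU
  quot_smallD quot_smallZ quot_small_hull.

End Quotient.

(* The closure of the linear span of A is the least closed subspace containing A. *)
Lemma closed_span0 (V : bornSpace) (A : set V) :
  [set x | forall P : subspace V, bclosed (P : set V) -> A `<=` P -> P x] 0.
Proof. by move=> P _ _; apply: ss0. Qed.

Lemma closed_spanP (V : bornSpace) (A : set V) a x y :
  let B := [set x | forall P : subspace V,
                      bclosed (P : set V) -> A `<=` P -> P x] in
  B x -> B y -> B (a *: x + y).
Proof. by move=> B Bx By P cP AP; apply: ssP; [apply: Bx|apply: By]. Qed.

Definition closed_span (V : bornSpace) (A : set V) : subspace V :=
  Subspace (@closed_span0 V A) (@closed_spanP V A).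

Section Hom.
Variables V W : bornSpace.

Definition hom_sub : subspace (V -> W) :=
  Subspace (@blin0 V W) (@blin_comb V W).

Definition hom_small : set (set (ss_type hom_sub)) :=
  [set F | equibounded (val @` F)].

Lemma hom_small1 x : hom_small [set x].
Proof.
rewrite /hom_small /= image_set1; apply: equibounded1.
exact/asboolP/(valP x).
Qed.

Lemma hom_sub_small A B : A `<=` B -> hom_small B -> hom_small A.
Proof. by move=> AB; apply: sub_equibounded; apply: image_subset. Qed.

Lemma hom_smallU A B : hom_small A -> hom_small B -> hom_small (A `|` B).
Proof. by move=> sA sB; rewrite /hom_small /= image_setU; apply: equiboundedU. Qed.

Lemma hom_smallD A B : hom_small A -> hom_small B ->
  hom_small [set a + b | a in A & b in B].
Proof.
move=> sA sB; apply: sub_equibounded (equiboundedD sA sB).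
move=> _ [_ [a Aa [b Bb <-]] <-]; exists (val a); first by exists a.
by exists (val b); first by exists b.
Qed.

Lemma hom_smallZ c A : hom_small A -> hom_small [set c *: a | a in A].
Proof.
move=> sA; apply: sub_equibounded (equiboundedZ c sA).
by move=> _ [_ [a Aa <-] <-]; exists (val a) => //; exists a.
Qed.

Lemma hom_small_hull A : hom_small A -> hom_small (hull A).
Proof.
move=> sA; apply: sub_equibounded (equibounded_hull sA).
move=> _ [a ha <-]; apply: (ha (val @^-1` hull (val @` A))).
  by apply: preimage_disk (hull_disk _).
by move=> b Ab; apply: sub_hull; exists b.
Qed.

Definition Hom : bornSpace := BornSpace hom_small1 hom_sub_small hom_smallU
  hom_smallD hom_smallZ hom_small_hull.

Definition to_hom (f : V -> W) : Hom := ss_in hom_sub f.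

End Hom.

Section DiskSpan.
Variables (V : bornSpace) (S : set V) (dS : disk S).

Let absorbed (r : R) (x : V) := exists2 s, S s & x = r%:C%C *: s.

Let cabsR (r : R) : 0 <= r -> cabs (r%:C%C) = r.
Proof. by move=> r0; rewrite /= expr0n/= addr0 sqrtr_sqr ger0_norm. Qed.

Let cabs_ge0 (a : R[i]) : 0 <= cabs a.
Proof. by case: a => ? ?; exact: sqrtr_ge0. Qed.

Let absorbedP a x y (r s : R) : 0 < r -> 0 < s -> absorbed r x -> absorbed s y ->
  absorbed (cabs a * r + s) (a *: x + y).
Proof.
move=> r0 s0 [u Su ->] [v Sv ->]; set t := cabs a * r + s.
have t0 : 0 < t by rewrite ltr_wpDl// mulr_ge0// ltW.
have tC : t%:C%C != 0 :> R[i] by rewrite fmorph_eq0 gt_eqF.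
exists ((t%:C%C)^-1 * a * r%:C%C *: u + (t%:C%C)^-1 * s%:C%C *: v).
  case: dS => _; apply => //.
  rewrite !ComplexField.Normc.normcM !ComplexField.Normc.normcV.
  rewrite (cabsR (ltW r0)) (cabsR (ltW s0)) (cabsR (ltW t0)).
  by rewrite -mulrA -mulrDr mulVf// gt_eqF.
by rewrite scalerDr !scalerA !mulrA !divff// !mul1r.
Qed.

Let absorbedW x (r s : R) : 0 < s -> r <= s -> 0 < r -> absorbed r x -> absorbed s x.
Proof.
move=> s0 rs r0 [u Su ->]; exists ((r / s)%:C%C *: u).
  apply: diskZ => //; rewrite cabsR; first by rewrite ler_pdivrMr// mul1r.
  by rewrite divr_ge0// ltW.
by rewrite scalerA -rmorphM/= mulrCA divff ?mulr1// gt_eqF.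
Qed.

(* The bounded subsets of the normed space <S> are those absorbed by S. *)
Definition span_small : set (set (ss_type (lspan S))) :=
  [set A | exists2 r : R, 0 < r &
    forall x, A x -> exists2 s, S s & val x = r%:C%C *: s].

Lemma span_small1 x : span_small [set x].
Proof.
have B0 : [set x | exists2 r, 0 < r & absorbed r x] 0.
  by exists 1 => //; exists 0; [case: dS|rewrite scaler0].
have BP a y z : [set x | exists2 r, 0 < r & absorbed r x] y ->
    [set x | exists2 r, 0 < r & absorbed r x] z ->
    [set x | exists2 r, 0 < r & absorbed r x] (a *: y + z).
  move=> [r r0 ry] [s s0 sz]; exists (cabs a * r + s); last exact: absorbedP.
  by rewrite ltr_wpDl// mulr_ge0// ltW.
have /asboolP/(_ (Subspace B0 BP)) := valP x.
have SB : S `<=` Subspace B0 BP.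
  by move=> s Ss; exists 1 => //; exists s => //; rewrite scale1r.
by move=> /(_ SB)[r r0 rx]; exists r => // _ ->.
Qed.

Lemma span_sub_small A B : A `<=` B -> span_small B -> span_small A.
Proof. by move=> AB [r r0 rB]; exists r => // x /AB; exact: rB. Qed.

Lemma span_smallU A B : span_small A -> span_small B -> span_small (A `|` B).
Proof.
move=> [r r0 rA] [s s0 sB]; exists (r + s); first exact: addr_gt0.
move=> x [/rA|/sB]; apply: absorbedW => //; rewrite ?addr_gt0//.
  by rewrite lerDl ltW.
by rewrite lerDr ltW.
Qed.

Lemma span_smallD A B : span_small A -> span_small B ->
  span_small [set a + b | a in A & b in B].
Proof.
move=> [r r0 rA] [s s0 sB]; exists (r + s); first exact: addr_gt0.
move=> _ [a /rA ra [b /sB sb <-]].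
have := absorbedP 1 r0 s0 ra sb.
by rewrite ComplexField.Normc.normc1 mul1r scale1r.
Qed.

Lemma span_smallZ c A : span_small A -> span_small [set c *: a | a in A].
Proof.
move=> [r r0 rA]; exists (cabs c * r + 1).
  by rewrite ltr_wpDl// mulr_ge0// ltW.
move=> _ [a /rA ra <-]; rewrite -[c *: a]addr0.
apply: absorbedP => //; exists 0; first by case: dS.
by rewrite scaler0.
Qed.

Lemma span_small_hull A : span_small A -> span_small (hull A).
Proof.
move=> [r r0 rA]; exists r => // x hx.
apply: (hx (val @^-1` [set x | absorbed r x])) => //.
apply: preimage_disk => //.
case: dS => S0 SP; split; first by exists 0 => //; rewrite scaler0.
move=> a b y z ab [s Ss ->] [t St ->]; exists (a *: s + b *: t).
  exact: SP.
by rewrite scalerDr !scalerA ![_ * r%:C%C]mulrC.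
Qed.

Definition diskspan : bornSpace := BornSpace span_small1 span_sub_small
  span_smallU span_smallD span_smallZ span_small_hull.

End DiskSpan.

Definition gauge_open (V : lmodType R[i]) (T U : set V) : Prop :=
  forall x, lspan T x -> U x -> exists2 e : R, 0 < e &
    forall y, lspan T y -> gauge T (y - x) < e -> U y.

Definition gauge_compact (V : lmodType R[i]) (T S : set V) : Prop :=
  S `<=` lspan T /\
  forall F : set (set V), (forall U, F U -> gauge_open T U) ->
    S `<=` \bigcup_(U in F) U ->
    exists E : set (set V), [/\ finite_set E, E `<=` F & S `<=` \bigcup_(U in E) U].

Definition compact_disk (V : bornSpace) (S : set V) : Prop :=
  disk S /\ exists T : set V, [/\ small T, banach_disk T & gauge_compact T S].

Definition finite_rank (V W : lmodType R[i]) (f : V -> W) : Prop :=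
  exists s : seq W, forall x, lspan [set` s] (f x).

Definition approximation_property (V : bornSpace) : Prop :=
  forall (S : set V) (cS : compact_disk S),
    exists f : nat -> V -> V,
      (forall n, blin (f n) /\ finite_rank (f n)) /\
      bcvg (fun n => to_hom (fun x : diskspan (proj1 cS) => f n (val x)))
           (to_hom (fun x : diskspan (proj1 cS) => val x)).

Record pretensor (V W : bornSpace) := Pretensor {
  pt_space :> bornSpace;
  pt_map : V -> W -> pt_space }.

(* The completed tensor product is characterized by its universal property;
   it always exists: take the functions c : V * W -> C supported in a product of
   two small sets with sum of |c| finite, modulo the closed span of the bilinear
   relations between the point masses. *)
Definition is_tensor (V W : bornSpace) (T : pretensor V W) : Prop :=
  [/\ bcomplete T, bbilin (@pt_map _ _ T)
    & forall Z : bornSpace, bcomplete Z -> forall b : V -> W -> Z, bbilin b ->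
        exists! f : T -> Z, blin f /\ forall v w, f (pt_map T v w) = b v w].

Definition tens (V W : bornSpace) : pretensor V W :=
  the (Pretensor (fun _ _ => 0 : V)) (@is_tensor V W).

Definition ot (V W : bornSpace) (v : V) (w : W) : tens V W := pt_map (tens V W) v w.

Definition lift (V W Z : bornSpace) (b : V -> W -> Z) : tens V W -> Z :=
  the (fun _ => 0) (fun f => blin f /\ forall v w, f (ot v w) = b v w).

Definition tmap (V W V' W' : bornSpace) (f : V -> V') (g : W -> W') :
  tens V W -> tens V' W' := lift (fun v w => ot (f v) (g w)).

(* By the universal property, bounded maps on the completed tensor product are the
   same as bounded bilinear maps. Completeness and associativity are stated
   separately in is_bornAlg. *)
Record bornAlg := BornAlg {
  ba_space :> bornSpace;
  bmul : ba_space -> ba_space -> ba_space;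
  bmulP : bbilin bmul }.
Arguments bmul {b}.

Definition is_bornAlg (A : bornAlg) : Prop :=
  bcomplete A /\ associative (@bmul A).

Lemma tmul_bbilin (A B : bornAlg) : bbilin
  (the (fun _ _ => 0) (fun m : tens A B -> tens A B -> tens A B =>
     bbilin m /\ forall a b a' b',
       m (ot a b) (ot a' b') = ot (bmul a a') (bmul b b'))).
Proof. by rewrite /the; case: pselect => [h|_]; [case: cid => ? []|exact: bbilin0]. Qed.

Definition tens_alg (A B : bornAlg) : bornAlg := BornAlg (tmul_bbilin A B).

Section Multipliers.
Variable A : bornAlg.

Definition is_multiplier (m : (A -> A) * (A -> A)) : Prop :=
  (blin m.1 /\ blin m.2) /\
  [/\ forall f g, m.1 (bmul f g) = bmul (m.1 f) g,
      forall f g, m.2 (bmul f g) = bmul f (m.2 g)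
    & forall f g, bmul f (m.1 g) = bmul (m.2 f) g].

Let bmul0l (g : A) : bmul 0 g = 0.
Proof.
have [/(_ g)h _ _] := @bmulP A.
by have := h (-1) 0 0; rewrite !scaleN1r !addNr.
Qed.

Let bmul0r (f : A) : bmul f 0 = 0.
Proof.
have [_ /(_ f)h _] := @bmulP A.
by have := h (-1) 0 0; rewrite !scaleN1r !addNr.
Qed.

Lemma multiplier0 : is_multiplier 0.
Proof.
split; first by split; exact: blin0.
by split=> f g /=; rewrite ?bmul0l ?bmul0r.
Qed.

Lemma multiplierP a m n :
  is_multiplier m -> is_multiplier n -> is_multiplier (a *: m + n).
Proof.
have [lA rA _] := @bmulP A.
move=> [[m1 m2] [mL mR mM]] [[n1 n2] [nL nR nM]].
split; first by split; exact: blin_comb.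
split=> f g /=; rewrite !fctE.
- by rewrite mL nL (lA g).
- by rewrite mR nR (rA f).
- by rewrite (rA f) (lA g) mM nM.
Qed.

Definition mult_sub : subspace ((A -> A) * (A -> A))%type :=
  Subspace multiplier0 multiplierP.

(* The bornology induced from Hom(A, A) x Hom(A, A). *)
Definition mult_small : set (set (ss_type mult_sub)) :=
  [set F | equibounded [set (val m).1 | m in F] /\
           equibounded [set (val m).2 | m in F]].

Lemma multP (m : ss_type mult_sub) : is_multiplier (val m).
Proof. exact/asboolP/(valP m). Qed.

Lemma mult_small1 x : mult_small [set x].
Proof.
have [[b1 b2] _] := multP x.
by split; rewrite image_set1; exact: equibounded1.
Qed.

Lemma mult_sub_small F G : F `<=` G -> mult_small G -> mult_small F.
Proof.
by move=> FG [G1 G2]; split; [apply: sub_equibounded G1|apply: sub_equibounded G2];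
  exact: image_subset.
Qed.

Lemma mult_smallU F G : mult_small F -> mult_small G -> mult_small (F `|` G).
Proof.
by move=> [F1 F2] [G1 G2]; split; rewrite image_setU; exact: equiboundedU.
Qed.

Lemma mult_smallD F G : mult_small F -> mult_small G ->
  mult_small [set a + b | a in F & b in G].
Proof.
move=> [F1 F2] [G1 G2]; split.
  apply: sub_equibounded (equiboundedD F1 G1) => _ [_ [a Fa [b Gb <-]] <-].
  rewrite ss_valD; exists (val a).1; first by exists a.
  by exists (val b).1; first by exists b.
apply: sub_equibounded (equiboundedD F2 G2) => _ [_ [a Fa [b Gb <-]] <-].
rewrite ss_valD; exists (val a).2; first by exists a.
by exists (val b).2; first by exists b.
Qed.

Lemma mult_smallZ c F : mult_small F -> mult_small [set c *: a | a in F].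
Proof.
move=> [F1 F2]; split.
  apply: sub_equibounded (equiboundedZ c F1) => _ [_ [a Fa <-] <-].
  by rewrite ss_valZ; exists (val a).1; first by exists a.
apply: sub_equibounded (equiboundedZ c F2) => _ [_ [a Fa <-] <-].
by rewrite ss_valZ; exists (val a).2; first by exists a.
Qed.

Lemma mult_small_hull F : mult_small F -> mult_small (hull F).
Proof.
move=> [F1 F2]; split.
  apply: sub_equibounded (equibounded_hull F1) => _ [a ha <-].
  apply: (ha ((fun m : ss_type mult_sub => (val m).1) @^-1` hull _)).
    apply: preimage_disk (hull_disk _) => c x y.
    by rewrite ss_valP.
  by move=> b Fb; apply: sub_hull; exists b.
apply: sub_equibounded (equibounded_hull F2) => _ [a ha <-].
apply: (ha ((fun m : ss_type mult_sub => (val m).2) @^-1` hull _)).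
  apply: preimage_disk (hull_disk _) => c x y.
  by rewrite ss_valP.
by move=> b Fb; apply: sub_hull; exists b.
Qed.

Definition mult_space : bornSpace := BornSpace mult_small1 mult_sub_small
  mult_smallU mult_smallD mult_smallZ mult_small_hull.

Definition mL (m : mult_space) : A -> A := (val m).1.
Definition mR (m : mult_space) : A -> A := (val m).2.

(* The multiplier (L, Q), or 0 if this pair is not a multiplier. *)
Definition to_mult (L Q : A -> A) : mult_space := ss_in mult_sub (L, Q).

Definition mmul (m n : mult_space) : mult_space :=
  to_mult (mL m \o mL n) (mR n \o mR m).

Lemma to_multE (L Q : A -> A) :
  is_multiplier (L, Q) -> val (to_mult L Q) = (L, Q).
Proof. by move=> h; rewrite /to_mult /ss_in insubdK//; apply/asboolP. Qed.

Lemma mmul_multiplier m n : is_multiplier (mL m \o mL n, mR n \o mR m).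
Proof.
have [[m1 m2] [hL hR hM]] := multP m; have [[n1 n2] [kL kR kM]] := multP n.
split; first by split; exact: blin_comp.
by split=> f g /=; rewrite /mL /mR ?kL ?hL ?hR ?kR ?hM ?kM.
Qed.

Lemma mmul_bbilin : bbilin mmul.
Proof.
have E m n := to_multE (mmul_multiplier m n).
have lL m a x y : mL m (a *: x + y) = a *: mL m x + mL m y.
  by have [[[l _] _] _] := multP m; rewrite /mL l.
have lR m a x y : mR m (a *: x + y) = a *: mR m x + mR m y.
  by have [[_ [l _]] _] := multP m; rewrite /mR l.
split=> [n a x y|m a x y|F G [F1 F2] [G1 G2]].
- apply: val_inj; rewrite ss_valP !E /mL /mR ss_valP.
  congr pair; apply/funext => z //=.
  by rewrite -[LHS]/(mR n _) lR.
- apply: val_inj; rewrite ss_valP !E /mL /mR ss_valP.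
  congr pair; apply/funext => z //=.
  by rewrite -[LHS]/(mL m _) lL.
- split=> S sS.
    apply: sub_small (F1 _ (G1 _ sS)).
    move=> _ [_ [_ [m Fm [n Gn <-]] <-] [x Sx <-]]; rewrite E /=.
    exists (mL m); first by exists m.
    by exists (mL n x) => //; exists (mL n); [exists n|exists x].
  apply: sub_small (G2 _ (F2 _ sS)).
  move=> _ [_ [_ [m Fm [n Gn <-]] <-] [x Sx <-]]; rewrite E /=.
  exists (mR n); first by exists n.
  by exists (mR m x) => //; exists (mR m); [exists m|exists x].
Qed.

Definition Mult : bornAlg := BornAlg mmul_bbilin.

Definition mone : Mult := to_mult idfun idfun.

Definition iota (a : A) : Mult := to_mult (bmul a) (bmul^~ a).

End Multipliers.

Definition is_hom (A B : bornAlg) (f : A -> B) : Prop :=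
  blin f /\ forall x y, f (bmul x y) = bmul (f x) (f y).

Section Modules.
Variable H : bornAlg.

Definition is_lmodule (V : bornSpace) (la : H -> V -> V) : Prop :=
  [/\ bcomplete V, bbilin la & forall h k v, la (bmul h k) v = la h (la k v)].

Definition is_rmodule (M : bornSpace) (ra : M -> H -> M) : Prop :=
  [/\ bcomplete M, bbilin ra & forall m h k, ra m (bmul h k) = ra (ra m h) k].

Definition balanced (M V : bornSpace) (ra : M -> H -> M) (la : H -> V -> V) :
    subspace (tens M V) :=
  closed_span [set x | exists m h v, x = ot (ra m h) v - ot m (la h v)].

Definition tens_over (M V : bornSpace) (ra : M -> H -> M) (la : H -> V -> V) :
  bornSpace := quotB (balanced ra la).

Definition induced (M V Z : bornSpace) (ra : M -> H -> M) (la : H -> V -> V)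
    (b : M -> V -> Z) : tens_over ra la -> Z :=
  fun q => lift b (repr (q : ss_quot (balanced ra la))).

Definition essential_left (V : bornSpace) (la : H -> V -> V) : Prop :=
  is_lmodule la /\ biso (@induced H V V bmul la la).

Definition essential_right (M : bornSpace) (ra : M -> H -> M) : Prop :=
  is_rmodule ra /\ biso (@induced M H M ra bmul ra).

Definition essential_alg : Prop :=
  (exists x : H, x <> 0) /\ biso (@induced H H H bmul bmul bmul).

End Modules.

Definition essential_hom (H K : bornAlg) (f : H -> Mult K) : Prop :=
  [/\ is_hom f, essential_left (fun h k => mL (f h) k)
    & essential_right (fun k h => mR (f h) k)].

(* The unital extension M(A) -> M(K) of an essential homomorphism A -> M(K). *)
Definition mext (A K : bornAlg) (f : A -> Mult K) : Mult A -> Mult K :=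
  the (fun _ => 0) (fun F : Mult A -> Mult K =>
    [/\ is_hom F, F (mone A) = mone K & forall a, F (iota a) = f a]).

Definition mtens (A B : bornAlg) (m : Mult A) (n : Mult B) : Mult (tens_alg A B) :=
  @to_mult (tens_alg A B) (tmap (mL m) (mL n)) (tmap (mR m) (mR n)).

Section QuantumGroup.
Variables (H : bornAlg) (Delta : H -> Mult (tens_alg H H)).

Definition tens_assoc : tens (tens H H) H -> tens H (tens H H) :=
  lift (fun x c => lift (fun a b => ot a (ot b c)) x).

Definition Delta_id : tens_alg H H -> Mult (tens_alg (tens_alg H H) H) :=
  lift (fun f g => mtens (Delta f) (iota g)).

Definition id_Delta : tens_alg H H -> Mult (tens_alg H (tens_alg H H)) :=
  lift (fun f g => mtens (iota f) (Delta g)).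

(* Equality of multipliers of the threefold tensor power, through the
   associativity isomorphism. *)
Definition coassociative : Prop :=
  forall f (x : tens (tens H H) H),
    tens_assoc (mL (mext Delta_id (Delta f)) x) =
      mL (mext id_Delta (Delta f)) (tens_assoc x) /\
    tens_assoc (mR (mext Delta_id (Delta f)) x) =
      mR (mext id_Delta (Delta f)) (tens_assoc x).

Definition comultiplication : Prop := essential_hom Delta /\ coassociative.

Definition gamma_l : tens H H -> Mult (tens_alg H H) :=
  lift (fun f g => bmul (Delta f) (mtens (iota g) (mone H))).
Definition gamma_r : tens H H -> Mult (tens_alg H H) :=
  lift (fun f g => bmul (Delta f) (mtens (mone H) (iota g))).
Definition rho_l : tens H H -> Mult (tens_alg H H) :=
  lift (fun f g => bmul (mtens (iota f) (mone H)) (Delta g)).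
Definition rho_r : tens H H -> Mult (tens_alg H H) :=
  lift (fun f g => bmul (mtens (mone H) (iota f)) (Delta g)).

Definition galois_iso (g : tens H H -> Mult (tens_alg H H)) : Prop :=
  exists2 e : tens H H -> tens_alg H H, biso e & forall x, iota (e x) = g x.

Definition bfunctional (w : H -> R[i]) : Prop :=
  (forall a x y, w (a *: x + y) = a * w x + w y) /\
  forall A : set H, small A -> exists M : R, forall x, A x -> cabs (w x) <= M.

Definition faithful (w : H -> R[i]) : Prop :=
  (forall f, (forall g, w (bmul f g) = 0) -> f = 0) /\
  (forall g, (forall f, w (bmul f g) = 0) -> g = 0).

(* The inverse of the inclusion of A in M(A). *)
Definition of_mult (A : bornAlg) (m : Mult A) : A :=
  the 0 (fun a => iota a = m).

Definition id_tens (w : H -> R[i]) : tens H H -> H :=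
  lift (fun f g => w g *: f).

(* The multiplier (id (x) w) Delta(f). *)
Definition slice (w : H -> R[i]) (f : H) : Mult H :=
  to_mult (fun g => id_tens w (of_mult (gamma_l (ot f g))))
          (fun g => id_tens w (of_mult (rho_l (ot g f)))).

Definition left_invariant (w : H -> R[i]) : Prop :=
  forall f, slice w f = w f *: mone H.

Record bornological_quantum_group (phi : H -> R[i]) : Prop := {
  bqg_alg : is_bornAlg H;
  bqg_essential : essential_alg H;
  bqg_approx : approximation_property H;
  bqg_comul : comultiplication;
  bqg_gamma_l : galois_iso gamma_l;
  bqg_gamma_r : galois_iso gamma_r;
  bqg_rho_l : galois_iso rho_l;
  bqg_rho_r : galois_iso rho_r;
  bqg_bounded : bfunctional phi;
  bqg_faithful : faithful phi;
  bqg_invariant : left_invariant phi }.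

End QuantumGroup.

End Bornology.

Section GroupAlgebras.
Variables (R : realType) (G : groupType).

Implicit Types (f g : G -> R[i]^o) (w : G -> R).

(* The letters are the elements of S and their inverses. *)
Definition is_word (S : seq G) (n : nat) (t : G) : Prop :=
  exists s : seq G, [/\ size s = n, all (fun x => (x \in S) || (x^-1%g \in S)) s
    & t = (\prod_(x <- s) x)%g].

Definition generates (S : seq G) : Prop :=
  forall t, exists n, `[< is_word S n t >].

Definition word_length (S : seq G) (gS : generates S) (t : G) : nat :=
  ex_minn (gS t).

Definition wnorm w f : \bar R := \esum_(t in [set: G]) (cabs (f t) * w t)%:E.

Lemma wnorm_leP w f (M : R) : (wnorm w f <= M%:E)%E <->
  forall A : {fset G}, \sum_(t <- A) cabs (f t) * w t <= M.
Proof.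
split=> [h A|h].
  rewrite -lee_fin; apply: le_trans h; apply: ereal_sup_ubound.
  exists [set` A]; first by split => //; exact: finite_fset.
  by rewrite fsbig_finite//= set_fsetK -sumEFin.
apply: ge_ereal_sup => _ [A [fA _] <-].
by rewrite fsbig_finite//= sumEFin lee_fin.
Qed.

Lemma wnorm_fin w f : (wnorm w f < +oo)%E <-> exists M : R, (wnorm w f <= M%:E)%E.
Proof.
split=> [|[M hM]]; last by rewrite (le_lt_trans hM)// ltry.
case E : (wnorm w f) => [r| |] // _; first by exists r.
by exists 0; rewrite leNye.
Qed.

Lemma cabs_ge0 (a : R[i]) : 0 <= cabs a.
Proof. by case: a => ? ?; exact: sqrtr_ge0. Qed.

Lemma wnormP w a f g (M N : R) : (forall t, 0 <= w t) ->
  (wnorm w f <= M%:E)%E -> (wnorm w g <= N%:E)%E ->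
  (wnorm w (a *: f + g)%R <= (cabs a * M + N)%R%:E)%E.
Proof.
move=> w0 /wnorm_leP hf /wnorm_leP hg; apply/wnorm_leP => A.
apply: le_trans (lerD (ler_wpM2l (cabs_ge0 a) (hf A)) (hg A)).
rewrite mulr_sumr -big_split /=; apply: ler_sum => t _.
rewrite mulrA -mulrDl ler_wpM2r// -ComplexField.Normc.normcM.
exact: le_normcD.
Qed.

Lemma wnorm0 w : (wnorm w 0%R <= 0%:E)%E.
Proof.
by apply/wnorm_leP => A; rewrite big1// => t _; rewrite ComplexField.Normc.normc0 mul0r.
Qed.

Lemma wnormW v w f (M : R) : (forall t, v t <= w t) ->
  (wnorm w f <= M%:E)%E -> (wnorm v f <= M%:E)%E.
Proof.
move=> vw /wnorm_leP h; apply/wnorm_leP => A; apply: le_trans (h A).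
by apply: ler_sum => t _; rewrite ler_wpM2l// cabs_ge0.
Qed.

Lemma wnorm_ball_disk w (M : R) : (forall t, 0 <= w t) -> 0 <= M ->
  disk [set f | (wnorm w f <= M%:E)%E].
Proof.
move=> w0 M0; split=> [|a b f g ab hf hg /=].
  by apply: le_trans (wnorm0 w) _; rewrite lee_fin.
have hg' := wnormP b w0 hg (wnorm0 w).
apply: le_trans (wnormP a w0 hf _) _; first by rewrite -[b *: g]addr0; exact: hg'.
rewrite lee_fin addr0 -mulrDl -[leRHS]mul1r ler_wpM2r//.
Qed.

Definition delta (t : G) : G -> R[i]^o := fun s => (s == t)%:R.

Lemma wnorm_delta w t : (forall s, 0 <= w s) -> (wnorm w (delta t) <= (w t)%:E)%E.
Proof.
move=> w0; apply/wnorm_leP => A.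
have d1 s : cabs (delta t s) * w s = if s == t then w t else 0.
  rewrite /delta; case: eqP => [->|_].
    by rewrite ComplexField.Normc.normc1 mul1r.
  by rewrite ComplexField.Normc.normc0 mul0r.
rewrite (eq_bigr _ (fun s _ => d1 s)).
have [tA|tA] := boolP (t \in A).
  rewrite (big_fsetD1 t tA) /= eqxx big1_seq ?addr0// => s /=.
  by rewrite in_fsetD1 => /andP[/negbTE ->].
by rewrite big1_seq// => s /= sA; case: eqP => // st; rewrite -st sA in tA.
Qed.

(* The completion of the group ring for the norms wnorm (w i) is realized as the
   space of all functions on which these norms are finite; the small sets are
   those on which each of the norms is bounded. *)
Section Frechet.
Variables (I : Type) (w : I -> G -> R) (w0 : forall i t, 0 <= w i t).

Lemma frechet0 : [set f | forall i, (wnorm (w i) f < +oo)%E] 0.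
Proof. by move=> i; apply/wnorm_fin; exists 0; exact: wnorm0. Qed.

Lemma frechetP a f g :
  let F := [set f | forall i, (wnorm (w i) f < +oo)%E] in
  F f -> F g -> F (a *: f + g).
Proof.
move=> F hf hg i; apply/wnorm_fin.
have /wnorm_fin[M hM] := hf i; have /wnorm_fin[N hN] := hg i.
by exists (cabs a * M + N); exact: wnormP.
Qed.

Definition frechet_sub : subspace (G -> R[i]^o) := Subspace frechet0 frechetP.

Definition frechet_small : set (set (ss_type frechet_sub)) :=
  [set A | forall i, exists M : R,
     forall x, A x -> (wnorm (w i) (val x) <= M%:E)%E].

Lemma frechet_small1 x : frechet_small [set x].
Proof.
move=> i; have /asboolP/(_ i)/wnorm_fin[M hM] := valP x.
by exists M => _ ->.
Qed.

Lemma frechet_sub_small A B : A `<=` B -> frechet_small B -> frechet_small A.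
Proof. by move=> AB h i; have [M hM] := h i; exists M => f /AB; exact: hM. Qed.

Lemma frechet_smallU A B :
  frechet_small A -> frechet_small B -> frechet_small (A `|` B).
Proof.
move=> hA hB i; have [M hM] := hA i; have [N hN] := hB i.
exists (Num.max M N) => f [/hM h|/hN h]; apply: (le_trans h); rewrite lee_fin.
  by rewrite le_max lexx.
by rewrite le_max lexx orbT.
Qed.

Lemma frechet_smallD A B : frechet_small A -> frechet_small B ->
  frechet_small [set a + b | a in A & b in B].
Proof.
move=> hA hB i; have [M hM] := hA i; have [N hN] := hB i.
exists (cabs 1 * M + N) => _ [f /hM hf [g /hN hg <-]].
by rewrite ss_valD -[val f]scale1r; exact: wnormP.
Qed.

Lemma frechet_smallZ c A :
  frechet_small A -> frechet_small [set c *: a | a in A].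
Proof.
move=> hA i; have [M hM] := hA i; exists (cabs c * M + 0) => _ [f /hM hf <-].
by rewrite ss_valZ -[c *: val f]addr0; apply: wnormP => //; exact: wnorm0.
Qed.

Lemma frechet_small_hull A : frechet_small A -> frechet_small (hull A).
Proof.
move=> hA i; have [M hM] := hA i; exists (Num.max M 0) => f hf.
apply: (hf (val @^-1` [set f | (wnorm (w i) f <= (Num.max M 0)%:E)%E])).
  apply: preimage_disk; first exact: ss_valP.
  by apply: wnorm_ball_disk => //; rewrite le_max lexx orbT.
move=> g /hM h; apply: (le_trans h); by rewrite lee_fin le_max lexx.
Qed.

Lemma frechet_deltaP t : frechet_sub (delta t).
Proof. by move=> i; apply/wnorm_fin; exists (w i t); exact: wnorm_delta. Qed.

Definition frechet : bornSpace R := BornSpace frechet_small1 frechet_sub_small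
  frechet_smallU frechet_smallD frechet_smallZ frechet_small_hull.

Definition frechet_delta (t : G) : frechet := Sub (delta t) (asboolT (frechet_deltaP t)).

End Frechet.

(* The direct limit of the Banach spaces l^1(G, alpha), alpha > 1, along the
   inclusions of l^1(G, alpha) in l^1(G, beta) for beta <= alpha, is their union;
   a set is small if it is contained and bounded in one of them. *)
Section Limit.
Variable L : G -> nat.

Definition expw (alpha : R) : G -> R := fun t => alpha ^+ L t.

Let expw_ge0 (alpha : R) t : 1 < alpha -> 0 <= expw alpha t.
Proof. by move=> a1; rewrite exprn_ge0// ltW// (lt_trans _ a1). Qed.

Let expw_le (alpha beta : R) t :
  1 < alpha -> alpha <= beta -> expw alpha t <= expw beta t.
Proof.
move=> a1 ab; have a0 : 0 <= alpha by rewrite ltW// (lt_trans _ a1).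
by rewrite lerXn2r// nnegrE// (le_trans a0).
Qed.

Let expw_min (alpha beta M N : R) f g : 1 < alpha -> 1 < beta ->
  (wnorm (expw alpha) f <= M%:E)%E -> (wnorm (expw beta) g <= N%:E)%E ->
  [/\ 1 < Num.min alpha beta,
      (wnorm (expw (Num.min alpha beta)) f <= M%:E)%E
    & (wnorm (expw (Num.min alpha beta)) g <= N%:E)%E].
Proof.
move=> a1 b1 hf hg; have m1 : 1 < Num.min alpha beta by rewrite lt_min a1.
split=> //; [apply: wnormW hf|apply: wnormW hg] => t; apply: expw_le => //.
  by rewrite ge_min lexx.
by rewrite ge_min lexx orbT.
Qed.

Lemma limit0 :
  [set f | exists2 alpha : R, 1 < alpha & (wnorm (expw alpha) f < +oo)%E] 0.
Proof.
exists 2; first by rewrite ltr1n.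
by apply/wnorm_fin; exists 0; exact: wnorm0.
Qed.

Lemma limitP a f g :
  let F := [set f | exists2 alpha : R,
                      1 < alpha & (wnorm (expw alpha) f < +oo)%E] in
  F f -> F g -> F (a *: f + g).
Proof.
move=> F [alpha a1 /wnorm_fin[M hM]] [beta b1 /wnorm_fin[N hN]].
have [m1 mf mg] := expw_min a1 b1 hM hN.
exists (Num.min alpha beta) => //; apply/wnorm_fin.
by exists (cabs a * M + N); apply: wnormP => // t; exact: expw_ge0.
Qed.

Definition limit_sub : subspace (G -> R[i]^o) := Subspace limit0 limitP.

Definition limit_small : set (set (ss_type limit_sub)) :=
  [set A | exists2 alpha : R, 1 < alpha & exists M : R,
     forall x, A x -> (wnorm (expw alpha) (val x) <= M%:E)%E].

Lemma limit_small1 x : limit_small [set x].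
Proof.
have /asboolP[alpha a1 /wnorm_fin[M hM]] := valP x.
by exists alpha => //; exists M => _ ->.
Qed.

Lemma limit_sub_small A B : A `<=` B -> limit_small B -> limit_small A.
Proof.
by move=> AB [alpha a1 [M hM]]; exists alpha => //; exists M => f /AB; exact: hM.
Qed.

Lemma limit_smallU A B : limit_small A -> limit_small B -> limit_small (A `|` B).
Proof.
move=> [alpha a1 [M hM]] [beta b1 [N hN]].
exists (Num.min alpha beta); first by rewrite lt_min a1.
exists (Num.max M N) => f [/hM h|/hN h].
  have [_ /le_trans h' _] := expw_min a1 b1 h (wnorm0 _).
  by apply: h'; rewrite lee_fin le_max lexx.
have [_ _ /le_trans h'] := expw_min a1 b1 (wnorm0 _) h.
by apply: h'; rewrite lee_fin le_max lexx orbT.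
Qed.

Lemma limit_smallD A B : limit_small A -> limit_small B ->
  limit_small [set a + b | a in A & b in B].
Proof.
move=> [alpha a1 [M hM]] [beta b1 [N hN]].
have m1 : 1 < Num.min alpha beta by rewrite lt_min a1.
exists (Num.min alpha beta) => //.
exists (cabs 1 * M + N) => _ [f /hM hf [g /hN hg <-]].
have [_ hf' hg'] := expw_min a1 b1 hf hg.
rewrite ss_valD -[val f]scale1r; apply: wnormP => // t; exact: expw_ge0.
Qed.

Lemma limit_smallZ c A : limit_small A -> limit_small [set c *: a | a in A].
Proof.
move=> [alpha a1 [M hM]]; exists alpha => //.
exists (cabs c * M + 0) => _ [f /hM hf <-]; rewrite ss_valZ -[c *: val f]addr0.
by apply: wnormP => [t||] //; [exact: expw_ge0|exact: wnorm0].
Qed.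

Lemma limit_small_hull A : limit_small A -> limit_small (hull A).
Proof.
move=> [alpha a1 [M hM]]; exists alpha => //; exists (Num.max M 0) => f hf.
apply: (hf (val @^-1` [set f | (wnorm (expw alpha) f <= (Num.max M 0)%:E)%E])).
  apply: preimage_disk; first exact: ss_valP.
  apply: wnorm_ball_disk; first by move=> t; exact: expw_ge0.
  by rewrite le_max lexx orbT.
move=> g /hM h; apply: (le_trans h); by rewrite lee_fin le_max lexx.
Qed.

Definition limit : bornSpace R := BornSpace limit_small1 limit_sub_small
  limit_smallU limit_smallD limit_smallZ limit_small_hull.

Lemma limit_deltaP t : limit_sub (delta t).
Proof.
exists 2; first by rewrite ltr1n.
apply/wnorm_fin; exists (expw 2 t); apply: wnorm_delta => s.
by apply: expw_ge0; rewrite ltr1n.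
Qed.

Definition limit_delta (t : G) : limit := Sub (delta t) (asboolT (limit_deltaP t)).

End Limit.

Lemma polyw_ge0 (L : G -> nat) (k : nat) t : 0 <= (1 + (L t)%:R : R) ^+ k.
Proof. by rewrite exprn_ge0// addr_ge0. Qed.

Lemma natw_ge0 (L : G -> nat) (n : nat) t : 0 <= (n%:R : R) ^+ L t.
Proof. by rewrite exprn_ge0. Qed.

Section Examples.
Variables (S : seq G) (gS : generates S).
Let L := word_length gS.

Definition l1 : bornSpace R :=
  frechet (w := fun (_ : unit) t => (1 + (L t)%:R) ^+ 0) (fun _ => polyw_ge0 L 0).

Definition schwartz : bornSpace R :=
  frechet (w := fun (k : nat) t => (1 + (L t)%:R) ^+ k) (polyw_ge0 L).

(* O(G): the norms ||.||_n are indexed by the integers n > 1. *)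
Definition entire : bornSpace R :=
  frechet (w := fun (n : nat) t => n.+2%:R ^+ L t) (fun n => natw_ge0 L n.+2).

Definition schwartz_omega : bornSpace R := limit L.

Definition l1_delta (t : G) : l1 := frechet_delta _ t.
Definition schwartz_delta (t : G) : schwartz := frechet_delta _ t.
Definition entire_delta (t : G) : entire := frechet_delta _ t.
Definition schwartz_omega_delta (t : G) : schwartz_omega := limit_delta L t.

End Examples.

(* The structure maps restrict to those of the group ring, the span of the d t. *)
Definition extends_group_ring (A : bornAlg R) (d : G -> A)
    (Delta : A -> Mult (tens_alg A A)) (phi : A -> R[i]) : Prop :=
  [/\ forall s t, bmul (d s) (d t) = d (s * t)%g,
      forall t, Delta (d t) = iota (ot (d t) (d t) : tens_alg A A)
    & forall t, phi (d t) = (t == 1%g)%:R].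

(* In each of the examples the span of the d t is dense, so that the bounded
   structure maps are determined by their restrictions to it. *)
Definition ext_quantum_group (H : bornSpace R) (d : G -> H) : Prop :=
  exists (mu : H -> H -> H) (muP : bbilin mu), let A := BornAlg muP in
  exists (Delta : A -> Mult (tens_alg A A)) (phi : A -> R[i]),
    @extends_group_ring A d Delta phi /\ bornological_quantum_group Delta phi.

End GroupAlgebras.

(* Main.v *)
(* Each of the four spaces is the union of weighted spaces l^1(G, v) over a downward
   directed set of weights v, a set being small if it is bounded in one of them; for
   the Frechet spaces v runs over the weights that dominate, up to constants, all
   the weights of the defining norms. Such a space is complete, has the
   approximation property by truncation to finite subsets of G, and a map of G to a
   complete space Z extends to a bounded linear map as soon as its values divided by
   v form a small set for each v. The completed tensor product of two such spaces is
   again such a space, on the product set with the weights u(s) v(t). As the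
   multiplication, the diagonal (by the weights sqrt v) and the inversion of G extend
   to bounded maps, and as the algebras are unital, so that M(A) = A, all axioms
   reduce to identities on group elements; the inverses of the Galois maps are
   written with the extension of the inversion. *)
From mathcomp Require Import all_boot all_order all_algebra finmap.
From mathcomp Require Import boolp classical_sets functions cardinality.
From mathcomp Require Import reals ereal normedtype.
From mathcomp Require Import complex ring lra.
Require Import Defs.

Set Implicit Arguments.
Unset Strict Implicit.
Unset Printing Implicit Defensive.

Import Order.TTheory GRing.Theory Num.Theory.
Import numFieldNormedType.Exports.

Local Open Scope classical_set_scope.
Local Open Scope ring_scope.

(** Tensor products, the maps out of them, the product on [tens_alg] and the extension to
    multipliers are fixed by description ([the]), with a default value. Such an object can be
    handled only after something satisfying its description has been exhibited, and this shapes the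
    proof: an explicit tensor product is built in order to learn that [tens] has the universal
    property, and its weights and basis vectors are then carried over to [tens] by the isomorphism
    between the two.

    A Frechet bornology asks for bounds in all norms at once, the direct limit for a bound in one of
    them. Unions over weights treat both alike and turn the boundedness of a map of group elements
    into an inequality between weights. The price is that a bounded set of a Frechet space has to be
    found in a single weighted space. The square roots come from the map t |-> (t, t), which is
    bounded into the tensor square as soon as u(t) u'(t) <= K v(t) for some weights u, u' of the
    family; u = u' = sqrt v is the symmetric choice. *)

Section Linear.
Variables (R : realType) (V W : lmodType R[i]) (f : V -> W) (lf : linear f).

Lemma lin0 : f 0 = 0.
Proof. by have := lf (-1) 0 0; rewrite !scaleN1r !addNr. Qed.

Lemma linZ a x : f (a *: x) = a *: f x.
Proof. by rewrite -[a *: x]addr0 lf lin0 addr0. Qed.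

Lemma linD x y : f (x + y) = f x + f y.
Proof. by rewrite -[x]scale1r lf !scale1r. Qed.

Lemma linB x y : f (x - y) = f x - f y.
Proof. by rewrite -scaleN1r addrC lf scaleN1r addrC. Qed.

Lemma lin_sum (I : Type) (s : seq I) (F : I -> V) :
  f (\sum_(i <- s) F i) = \sum_(i <- s) f (F i).
Proof.
by elim: s => [|i s IH]; rewrite ?big_nil ?lin0// !big_cons linD IH.
Qed.

End Linear.

(** * Gauges of disks, expressed through absorption *)

Section Gauge.
Variables (R : realType) (V : lmodType R[i]).
Implicit Types (T : set V) (x y : V) (r s : R).

Lemma cabsR r : 0 <= r -> cabs (r%:C%C) = r.
Proof. by move=> r0; rewrite /= expr0n/= addr0 sqrtr_sqr ger0_norm. Qed.

(** Stands in for [gauge T x <= r]. The infimum in [gauge] need not be attained; membership in a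
    multiple of T avoids it and is preserved by linear maps without further argument. *)
Definition absorbed T r : set V := [set x | exists2 t, T t & x = r%:C%C *: t].

Lemma absorbedP T a x y r s : disk T -> 0 <= r -> 0 <= s ->
  absorbed T r x -> absorbed T s y -> absorbed T (cabs a * r + s) (a *: x + y).
Proof.
move=> dT r0 s0 [u Su ->] [v Sv ->]; set t := cabs a * r + s.
have ar0 : 0 <= cabs a * r by rewrite mulr_ge0// cabs_ge0.
have : 0 <= t by rewrite addr_ge0.
rewrite le_eqVlt => /orP[/eqP t0|t0].
  (* The general case divides by t. If t = 0, both [a *: x] and y vanish. *)
  have /eqP : t = 0 by [].
  rewrite paddr_eq0// => /andP[/eqP ar /eqP se0].
  exists 0; first by case: dT.
  rewrite scaler0 se0 scale0r addr0 scalerA.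
  have -> : a * r%:C%C = 0.
    by apply: ComplexField.Normc.eq0_normc; rewrite ComplexField.Normc.normcM cabsR.
  by rewrite scale0r.
have tC : t%:C%C != 0 :> R[i] by rewrite fmorph_eq0 gt_eqF.
exists ((t%:C%C)^-1 * a * r%:C%C *: u + (t%:C%C)^-1 * s%:C%C *: v).
  case: dT => _; apply => //.
  rewrite !ComplexField.Normc.normcM !ComplexField.Normc.normcV.
  rewrite (cabsR r0) (cabsR s0) (cabsR (ltW t0)).
  by rewrite -mulrA -mulrDr mulVf// gt_eqF.
by rewrite scalerDr !scalerA !mulrA !divff// !mul1r.
Qed.

Lemma absorbed0 T r : disk T -> absorbed T r 0.
Proof. by move=> [T0 _]; exists 0 => //; rewrite scaler0. Qed.

Lemma absorbed1 T x : T x -> absorbed T 1 x.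
Proof. by exists x => //; rewrite scale1r. Qed.

Lemma absorbedD T x y r s : disk T -> 0 <= r -> 0 <= s ->
  absorbed T r x -> absorbed T s y -> absorbed T (r + s) (x + y).
Proof.
move=> dT r0 s0 hx hy; have := absorbedP 1 dT r0 s0 hx hy.
by rewrite ComplexField.Normc.normc1 mul1r scale1r.
Qed.

Lemma absorbedZ T a x r : disk T -> 0 <= r ->
  absorbed T r x -> absorbed T (cabs a * r) (a *: x).
Proof.
move=> dT r0 hx; have := absorbedP a dT r0 (lexx 0) hx (absorbed0 0 dT).
by rewrite !addr0.
Qed.

Lemma absorbedB T x y r s : disk T -> 0 <= r -> 0 <= s ->
  absorbed T r x -> absorbed T s y -> absorbed T (r + s) (x - y).
Proof.
move=> dT r0 s0 hx hy; apply: absorbedD => //.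
have := absorbedZ (-1) dT s0 hy.
by rewrite normcN ComplexField.Normc.normc1 mul1r scaleN1r.
Qed.

Lemma absorbedW T x r s : disk T -> 0 <= r -> r <= s ->
  absorbed T r x -> absorbed T s x.
Proof.
move=> dT r0 rs hx; have sr0 : 0 <= s - r by rewrite subr_ge0.
have := absorbedD dT r0 sr0 hx (absorbed0 _ dT).
by rewrite addr0 addrC subrK.
Qed.

Lemma absorbedS T T' x r : T `<=` T' -> absorbed T r x -> absorbed T' r x.
Proof. by move=> TT [t /TT h ->]; exists t. Qed.

Lemma absorbed_sum T (I : eqType) (A : seq I) (F : I -> V) (r : I -> R) :
  disk T -> (forall i, i \in A -> 0 <= r i /\ absorbed T (r i) (F i)) ->
  absorbed T (\sum_(i <- A) r i) (\sum_(i <- A) F i).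
Proof.
move=> dT; elim: A => [_|i A IH h]; first by rewrite !big_nil; exact: absorbed0.
have hA j : j \in A -> 0 <= r j /\ absorbed T (r j) (F j).
  by move=> jA; apply: h; rewrite inE jA orbT.
have [ri hi] := h i (mem_head _ _).
rewrite !big_cons; apply: absorbedD => //; last exact: IH.
by rewrite big_seq; apply: sumr_ge0 => j /hA[].
Qed.

(** For a disk the absorbed vectors already form a subspace, hence the least one containing T. *)
Lemma lspanE T x : disk T -> lspan T x <-> exists2 r, 0 < r & absorbed T r x.
Proof.
move=> dT; split=> [h|[r r0 [t Tt ->]] P TP]; last first.
  by rewrite -[_ *: _]addr0; apply: ssP; [exact: TP|exact: ss0].
have B0 : [set x | exists2 r, 0 < r & absorbed T r x] 0.
  by exists 1 => //; exact: absorbed0.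
have BP a y z : [set x | exists2 r, 0 < r & absorbed T r x] y ->
    [set x | exists2 r, 0 < r & absorbed T r x] z ->
    [set x | exists2 r, 0 < r & absorbed T r x] (a *: y + z).
  move=> [r r0 ry] [s s0 sz]; exists (cabs a * r + s).
    by rewrite ltr_wpDl// mulr_ge0// ?cabs_ge0// ltW.
  by apply: absorbedP => //; exact: ltW.
apply: (h (Subspace B0 BP)) => t Tt.
by exists 1 => //; exact: absorbed1.
Qed.


Lemma gauge_ge0 T x : 0 <= gauge T x.
Proof.
rewrite /gauge; set A := [set r | _].
have [->|/set0P A0] := eqVneq A set0; first by rewrite inf0.
by apply: lb_le_inf => // r [/ltW].
Qed.

Lemma gauge_le T x r : 0 < r -> absorbed T r x -> gauge T x <= r.
Proof.
move=> r0 h; apply: ge_inf; last by split.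
by exists 0 => s [/ltW].
Qed.

(** Outside the span the infimum is over the empty set and [gauge] takes the value 0, so the span
    has to be assumed. *)
Lemma gauge_lt T x r : disk T -> lspan T x -> gauge T x < r -> absorbed T r x.
Proof.
move=> dT /(lspanE _ dT)[s s0 hs] xr.
have hi : has_inf [set r : R | 0 < r /\ exists2 t, T t & x = r%:C%C *: t].
  by split; [exists s; split|exists 0 => q [/ltW]].
have e0 : 0 < r - gauge T x by rewrite subr_gt0.
have [q [q0 hq] qr] := inf_adherent e0 hi.
apply: absorbedW (ltW q0) _ hq => //.
by apply: ltW; rewrite addrC subrK in qr.
Qed.

Lemma gauge_cvg0 T (u : nat -> V) : disk T ->
  (forall e : R, 0 < e -> exists N, forall n, (N <= n)%N -> absorbed T e (u n)) ->
  (fun n => gauge T (u n)) @ \oo --> (0 : R).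
Proof.
move=> dT h; apply/cvgrPdist_lt => e e0.
have e20 : 0 < e / 2 by rewrite divr_gt0.
have [N hN] := h _ e20; exists N => // n /= Nn.
rewrite sub0r normrN ger0_norm ?gauge_ge0//.
apply: le_lt_trans (gauge_le e20 (hN _ Nn)) _.
by rewrite ltr_pdivrMr// ltr_pMr// ltr1n.
Qed.

Lemma cvg0_gauge T (u : nat -> V) : disk T -> (forall n, lspan T (u n)) ->
  (fun n => gauge T (u n)) @ \oo --> (0 : R) ->
  forall e : R, 0 < e -> exists N, forall n, (N <= n)%N -> absorbed T e (u n).
Proof.
move=> dT hu /cvgrPdist_lt h e e0.
have [N _ hN] := h e e0; exists N => n Nn; apply: gauge_lt => //.
by have := hN n Nn; rewrite sub0r normrN ger0_norm ?gauge_ge0.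
Qed.

Lemma banach_eq0 T x : banach_disk T ->
  (forall e : R, 0 < e -> absorbed T e x) -> x = 0.
Proof.
move=> [dT sT _] h; have xT : lspan T x by apply/lspanE => //; exists 1 => //; exact: h.
apply: sT => //; apply/eqP; rewrite eq_le gauge_ge0 andbT.
by apply/ler_addgt0Pr => e e0; rewrite add0r; apply: gauge_le => //; exact: h.
Qed.

Lemma banach_cauchy T (u : nat -> V) : banach_disk T ->
  (forall n, lspan T (u n)) ->
  (forall e : R, 0 < e -> exists N, forall m n, (N <= m)%N -> (N <= n)%N ->
     absorbed T e (u m - u n)) ->
  exists2 x, lspan T x & forall e : R, 0 < e ->
    exists N, forall n, (N <= n)%N -> absorbed T e (u n - x).
Proof.
move=> [dT sT cT] hu h.
have [e e0|x xT xu] := cT u hu.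
  have e20 : 0 < e / 2 by rewrite divr_gt0.
  have [N hN] := h _ e20; exists N => m n Nm Nn.
  apply: le_lt_trans (gauge_le e20 (hN _ _ Nm Nn)) _.
  by rewrite ltr_pdivrMr// ltr_pMr// ltr1n.
exists x => //; apply: cvg0_gauge => // n.
by rewrite -scaleN1r addrC; apply: ssP.
Qed.

End Gauge.

Lemma absorbed_image (R : realType) (V W : lmodType R[i]) (f : V -> W) T x r :
  linear f -> absorbed T r x -> absorbed (f @` T) r (f x).
Proof. by move=> lf [t Tt ->]; exists (f t); [exists t|rewrite linZ]. Qed.

(** * Bornological convergence and completeness *)

Section Limits.
Variable R : realType.
Implicit Types V W Z : bornSpace R.

Lemma bcvgP V (u : nat -> V) (x : V) (T : set V) : small T -> disk T ->
  lspan T x ->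
  (forall e : R, 0 < e -> exists N, forall n, (N <= n)%N -> absorbed T e (u n - x)) ->
  (forall n, lspan T (u n)) -> bcvg u x.
Proof. by move=> sT dT Tx h Tu; exists T; split => //; exact: gauge_cvg0. Qed.

Lemma bcvg_absorbed V (u : nat -> V) (x : V) : bcvg u x ->
  exists T : set V, [/\ small T, disk T, forall n, lspan T (u n), lspan T x &
    forall e : R, 0 < e -> exists N, forall n, (N <= n)%N -> absorbed T e (u n - x)].
Proof.
move=> [T [sT dT Tu Tx h]]; exists T; split=> //.
by apply: cvg0_gauge => // n; rewrite -scaleN1r addrC; apply: ssP.
Qed.

Lemma bcvg_blin V W (f : V -> W) u x : blin f -> bcvg u x -> bcvg (f \o u) (f x).
Proof.
move=> [lf bf] /bcvg_absorbed[T [sT dT Tu Tx h]].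
have dfT := linear_disk lf dT.
have L y : lspan T y -> lspan (f @` T) (f y).
  move=> /(lspanE _ dT)[r r0 hr]; apply/lspanE => //.
  by exists r => //; exact: absorbed_image.
apply: (@bcvgP _ _ _ (f @` T)) => //; [exact: bf|exact: L| |by move=> n; exact: L].
move=> e e0; have [N hN] := h e e0; exists N => n Nn.
by rewrite /= -linB//; apply: absorbed_image => //; exact: hN.
Qed.

(** The two limits come with two different disks; completeness puts both into one Banach disk, whose
    gauge separates points. *)
Lemma bcvg_unique V (u : nat -> V) x y : bcomplete V -> bcvg u x -> bcvg u y -> x = y.
Proof.
move=> cV /bcvg_absorbed[T [sT dT Tu Tx hT]] /bcvg_absorbed[U [sU dU Uu Ux hU]].
have [B [sB bB sub]] := cV _ (smallU sT sU).
have dB : disk B by case: bB.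
apply/eqP; rewrite -subr_eq0; apply/eqP; apply: (banach_eq0 bB) => e e0.
have e20 : 0 < e / 2 by rewrite divr_gt0.
have [N hN] := hT _ e20; have [M hM] := hU _ e20.
have {}hN := hN (maxn N M) (leq_maxl _ _).
have {}hM := hM (maxn N M) (leq_maxr _ _).
have -> : x - y = (u (maxn N M) - y) - (u (maxn N M) - x).
  by rewrite [RHS]addrC opprB addrA subrK.
rewrite [e]splitr; apply: absorbedB; rewrite ?(ltW e20)//.
  by apply: absorbedS hM => z Uz; apply: sub; right.
by apply: absorbedS hN => z Uz; apply: sub; left.
Qed.

(** This is what makes density arguments work: an identity between bounded maps passes from a set to
    the closed span of it. *)
Lemma blin_ker_closed V Z (f g : V -> Z) : bcomplete Z -> blin f -> blin g ->
  bclosed [set x | f x = g x].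
Proof.
move=> cZ bf bg u x hu ux; apply: (bcvg_unique cZ (bcvg_blin bf ux)).
suff -> : f \o u = g \o u by exact: bcvg_blin.
by apply/funext => n; exact: hu.
Qed.

Lemma equalizer0 V Z (f g : V -> Z) : linear f -> linear g -> [set x | f x = g x] 0.
Proof. by move=> lf lg /=; rewrite !lin0. Qed.

Lemma equalizerP V Z (f g : V -> Z) a x y : linear f -> linear g ->
  let E := [set x | f x = g x] in E x -> E y -> E (a *: x + y).
Proof. by move=> lf lg E fx fy; rewrite /E /= lf lg (fx : f x = g x) (fy : f y = g y). Qed.

Definition equalizer V Z (f g : V -> Z) (lf : linear f) (lg : linear g) :=
  Subspace (equalizer0 lf lg) (fun a x y => @equalizerP _ _ f g a x y lf lg).

(** The image of a Banach disk under the inverse is a Banach disk with the same gauge. The lemma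
    serves to make the multiplier algebra complete, which the universal property demands of a
    target. *)
Lemma biso_complete V W (f : V -> W) : biso f -> bcomplete W -> bcomplete V.
Proof.
move=> [[lf bf] [g [[lg bg] fg gf]]] cW S sS.
have [T [sT bT ST]] := cW _ (bf _ sS); have [dT sepT cT] := bT.
have eT : g @` T = f @^-1` T.
  apply/seteqP; split=> [_ [t Tt <-]|x Tx]; first by rewrite /preimage /= gf.
  by exists (f x).
have dgT : disk (g @` T) := linear_disk lg dT.
have aT r x : absorbed (g @` T) r x <-> absorbed T r (f x).
  split=> [[_ [t Tt <-] ->]|[t Tt e]].
    by rewrite linZ// gf; exists t.
  by exists (g t); [exists t|rewrite -linZ// -e fg].
have lT x : lspan (g @` T) x <-> lspan T (f x).
  split=> [/(lspanE _ dgT)|/(lspanE _ dT)] [r r0 /aT h]; apply/lspanE => //.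
    by exists r.
  by exists r.
exists (g @` T); split; [exact: bg| |by rewrite eT => x Sx; apply: ST; exists x].
split=> // [x /lT xT x0|u uT cu].
  apply: (can_inj fg); rewrite lin0//; apply: (banach_eq0 bT) => e e0.
  by apply/aT/gauge_lt => //; [exact/lT|rewrite x0].
have [||y yT hy] := banach_cauchy bT (u := f \o u).
- by move=> n; apply/lT.
- move=> e e0; have [N hN] := cu e e0; exists N => m n Nm Nn.
  rewrite /= -linB//; apply/aT/gauge_lt => //; last exact: hN.
  by rewrite -scaleN1r addrC; apply: ssP.
exists (g y); first by apply/lT; rewrite gf.
apply: gauge_cvg0 => // e e0; have [N hN] := hy e e0; exists N => n Nn.
by apply/aT; rewrite linB// gf; exact: hN.
Qed.

Lemma blin_can_biso V W (f : V -> W) (g : W -> V) : blin f -> blin g ->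
  cancel f g -> cancel g f -> biso f.
Proof. by move=> bf bg fg gf; split=> //; exists g. Qed.

End Limits.

(** * Completeness of the scalars *)

Section CauchySequences.
Variable R : realType.

(** The limit is the supremum of the numbers that are eventually below the sequence, its limit
    inferior. *)
Lemma real_cauchy (u : nat -> R) :
  (forall e : R, 0 < e -> exists N, forall m n, (N <= m)%N -> (N <= n)%N ->
     `|u m - u n| <= e) ->
  exists l, forall e : R, 0 < e -> exists N, forall n, (N <= n)%N -> `|u n - l| <= e.
Proof.
move=> cu; pose E := [set x | exists N, forall n, (N <= n)%N -> x <= u n].
have lo e N : (forall m n, (N <= m)%N -> (N <= n)%N -> `|u m - u n| <= e) ->
    E (u N - e).
  move=> h; exists N => n Nn; have := h _ _ (leqnn N) Nn.
  by rewrite ler_norml => /andP[_]; rewrite lerBlDr addrC -lerBlDr.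
have up e N x : (forall m n, (N <= m)%N -> (N <= n)%N -> `|u m - u n| <= e) ->
    E x -> x <= u N + e.
  move=> h [M hM]; have := h _ _ (leq_maxl N M) (leqnn N).
  rewrite ler_norml => /andP[_]; rewrite lerBlDr addrC; apply: le_trans.
  exact: hM (leq_maxr _ _).
have [N1 hN1] := cu 1 ltr01.
have ubE : has_ubound E by exists (u N1 + 1) => x; exact: up.
exists (sup E) => e e0.
have e20 : 0 < e / 2 by rewrite divr_gt0.
have [N hN] := cu _ e20; exists N => n Nn.
have h1 : u N - e / 2 <= sup E by apply: ub_le_sup => //; exact: lo.
have h2 : sup E <= u N + e / 2.
  by apply: sup_le_ub; [exists (u N - e / 2); exact: lo|move=> x; exact: up].
have h3 : `|u N - sup E| <= e / 2.
  by rewrite ler_norml; apply/andP; split; lra.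
rewrite -(subrKA (u N)) [e]splitr; apply: le_trans (ler_normD _ _) _.
by apply: lerD => //; exact: hN.
Qed.

Lemma cabs_Re (z : R[i]) : `|complex.Re z| <= cabs z.
Proof.
case: z => a b /=; rewrite -sqrtr_sqr ler_wsqrtr// lerDl; exact: sqr_ge0.
Qed.

Lemma cabs_Im (z : R[i]) : `|complex.Im z| <= cabs z.
Proof.
case: z => a b /=; rewrite -sqrtr_sqr ler_wsqrtr// lerDr; exact: sqr_ge0.
Qed.

Lemma cabs_le_ReIm (z : R[i]) : cabs z <= `|complex.Re z| + `|complex.Im z|.
Proof.
case: z => a b /=; rewrite -(ger0_norm (addr_ge0 (normr_ge0 a) (normr_ge0 b))).
rewrite -sqrtr_sqr ler_wsqrtr// sqrrD !real_normK ?num_real//.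
by rewrite addrAC lerDl mulrn_wge0// mulr_ge0.
Qed.

Lemma complex_cauchy (u : nat -> R[i]) :
  (forall e : R, 0 < e -> exists N, forall m n, (N <= m)%N -> (N <= n)%N ->
     cabs (u m - u n) <= e) ->
  exists l, forall e : R, 0 < e -> exists N, forall n, (N <= n)%N -> cabs (u n - l) <= e.
Proof.
move=> cu.
have ReB (y z : R[i]) : complex.Re (y - z) = complex.Re y - complex.Re z.
  by case: y; case: z.
have ImB (y z : R[i]) : complex.Im (y - z) = complex.Im y - complex.Im z.
  by case: y; case: z.
have [e e0|a ha] := @real_cauchy (fun n => complex.Re (u n)).
  have [N hN] := cu e e0; exists N => m n Nm Nn.
  by rewrite -ReB (le_trans (cabs_Re _))// hN.
have [e e0|b hb] := @real_cauchy (fun n => complex.Im (u n)).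
  have [N hN] := cu e e0; exists N => m n Nm Nn.
  by rewrite -ImB (le_trans (cabs_Im _))// hN.
exists (Complex a b) => e e0.
have e20 : 0 < e / 2 by rewrite divr_gt0.
have [N hN] := ha _ e20; have [M hM] := hb _ e20.
exists (maxn N M) => n; rewrite geq_max => /andP[Nn Mn].
rewrite [e]splitr (le_trans (cabs_le_ReIm _))// ReB ImB.
by apply: lerD; [exact: hN|exact: hM].
Qed.

Lemma ex_invS (e : R) : 0 < e -> exists N, forall n, (N <= n)%N -> n.+1%:R^-1 <= e.
Proof.
move=> e0; have [N _ hN] := near_infty_natSinv_lt (PosNum e0).
by exists N => n Nn; apply/ltW/hN.
Qed.

End CauchySequences.

(** * Weighted l^1 norms over an arbitrary index set *)

Section WeightedNorm.
Variables (R : realType) (X : choiceType).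
Implicit Types (v : X -> R) (f g : X -> R[i]^o) (M N : R).

(** The bound [wnorm v f <= M] unfolded to finite partial sums: no extended reals occur, and the
    index set may be a product. *)
Definition nle v f M : Prop :=
  forall A : {fset X}, \sum_(t <- A) cabs (f t) * v t <= M.

Lemma nle_ge0 v f M : nle v f M -> 0 <= M.
Proof. by move=> /(_ fset0); rewrite big_seq_fset0. Qed.

Lemma nleP v a f g M N : (forall t, 0 <= v t) -> nle v f M -> nle v g N ->
  nle v (a *: f + g) (cabs a * M + N).
Proof.
move=> v0 hf hg A.
apply: le_trans (lerD (ler_wpM2l (cabs_ge0 a) (hf A)) (hg A)).
rewrite mulr_sumr -big_split /=; apply: ler_sum => t _.
rewrite mulrA -mulrDl ler_wpM2r// -ComplexField.Normc.normcM.
exact: le_normcD.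
Qed.

Lemma nle0 v : nle v 0 0.
Proof.
by move=> A; rewrite big1// => t _; rewrite ComplexField.Normc.normc0 mul0r.
Qed.

Lemma nleZ v a f M : (forall t, 0 <= v t) -> nle v f M -> nle v (a *: f) (cabs a * M).
Proof.
move=> v0 hf; rewrite -[a *: f]addr0 -[_ * M]addr0; apply: nleP => //; exact: nle0.
Qed.

Lemma nleD v f g M N : (forall t, 0 <= v t) -> nle v f M -> nle v g N ->
  nle v (f + g) (M + N).
Proof.
move=> v0 hf hg; have := nleP 1 v0 hf hg.
by rewrite ComplexField.Normc.normc1 mul1r scale1r.
Qed.

Lemma nleN v f M : nle v f M -> nle v (- f) M.
Proof. by move=> h A; under eq_bigr do rewrite fctE normcN; exact: h. Qed.

Lemma nleW v f M N : M <= N -> nle v f M -> nle v f N.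
Proof. by move=> MN h A; apply: le_trans MN. Qed.

Lemma nle_weight u v f C M : 0 <= C -> (forall t, u t <= C * v t) ->
  nle v f M -> nle u f (C * M).
Proof.
move=> C0 uv h A; apply: le_trans (ler_wpM2l C0 (h A)); rewrite mulr_sumr.
by apply: ler_sum => t _; rewrite mulrCA ler_wpM2l ?cabs_ge0.
Qed.

Lemma nle_dom v f g M : (forall t, 0 <= v t) -> (forall t, cabs (f t) <= cabs (g t)) ->
  nle v g M -> nle v f M.
Proof.
by move=> v0 fg h A; apply: le_trans (h A); apply: ler_sum => t _; rewrite ler_wpM2r.
Qed.

Lemma nle_point v f M t : nle v f M -> cabs (f t) * v t <= M.
Proof. by move=> /(_ [fset t]%fset); rewrite big_seq_fset1. Qed.

Definition outside (A : {fset X}) f : X -> R[i]^o :=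
  fun t => if t \in A then 0 else f t.

Lemma nle_outside v A f M : (forall t, 0 <= v t) -> nle v f M -> nle v (outside A f) M.
Proof.
move=> v0; apply: nle_dom => // t; rewrite /outside; case: ifP => // _.
by rewrite ComplexField.Normc.normc0 cabs_ge0.
Qed.

Lemma outside_sub v (A B : {fset X}) f M : (forall t, 0 <= v t) ->
  (A `<=` B)%fset -> nle v (outside A f) M -> nle v (outside B f) M.
Proof.
move=> v0 /fsubsetP AB; apply: nle_dom => // t; rewrite /outside.
case: ifP => tB; first by rewrite ComplexField.Normc.normc0 cabs_ge0.
by case: ifP => // /AB; rewrite tB.
Qed.

(** Take A with partial sum within e of the supremum of all partial sums. A finite set disjoint from
    A can then add at most e. *)
Lemma nle_tail v f M (e : R) : (forall t, 0 <= v t) -> nle v f M -> 0 < e ->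
  exists A : {fset X}, nle v (outside A f) e.
Proof.
move=> v0 hf e0; pose E := [set s | exists A : {fset X}, s = \sum_(t <- A) cabs (f t) * v t].
have hE : has_sup E.
  split; first by exists (\sum_(t <- fset0) cabs (f t) * v t), fset0.
  by exists M => _ [A ->]; exact: hf.
have [_ [A ->] hA] := sup_adherent e0 hE; exists A => B.
rewrite (big_fsetID _ (mem A)) /= big1_seq ?add0r; last first.
  move=> t /= ; rewrite !inE /= => /andP[_ tA].
  by rewrite /outside tA ComplexField.Normc.normc0 mul0r.
set C := [fset x in B | _]%fset.
have dAC : [disjoint A & C]%fset.
  by apply/fdisjointP => t tA; rewrite !inE /= tA andbF.
have : \sum_(t <- (A `|` C)%fset) cabs (f t) * v t <= sup E.
  by apply: sup_upper_bound => //; exists (A `|` C)%fset.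
have pAC : perm_eq (A `|` C)%fset (A ++ C).
  apply: uniq_perm => [||t]; [exact: fset_uniq| |by rewrite mem_cat inE].
  rewrite cat_uniq !fset_uniq andbT /=; apply/hasPn => t /= tC.
  by apply: contraL tC => /(fdisjointP dAC).
rewrite (perm_big (A ++ C))//= big_cat/= => h.
have -> : \sum_(t <- C) cabs (outside A f t) * v t = \sum_(t <- C) cabs (f t) * v t.
  rewrite big_seq [RHS]big_seq; apply: eq_bigr => t.
  by rewrite !inE /= /outside => /andP[_ /negbTE ->].
rewrite -(lerD2l (\sum_(t <- A) cabs (f t) * v t)); apply: (le_trans h).
by rewrite -lerBlDr ltW.
Qed.

(** The limit is taken pointwise. On one finite set A the coordinates converge simultaneously, so
    the Cauchy bound passes to the limit there; N does not depend on A, so the norm bound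
    follows. *)
Lemma nle_cauchy v (u : nat -> X -> R[i]^o) : (forall t, 0 < v t) ->
  (forall e : R, 0 < e -> exists N : nat, forall m n, (N <= m)%N -> (N <= n)%N ->
     nle v (u m - u n) e) ->
  exists f, forall e : R, 0 < e -> exists N : nat, forall n, (N <= n)%N -> nle v (u n - f) e.
Proof.
move=> v0 cu.
have /(_ _)/cid-/all_sig[f hf] (t : X) : exists l, forall e : R, 0 < e ->
    exists N : nat, forall n, (N <= n)%N -> cabs (u n t - l) <= e.
  apply: (@complex_cauchy _ (fun n => u n t)) => e e0.
  have [N hN] := cu (e * v t) (mulr_gt0 e0 (v0 t)); exists N => m n Nm Nn.
  by have := nle_point t (hN _ _ Nm Nn); rewrite ler_pM2r.
exists f => e e0; have [N hN] := cu e e0; exists N => n Nn A.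
apply/ler_addgt0Pr => d d0.
have lim (s : seq X) (d' : R) : 0 < d' -> exists K, forall m, (K <= m)%N ->
    \sum_(t <- s) cabs (u m t - f t) * v t <= d'.
  elim: s d' => [|t s IH] d' d'0; first by exists 0%N => m _; rewrite big_nil ltW.
  have d20 : 0 < d' / 2 by rewrite divr_gt0.
  have [K hK] := IH _ d20; have [L hL] := hf t _ (divr_gt0 d20 (v0 t)).
  exists (maxn K L) => m; rewrite geq_max => /andP[Km Lm].
  rewrite big_cons [d']splitr; apply: lerD; last exact: hK.
  by rewrite -ler_pdivlMr//; exact: hL.
have [K hK] := lim A _ d0.
have h1 := hN _ _ Nn (leq_maxl N K) A; have h2 := hK _ (leq_maxr N K).
apply: le_trans (lerD h1 h2); rewrite -big_split /=; apply: ler_sum => t _.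
rewrite -mulrDl ler_wpM2r ?(ltW (v0 t))//.
have -> : (u n - f) t = (u n - u (maxn N K)) t + (u (maxn N K) t - f t).
  by rewrite !fctE subrKA.
exact: le_normcD.
Qed.

Lemma nle_delta v t : (forall s, 0 <= v s) ->
  nle v (fun s => (s == t)%:R : R[i]^o) (v t).
Proof.
move=> v0 A.
have d1 s : cabs ((s == t)%:R : R[i]) * v s = if s == t then v t else 0.
  case: eqP => [->|_]; first by rewrite ComplexField.Normc.normc1 mul1r.
  by rewrite ComplexField.Normc.normc0 mul0r.
rewrite (eq_bigr _ (fun s _ => d1 s)).
have [tA|tA] := boolP (t \in A).
  rewrite (big_fsetD1 t tA) /= eqxx big1_seq ?addr0// => s /=.
  by rewrite in_fsetD1 => /andP[/negbTE ->].
by rewrite big1_seq// => s /= sA; case: eqP => // st; rewrite -st sA in tA.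
Qed.

End WeightedNorm.

(** * Spaces with a weighted basis *)

Section Basis.
Variable R : realType.

(** Directed downwards, because a smaller weight gives a larger space: two small sets are then
    bounded for a common weight. *)
Record weights (X : Type) := Weights {
  wt :> (X -> R) -> Prop;
  wt_gt0 : forall v, wt v -> forall x, 0 < v x;
  wt_nonempty : exists v, wt v;
  wt_directed : forall u v, wt u -> wt v ->
    exists w, [/\ wt w, forall x, w x <= u x & forall x, w x <= v x] }.

(* V is the union of the weighted spaces l^1(X, v), v in wt, a set being small if
   it is bounded in one of them. *)
Record basis (X : choiceType) (V : bornSpace R) := MkBasis {
  bwt :> weights X;
  coord : V -> X -> R[i]^o;
  bvec : X -> V;
  coord_linear : linear coord;
  coord_inj : injective coord;
  coord_surj : forall v f M, bwt v -> nle v f M -> exists x, coord x = f;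
  coord_bvec : forall x, coord (bvec x) = fun y => (y == x)%:R;
  smallP : forall A, small A <-> exists2 v, bwt v &
    exists M, forall x, A x -> nle v (coord x) M }.

Section Theory.
Variables (X : choiceType) (V : bornSpace R) (B : basis X V).
Local Notation c := (coord B).
Local Notation d := (bvec B).

Let v_ge0 v : B v -> forall t, 0 <= v t.
Proof. by move=> Bv t; apply/ltW/(wt_gt0 Bv). Qed.

Lemma coord_eq x y : c x =1 c y -> x = y.
Proof. by move=> h; apply: (@coord_inj _ _ B); apply/funext. Qed.

Lemma coord_fin x : exists2 v, B v & exists M, nle v (c x) M.
Proof.
have /(smallP B)[v Bv [M hM]] := small1 x.
by exists v => //; exists M; exact: hM.
Qed.

Definition ball v (M : R) : set V := [set x | nle v (c x) M].

Lemma small_ball v M : B v -> small (ball v M).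
Proof. by move=> Bv; apply/(smallP B); exists v => //; exists M. Qed.

Lemma disk_ball v M : B v -> 0 <= M -> disk (ball v M).
Proof.
move=> /v_ge0 v0 M0; split=> [|a b x y ab hx hy]; rewrite /ball /=.
  by rewrite lin0; [apply: nleW (nle0 v)|exact: coord_linear].
rewrite (coord_linear B) (linZ (coord_linear B)).
apply: nleW (nleP a v0 hx (nleZ b v0 hy)).
by rewrite -mulrDl ler_piMl.
Qed.

Lemma absorbed_ball v M r x : B v -> 0 < r ->
  absorbed (ball v M) r x <-> nle v (c x) (r * M).
Proof.
move=> /v_ge0 v0 r0; split=> [[t ht ->]|h].
  by rewrite (linZ (coord_linear B)) -{2}(cabsR (ltW r0)); exact: nleZ.
exists ((r%:C%C)^-1 *: x); last first.
  by rewrite scalerA divff ?scale1r// fmorph_eq0 gt_eqF.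
rewrite /ball /= (linZ (coord_linear B)); have := nleZ (r%:C%C)^-1 v0 h.
by rewrite ComplexField.Normc.normcV (cabsR (ltW r0)) mulKf// gt_eqF.
Qed.

Lemma ball_banach v M : B v -> 0 < M -> banach_disk (ball v M).
Proof.
move=> Bv M0; have dB := disk_ball Bv (ltW M0); have v0 := wt_gt0 Bv.
have lc := coord_linear B.
split=> // [x xB gx|u uB cu].
  apply: coord_eq => t; rewrite (lin0 lc); apply: ComplexField.Normc.eq0_normc.
  apply/eqP; rewrite eq_le cabs_ge0 andbT; apply/ler_addgt0Pr => e e0; rewrite add0r.
  (* With this radius the coordinate estimate reads [cabs (c x t) * v t <= e * v t]. *)
  have r0 : 0 < e * v t / M by rewrite divr_gt0// mulr_gt0.
  have /(absorbed_ball _ _ Bv r0)/(nle_point t) : absorbed (ball v M) (e * v t / M) x.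
    by apply: gauge_lt => //; rewrite gx.
  by rewrite divfK ?gt_eqF// ler_pM2r.
have [e e0|f hf] := @nle_cauchy _ _ v (fun n => c (u n)) v0.
  have eM : 0 < e / M by rewrite divr_gt0.
  have [N hN] := cu _ eM; exists N => m n Nm Nn.
  rewrite -(linB lc) -[e](divfK (negbT (gt_eqF M0))).
  apply/(absorbed_ball _ _ Bv eM)/gauge_lt => //; last exact: hN.
  by rewrite -scaleN1r addrC; apply: ssP.
have [N hN] := hf _ ltr01.
(* The limit f lies within distance 1 of [c (u N)], hence has finite norm and is the coordinate
   function of a vector. *)
have [x fx] : exists x, c x = f.
  have /(lspanE _ dB)[r r0 /(absorbed_ball _ _ Bv r0) hr] := uB N.
  apply: (coord_surj Bv (M := 1 + r * M)); rewrite -[f](subrK (c (u N))).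
  apply: nleD => //; first exact: v_ge0.
  by rewrite -opprB; apply: nleN; exact: hN (leqnn N).
have hx (e : R) : 0 < e -> exists N, forall n, (N <= n)%N -> absorbed (ball v M) e (u n - x).
  move=> e0; have [K hK] := hf _ (mulr_gt0 e0 M0); exists K => n Kn.
  by apply/absorbed_ball => //; rewrite (linB lc) fx; exact: hK.
exists x; last exact: gauge_cvg0.
have [K hK] := hx _ ltr01.
rewrite -[x](subKr (u K)) -scaleN1r addrC; apply: ssP => //.
by apply/lspanE => //; exists 1 => //; exact: hK.
Qed.

Lemma basis_complete : bcomplete V.
Proof.
move=> S /(smallP B)[v Bv [M hM]]; exists (ball v (Num.max M 1)).
have M0 : 0 < Num.max M 1 by rewrite lt_max ltr01 orbT.
split; [exact: small_ball|exact: ball_banach|move=> x /hM].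
by apply: nleW; rewrite le_max lexx.
Qed.

Definition trunc (A : {fset X}) (x : V) : V := \sum_(t <- A) c x t *: d t.

Lemma coord_trunc A x : c (trunc A x) = c x - outside A (c x).
Proof.
apply/funext => s; rewrite /trunc (lin_sum (coord_linear B)).
rewrite fct_sumE !fctE /outside.
have E t : c (c x t *: d t) s = if t == s then c x s else 0.
  rewrite (linZ (coord_linear B)) coord_bvec fctE eq_sym.
  by case: eqP => [->|_]; rewrite ?scaler0// /GRing.scale /= mulr1.
rewrite (eq_bigr _ (fun t _ => E t)); case: ifP => sA.
  rewrite subr0 (big_fsetD1 s sA) /= eqxx big1_seq ?addr0// => t /=.
  by rewrite in_fsetD1 => /andP[/negbTE ->].
rewrite subrr big1_seq// => t /= tA; case: eqP => // ts.
by rewrite -ts tA in sA.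
Qed.

Lemma trunc_cvg v M x : B v -> nle v (c x) M -> forall e : R, 0 < e ->
  exists A0 : {fset X}, forall A, (A0 `<=` A)%fset -> nle v (c (x - trunc A x)) e.
Proof.
move=> Bv hx e e0; have [A0 hA0] := nle_tail (v_ge0 Bv) hx e0.
exists A0 => A AA; rewrite (linB (coord_linear B)) coord_trunc subKr.
by apply: outside_sub hA0 => //; exact: v_ge0.
Qed.

Lemma trunc_lspan (P : subspace V) A x : (forall t, P (d t)) -> P (trunc A x).
Proof.
move=> Pd; rewrite /trunc; elim: (A : seq X) => [|t s IH].
  by rewrite big_nil; exact: ss0.
by rewrite big_cons; exact: ssP.
Qed.

(** Truncations with tails at most 1/(n+1) converge in a ball of the weight. The form with a closed
    subspace P covers equality of two bounded maps as well as membership in [balanced]. *)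
Lemma dense_basis (P : subspace V) : bclosed P -> (forall t, P (d t)) ->
  forall x, P x.
Proof.
move=> cP Pd x; have [v Bv [M hM]] := coord_fin x.
have e0 n : 0 < n.+1%:R^-1 :> R by rewrite invr_gt0.
have /(_ _)/cid-/all_sig[A hA] n := trunc_cvg Bv hM (e0 n).
apply: (cP (fun n => trunc (A n) x)) => [n|]; first exact: trunc_lspan.
have dB := disk_ball Bv ler01.
have L y N : nle v (c y) N -> lspan (ball v 1) y.
  move=> hy; have N0 := nle_ge0 hy; apply/lspanE => //; exists (N + 1).
    by rewrite ltr_wpDl.
  apply/absorbed_ball => //; first by rewrite ltr_wpDl.
  by apply: nleW hy; rewrite mulr1 lerDl.
apply: (bcvgP (T := ball v 1)) => //; [exact: small_ball|exact: L hM| |].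
  move=> e e00; have [N hN] := ex_invS e00.
  exists N => n Nn; apply/absorbed_ball => //; rewrite mulr1 -opprB.
  rewrite -scaleN1r (linZ (coord_linear B)) scaleN1r; apply: nleN.
  by apply: nleW (hA n _ (fsubset_refl _)); exact: hN.
move=> n; apply: (L _ (M + M)); rewrite coord_trunc.
apply: nleD => //; first exact: v_ge0.
by apply: nleN; apply: nle_outside => //; exact: v_ge0.
Qed.

Lemma basis_ext (Z : bornSpace R) (f g : V -> Z) : bcomplete Z -> blin f -> blin g ->
  (forall t, f (d t) = g (d t)) -> f = g.
Proof.
move=> cZ bf bg fg; apply/funext => x.
have [lf _] := bf; have [lg _] := bg.
exact: (dense_basis (P := equalizer lf lg) (blin_ker_closed cZ bf bg)).
Qed.

End Theory.
End Basis.

(** * Extending a map of the index set to a bounded linear map *)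

Section Extension.
Variables (R : realType) (X : choiceType) (V : bornSpace R) (B : basis X V).
Variables (Z : bornSpace R) (cZ : bcomplete Z) (phi : X -> Z).
(** After division by v this says that one small disk absorbs each [phi t] with factor [v t], so
    that the series of the [f t *: phi t] converges absolutely there when f has finite v-norm. *)
Hypothesis phi_small : forall v, B v ->
  small [set ((v x)%:C%C)^-1 *: phi x | x in [set: X]].
Implicit Types (T : set Z) (f : X -> R[i]^o) (z : Z) (A : {fset X}).
Local Notation c := (coord B).

Let psum A f : Z := \sum_(t <- A) (f t : R[i]) *: phi t.

Let psum_linear A : linear (psum A).
Proof.
move=> a f g; rewrite /psum scaler_sumr -big_split /=; apply: eq_bigr => t _.
by rewrite !fctE scalerDl scalerA.
Qed.

Let sumlim T f z := forall e : R, 0 < e ->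
  exists A0 : {fset X}, forall A, (A0 `<=` A)%fset -> absorbed T e (psum A f - z).

(** Unconditional summation to z in some small Banach disk. The disk depends on the weight for which
    f is finite, hence the existential; two disks are merged by completeness of Z. *)
Let spec f z := exists T, [/\ small T, banach_disk T & sumlim T f z].

Let sumlimS T T' f z : T `<=` T' -> sumlim T f z -> sumlim T' f z.
Proof.
move=> TT h e e0; have [A0 hA] := h e e0; exists A0 => A AA.
exact: absorbedS (hA _ AA).
Qed.

Let spec_comb a f g z w : spec f z -> spec g w -> spec (a *: f + g) (a *: z + w).
Proof.
move=> [T [sT bT hT]] [U [sU bU hU]].
have [D [sD bD sub]] := cZ (smallU sT sU).
have {}hT : sumlim D f z by apply: sumlimS hT => y Ty; apply: sub; left.
have {}hU : sumlim D g w by apply: sumlimS hU => y Ty; apply: sub; right.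
exists D; split=> // e e0.
have ca : 0 < cabs a + 1 by rewrite ltr_wpDl ?cabs_ge0.
(* Chosen so that [cabs a * e' + e' = e]. *)
have e'0 : 0 < e / (cabs a + 1) by rewrite divr_gt0.
have [A0 h0] := hT _ e'0; have [A1 h1] := hU _ e'0.
exists (A0 `|` A1)%fset => A; rewrite fsubUset => /andP[/h0 k0 /h1 k1].
have dD : disk D by case: bD.
have := absorbedP a dD (ltW e'0) (ltW e'0) k0 k1.
have -> : cabs a * (e / (cabs a + 1)) + e / (cabs a + 1) = e.
  by rewrite -[X in _ + X]mul1r -mulrDl mulrC divfK// gt_eqF.
by rewrite psum_linear scalerBr addrACA opprD.
Qed.

(** Subtracting the two specifications for the same f exhibits [w - z] as a limit of zero sums. *)
Let spec_unique f z w : spec f z -> spec f w -> z = w.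
Proof.
move=> hz hw; have [T [sT bT h]] := spec_comb (-1) hz hw.
apply/eqP; rewrite eq_sym -subr_eq0; apply/eqP; apply: (banach_eq0 bT) => e e0.
have dT : disk T by case: bT.
have [A0 /(_ _ (fsubset_refl _)) hA] := h e e0.
have := absorbedZ (-1) dT (ltW e0) hA.
rewrite normcN ComplexField.Normc.normc1 mul1r !scaleN1r addNr.
by rewrite (lin0 (psum_linear _)) sub0r opprK addrC.
Qed.

Section Convergence.
Variables (T : set Z) (v : X -> R).
Hypotheses (sT : small T) (bT : banach_disk T) (v0 : forall t, 0 <= v t).
Hypothesis phiT : forall t, absorbed T (v t) (phi t).

Let dT : disk T. Proof. by case: bT. Qed.

Let psum_absorbed A f M : nle v f M -> absorbed T M (psum A f).
Proof.
move=> hf.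
have s0 : 0 <= \sum_(t <- A) cabs (f t) * v t.
  by apply: sumr_ge0 => t _; rewrite mulr_ge0 ?cabs_ge0.
apply: (absorbedW dT s0 (hf A)); apply: absorbed_sum => // t _; split.
  by rewrite mulr_ge0 ?cabs_ge0.
exact: absorbedZ.
Qed.

(** Both sums are rewritten over A: cutting f down to A0 leaves the sum over A0 unchanged, and the
    difference is the sum of the tail [outside A0 f]. *)
Let psum_tail (A0 A : {fset X}) f e : (A0 `<=` A)%fset -> nle v (outside A0 f) e ->
  absorbed T e (psum A f - psum A0 f).
Proof.
move=> AA h; have := psum_absorbed A h.
suff -> : psum A (outside A0 f) = psum A f - psum A0 f by [].
have -> : psum A0 f = psum A (f - outside A0 f).
  have -> : psum A0 f = psum A0 (f - outside A0 f).
    rewrite /psum big_seq [RHS]big_seq; apply: eq_bigr => t tA.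
    by rewrite !fctE /outside tA subr0.
  apply: big_fset_incl => // t _ tA.
  by rewrite !fctE /outside (negbTE tA) subrr scale0r.
by rewrite -(linB (psum_linear A)) subKr.
Qed.

(** Sums over sets with tail at most 1/(n+1) form a Cauchy sequence, compared through the union of
    two such sets. The 1 in [M + 1] is the distance from the limit to one partial sum. *)
Let sumlim_exists f M : nle v f M -> exists2 z, sumlim T f z & absorbed T (M + 1) z.
Proof.
move=> hf; have e0 n : 0 < n.+1%:R^-1 :> R by rewrite invr_gt0.
have /(_ _)/cid-/all_sig[A hA] n := nle_tail v0 hf (e0 n).
pose u n := psum (A n) f.
have uT n : lspan T (u n).
  apply/lspanE => //; exists (M + 1); first by rewrite ltr_wpDl// (nle_ge0 hf).
  by apply: absorbedW (psum_absorbed _ hf); rewrite ?lerDl// (nle_ge0 hf).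
have [e e1|z zT hz] := banach_cauchy bT uT.
  have e20 : 0 < e / 2 by rewrite divr_gt0.
  have [N hN] := ex_invS e20; exists N => m n Nm Nn.
  have hm := psum_tail (fsubsetUl (A m) (A n)) (nleW (hN _ Nm) (hA m)).
  have hn := psum_tail (fsubsetUr (A m) (A n)) (nleW (hN _ Nn) (hA n)).
  have := absorbedB dT (ltW e20) (ltW e20) hn hm.
  by rewrite -splitr opprB addrC subrKA.
have lz : sumlim T f z.
  move=> e e1; have e20 : 0 < e / 2 by rewrite divr_gt0.
  have [N hN] := ex_invS e20; have [K hK] := hz _ e20.
  exists (A (maxn N K)) => D AD.
  have h1 := psum_tail AD (nleW (hN _ (leq_maxl _ _)) (hA _)).
  have := absorbedD dT (ltW e20) (ltW e20) h1 (hK _ (leq_maxr N K)).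
  by rewrite -splitr subrKA.
exists z => //; have [A0 /(_ _ (fsubset_refl _)) hA0] := lz _ ltr01.
have := absorbedB dT (nle_ge0 hf) ler01 (psum_absorbed A0 hf) hA0.
by rewrite subKr.
Qed.

Lemma extension_bound f M : nle v f M -> exists2 z, spec f z & absorbed T (M + 1) z.
Proof.
move=> hf; have [z hz zT] := sumlim_exists hf; exists z => //.
by exists T.
Qed.

End Convergence.

Lemma phi_absorbed v : B v -> exists T, [/\ small T, banach_disk T &
  forall t, absorbed T (v t) (phi t)].
Proof.
move=> Bv; have [T [sT bT sub]] := cZ (phi_small Bv).
exists T; split=> // t; exists ((v t)%:C%C^-1 *: phi t); first by apply: sub; exists t.
by rewrite scalerA divff ?scale1r// fmorph_eq0 gt_eqF// (wt_gt0 Bv).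
Qed.

Lemma basis_extend : exists F : V -> Z, blin F /\ forall t, F (bvec B t) = phi t.
Proof.
pose F x := the 0 (spec (c x)).
have FP x : spec (c x) (F x).
  apply: theP; have [v Bv [M hM]] := coord_fin B x.
  have [T [sT bT hT]] := phi_absorbed Bv.
  have v0 t : 0 <= v t by apply/ltW/(wt_gt0 Bv).
  by have [z] := extension_bound sT bT v0 hT hM; exists z.
(* [F] is defined by description; from here on, exhibiting a sum determines its value. *)
have FE x z : spec (c x) z -> F x = z by apply: spec_unique.
exists F; split; first split.
- move=> a x y; apply: FE; rewrite (coord_linear B); exact: spec_comb.
- move=> A /(smallP B)[v Bv [M hM]]; have [T [sT bT hT]] := phi_absorbed Bv.
  have v0 t : 0 <= v t by apply/ltW/(wt_gt0 Bv).
  apply: sub_small (smallZ (M + 1)%:C%C sT) => _ [x /hM hx <-].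
  have [z /FE -> [t Tt ->]] := extension_bound sT bT v0 hT hx.
  by exists t.
move=> t; apply: FE; have [v Bv] := wt_nonempty B.
have [T [sT bT hT]] := phi_absorbed Bv.
exists T; split=> // e e0; exists [fset t]%fset => A; rewrite fsub1set => tA.
rewrite /psum coord_bvec (big_fsetD1 t tA) /= eqxx scale1r big1_seq ?addr0.
  by rewrite subrr; apply: absorbed0; case: bT.
by move=> s /=; rewrite in_fsetD1 => /andP[/negbTE -> _]; rewrite scale0r.
Qed.

End Extension.

Lemma small_bvec_map (R : realType) (X : Type) (Y : choiceType) (W : bornSpace R)
    (C : basis Y W) (h : X -> Y) (v : X -> R) (u : Y -> R) (K : R) :
  (forall x, 0 < v x) -> C u -> (forall x, u (h x) <= K * v x) ->
  small [set ((v x)%:C%C)^-1 *: bvec C (h x) | x in [set: X]].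
Proof.
move=> v_gt0 Cu hK; apply/(smallP C); exists u => //; exists K => _ [x _ <-].
have u0 t : 0 <= u t by apply/ltW/(wt_gt0 Cu).
have v0 := v_gt0 x.
rewrite (linZ (coord_linear C)) coord_bvec.
apply: nleW (nleZ _ u0 (nle_delta _ u0)).
rewrite ComplexField.Normc.normcV (cabsR (ltW v0)).
by rewrite mulrC ler_pdivrMr.
Qed.

Lemma basis_map (R : realType) (X Y : choiceType) (V W : bornSpace R)
    (B : basis X V) (C : basis Y W) (h : X -> Y) :
  (forall v, B v -> exists2 u, C u & exists K, forall x, u (h x) <= K * v x) ->
  exists F : V -> W, blin F /\ forall x, F (bvec B x) = bvec C (h x).
Proof.
move=> hW; apply: basis_extend; first exact: basis_complete C.
move=> v Bv; have [u Cu [K hK]] := hW v Bv.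
exact: small_bvec_map (wt_gt0 Bv) Cu hK.
Qed.

Section Bilinear.
Variable R : realType.
Implicit Types V W Z : bornSpace R.

Lemma bbilin_blin_l V W Z (b : V -> W -> Z) w : bbilin b -> blin (b^~ w).
Proof.
move=> [l1 l2 s]; split=> // A sA.
apply: sub_small (s _ _ sA (small1 w)) => _ [x Ax <-].
by exists x => //; exists w.
Qed.

Lemma bbilin_blin_r V W Z (b : V -> W -> Z) v : bbilin b -> blin (b v).
Proof.
move=> [l1 l2 s]; split=> // A sA.
apply: sub_small (s _ _ (small1 v) sA) => _ [x Ax <-].
by exists v => //; exists x.
Qed.

Lemma blin_bbilin V W Z Z' (f : Z -> Z') (b : V -> W -> Z) :
  blin f -> bbilin b -> bbilin (fun v w => f (b v w)).
Proof.
move=> [lf bf] [l1 l2 s]; split=> [w a x y|v a x y|A B sA sB].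
- by rewrite l1 lf.
- by rewrite l2 lf.
- apply: sub_small (bf _ (s _ _ sA sB)) => _ [x Ax [y By <-]].
  by exists (b x y) => //; exists x => //; exists y.
Qed.

Lemma bbilin_blin V V' W W' Z (f : V -> V') (g : W -> W') (b : V' -> W' -> Z) :
  blin f -> blin g -> bbilin b -> bbilin (fun v w => b (f v) (g w)).
Proof.
move=> [lf bf] [lg bg] [l1 l2 s]; split=> [w a x y|v a x y|A B sA sB].
- by rewrite lf l1.
- by rewrite lg l2.
- apply: sub_small (s _ _ (bf _ sA) (bg _ sB)) => _ [x Ax [y By <-]].
  by exists (f x); [exists x|exists (g y) => //; exists y].
Qed.

Lemma bbilin_swap V W Z (b : V -> W -> Z) : bbilin b -> bbilin (fun w v => b v w).
Proof.
move=> [l1 l2 s]; split=> // A B sA sB.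
apply: sub_small (s _ _ sB sA) => _ [x Ax [y By <-]].
by exists y => //; exists x.
Qed.

Lemma basis_ext2 (X Y : choiceType) V W Z (B : basis X V) (C : basis Y W)
    (b b' : V -> W -> Z) : bcomplete Z -> bbilin b -> bbilin b' ->
  (forall x y, b (bvec B x) (bvec C y) = b' (bvec B x) (bvec C y)) ->
  forall v w, b v w = b' v w.
Proof.
move=> cZ hb hb' E v w.
suff -> : b v = b' v by [].
apply: (basis_ext (B := C)) => //; [exact: bbilin_blin_r|exact: bbilin_blin_r|].
move=> y; suff : b^~ (bvec C y) = b'^~ (bvec C y) by move=> /(congr1 (@^~ v)).
by apply: (basis_ext (B := B)) => //; exact: bbilin_blin_l.
Qed.

Lemma small_bvec (X : choiceType) V (B : basis X V) v : B v ->
  small [set ((v x)%:C%C)^-1 *: bvec B x | x in [set: X]].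
Proof.
move=> Bv; apply: (small_bvec_map (h := idfun) (K := 1) (wt_gt0 Bv) Bv) => x.
by rewrite mul1r.
Qed.

End Bilinear.

(** * The function space attached to a directed family of weights *)

Section Model.
Variables (R : realType) (X : choiceType) (W : weights R X).

Let W_ge0 v : W v -> forall t, 0 <= v t.
Proof. by move=> Wv t; apply/ltW/(wt_gt0 Wv). Qed.

Let W_common u v f g M N : W u -> W v -> nle u f M -> nle v g N ->
  exists w, [/\ W w, nle w f M & nle w g N].
Proof.
move=> Wu Wv hf hg; have [w [Ww wu wv]] := wt_directed Wu Wv; exists w; split=> //.
  by rewrite -[M]mul1r; apply: nle_weight hf => // t; rewrite mul1r.
by rewrite -[N]mul1r; apply: nle_weight hg => // t; rewrite mul1r.
Qed.

Let msum (f : X -> R[i]^o) := exists2 v, W v & exists M, nle v f M.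

Let msum0 : msum 0.
Proof. by have [v Wv] := wt_nonempty W; exists v => //; exists 0; exact: nle0. Qed.

Let msumP a f g : msum f -> msum g -> msum (a *: f + g).
Proof.
move=> [u Wu [M hM]] [v Wv [N hN]]; have [w [Ww h k]] := W_common Wu Wv hM hN.
by exists w => //; exists (cabs a * M + N); apply: nleP => //; exact: W_ge0.
Qed.

Definition model_sub : subspace (X -> R[i]^o) := Subspace msum0 msumP.

Definition model_small : set (set (ss_type model_sub)) :=
  [set A | exists2 v, W v & exists M, forall x, A x -> nle v (val x) M].

Let model_small1 x : model_small [set x].
Proof.
by have /asboolP[v Wv [M hM]] := valP x; exists v => //; exists M => _ ->.
Qed.

Let model_sub_small A B : A `<=` B -> model_small B -> model_small A.
Proof. by move=> AB [v Wv [M hM]]; exists v => //; exists M => x /AB /hM. Qed.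

Let model_common A B : model_small A -> model_small B -> exists2 w, W w &
  exists M, exists2 N, forall x, A x -> nle w (val x) M & forall x, B x -> nle w (val x) N.
Proof.
move=> [u Wu [M hM]] [v Wv [N hN]]; have [w [Ww wu wv]] := wt_directed Wu Wv.
exists w => //; exists M, N => x /[dup] _.
  by move=> /hM h; rewrite -[M]mul1r; apply: nle_weight h => // t; rewrite mul1r.
by move=> /hN h; rewrite -[N]mul1r; apply: nle_weight h => // t; rewrite mul1r.
Qed.

Let model_smallU A B : model_small A -> model_small B -> model_small (A `|` B).
Proof.
move=> sA sB; have [w Ww [M [N hA hB]]] := model_common sA sB.
exists w => //; exists (Num.max M N) => x [/hA|/hB]; apply: nleW.
  by rewrite le_max lexx.
by rewrite le_max lexx orbT.
Qed.

Let model_smallD A B : model_small A -> model_small B ->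
  model_small [set a + b | a in A & b in B].
Proof.
move=> sA sB; have [w Ww [M [N hA hB]]] := model_common sA sB.
exists w => //; exists (M + N) => _ [x /hA hx [y /hB hy <-]].
by rewrite ss_valD; apply: nleD => //; exact: W_ge0.
Qed.

Let model_smallZ c A : model_small A -> model_small [set c *: a | a in A].
Proof.
move=> [v Wv [M hM]]; exists v => //; exists (cabs c * M) => _ [x /hM hx <-].
by rewrite ss_valZ; apply: nleZ => //; exact: W_ge0.
Qed.

Let model_small_hull A : model_small A -> model_small (hull A).
Proof.
move=> [v Wv [M hM]]; exists v => //; exists (Num.max M 0) => x hx.
have v0 := W_ge0 Wv.
apply: (hx (val @^-1` [set f | nle v f (Num.max M 0)])) => [|y /hM]; last first.
  by apply: nleW; rewrite le_max lexx.
apply: preimage_disk; first exact: ss_valP.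
split=> [|a b f g ab hf hg].
  by apply: nleW (nle0 v); rewrite le_max lexx orbT.
apply: nleW (nleP a v0 hf (nleZ b v0 hg)).
by rewrite -mulrDl ler_piMl// le_max lexx orbT.
Qed.

Definition model : bornSpace R := BornSpace model_small1 model_sub_small
  model_smallU model_smallD model_smallZ model_small_hull.

Let deltaP x : model_sub (fun y => (y == x)%:R).
Proof.
have [v Wv] := wt_nonempty W; exists v => //; exists (v x).
by apply: nle_delta; exact: W_ge0.
Qed.

Let model_delta x : model := Sub (fun y => (y == x)%:R) (asboolT (deltaP x)).

Let mcoord (x : model) : X -> R[i]^o := val x.

Let mcoord_linear : linear mcoord. Proof. exact: ss_valP. Qed.

Let mcoord_inj : injective mcoord. Proof. exact: val_inj. Qed.

Let mcoord_surj v f M : W v -> nle v f M -> exists x, mcoord x = f.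
Proof.
move=> Wv hf; have fP : model_sub f by exists v => //; exists M.
by exists (Sub f (asboolT fP)); exact: SubK.
Qed.

Let mcoord_delta x : mcoord (model_delta x) = fun y => (y == x)%:R.
Proof. exact: SubK. Qed.

Definition model_basis : basis X model :=
  @MkBasis R X model W mcoord model_delta mcoord_linear mcoord_inj mcoord_surj
    mcoord_delta (fun A => iff_refl _).

End Model.

(** Ends with [Defined] because the weights and basis vectors of the transported basis must reduce
    to those of B. *)
Definition basis_iso (R : realType) (X : choiceType) (V W : bornSpace R)
  (B : basis X W) (f : V -> W) (g : W -> V) : blin f -> blin g ->
  cancel f g -> cancel g f -> basis X V.
Proof.
move=> bf bg fg gf.
apply: (@MkBasis _ _ V B (fun x => coord B (f x)) (fun x => g (bvec B x))).
- by move=> a x y; rewrite (proj1 bf) (coord_linear B).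
- by move=> x y /(@coord_inj _ _ _ B)/(can_inj fg).
- move=> v h M Bv hM; have [x <-] := coord_surj Bv hM.
  by exists (g x); rewrite gf.
- by move=> x; rewrite gf coord_bvec.
- move=> A; split=> [sA|[v Bv [M hM]]].
    have [v Bv [M hM]] := (smallP B (f @` A)).1 (proj2 bf _ sA).
    by exists v => //; exists M => x Ax; apply: hM; exists x.
  apply: (@sub_small _ _ _ (g @` (f @` A))) => [x Ax|].
    by exists (f x) => //; exists x.
  apply: (proj2 bg); apply/(smallP B); exists v => //; exists M => _ [x /hM h <-].
  exact: h.
Defined.

(** * The completed tensor product of two spaces with basis *)

Section TensorBasis.
Variables (R : realType) (X Y : choiceType) (V W : bornSpace R).
Variables (B : basis X V) (C : basis Y W).

Definition prodw (p : X * Y -> R) : Prop :=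
  exists u v, [/\ B u, C v & p = fun z => u z.1 * v z.2].

Definition prod_weights : weights R (X * Y)%type.
Proof.
apply: (@Weights _ _ prodw).
- move=> _ [u [v [Bu Cv ->]]] z.
  by rewrite mulr_gt0// ?(wt_gt0 Bu)// (wt_gt0 Cv).
- have [u Bu] := wt_nonempty B; have [v Cv] := wt_nonempty C.
  by exists (fun z => u z.1 * v z.2); exists u, v.
- move=> _ _ [u [v [Bu Cv ->]]] [u' [v' [Bu' Cv' ->]]].
  have [p [Bp pu pu']] := wt_directed Bu Bu'.
  have [q [Cq qv qv']] := wt_directed Cv Cv'.
  exists (fun z => p z.1 * q z.2); split; first by exists p, q.
    by move=> z; apply: ler_pM => //; apply/ltW; [exact: (wt_gt0 Bp)|exact: (wt_gt0 Cq)].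
  by move=> z; apply: ler_pM => //; apply/ltW; [exact: (wt_gt0 Bp)|exact: (wt_gt0 Cq)].
Defined.

(** A finite set of pairs lies in the rectangle spanned by its projections, over which the sum
    factors. *)
Lemma nle_prod (u : X -> R) (v : Y -> R) (f : X -> R[i]^o) (g : Y -> R[i]^o) M N :
  (forall t, 0 <= u t) -> (forall t, 0 <= v t) -> nle u f M -> nle v g N ->
  nle (fun z => u z.1 * v z.2) (fun z => f z.1 * g z.2 : R[i]^o) (M * N).
Proof.
move=> u0 v0 hf hg A.
pose A1 := [fset z.1 | z in A]%fset; pose A2 := [fset z.2 | z in A]%fset.
pose S := [seq (x, y) | x <- A1, y <- A2].
pose F (z : X * Y) := cabs (f z.1 * g z.2) * (u z.1 * v z.2).
have F0 z : 0 <= F z by rewrite /F !mulr_ge0 ?cabs_ge0.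
have uS : uniq S by apply: allpairs_uniq; rewrite ?fset_uniq// => -[? ?] [? ?].
have AS : \sum_(z <- A) F z <= \sum_(z <- S) F z.
  rewrite [leRHS](bigID (mem A)) /= -[X in _ <= X + _]big_filter.
  rewrite [X in _ <= X + _](perm_big A) /=; first by rewrite lerDl sumr_ge0.
  apply: uniq_perm; rewrite ?filter_uniq ?fset_uniq// => z.
  rewrite mem_filter /=; case: (boolP (z \in A)) => //= zA.
  by case: z zA => x y zA; apply: allpairs_f; apply/imfsetP; exists (x, y).
apply: (le_trans AS); rewrite big_allpairs.
have -> : \sum_(x <- A1) \sum_(y <- A2) F (x, y) =
    (\sum_(x <- A1) cabs (f x) * u x) * (\sum_(y <- A2) cabs (g y) * v y).
  rewrite mulr_suml; apply: eq_bigr => x _; rewrite mulr_sumr; apply: eq_bigr => y _.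
  by rewrite /F /= ComplexField.Normc.normcM mulrACA.
apply: ler_pM => //; apply: sumr_ge0 => t _; by rewrite mulr_ge0 ?cabs_ge0.
Qed.

Let tfun (v : V) (w : W) : X * Y -> R[i]^o := fun z => coord B v z.1 * coord C w z.2.

Let tfun_sub v w : model_sub prod_weights (tfun v w).
Proof.
have [p Bp [M hM]] := coord_fin B v; have [q Cq [N hN]] := coord_fin C w.
exists (fun z => p z.1 * q z.2); first by exists p, q.
by exists (M * N); apply: nle_prod => // t; apply/ltW; [exact: (wt_gt0 Bp)|exact: (wt_gt0 Cq)].
Qed.

Let tmod (v : V) (w : W) : model prod_weights := Sub (tfun v w) (asboolT (tfun_sub v w)).

Let tmod_bvec x y : tmod (bvec B x) (bvec C y) = bvec (model_basis prod_weights) (x, y).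
Proof.
apply: val_inj; rewrite !SubK /tfun !coord_bvec; apply/funext => -[s t] /=.
by rewrite -natrM mulnb.
Qed.

Let val_tmod v w : val (tmod v w) = tfun v w. Proof. by []. Qed.

Let tmod_bbilin : bbilin tmod.
Proof.
split=> [w a x y|v a x y|A D /(smallP B)[p Bp [M hM]] /(smallP C)[q Cq [N hN]]].
- apply: val_inj; rewrite ss_valP !val_tmod /tfun (coord_linear B); apply/funext => z.
  by rewrite !fctE mulrDl /GRing.scale /= mulrA.
- apply: val_inj; rewrite ss_valP !val_tmod /tfun (coord_linear C); apply/funext => z.
  by rewrite !fctE mulrDr /GRing.scale /= mulrCA.
- exists (fun z => p z.1 * q z.2); first by exists p, q.
  exists (M * N) => _ [x /hM hx [y /hN hy <-]]; rewrite val_tmod.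
  by apply: nle_prod => // t; apply/ltW; [exact: (wt_gt0 Bp)|exact: (wt_gt0 Cq)].
Qed.

(** For a product weight the smallness needed to extend b is exactly the boundedness of b on the two
    small sets of basis vectors scaled by u and by v. *)
Lemma model_tensor : is_tensor (Pretensor tmod).
Proof.
split=> [||Z cZ b hb]; [exact: basis_complete (model_basis _)|exact: tmod_bbilin|].
have [_ _ sb] := hb; have [l1 l2 _] := hb.
have [|F [bF FE]] := @basis_extend _ _ _ (model_basis prod_weights) Z cZ
    (fun z => b (bvec B z.1) (bvec C z.2)).
  move=> _ [u [v [Bu Cv ->]]].
  apply: sub_small (sb _ _ (small_bvec Bu) (small_bvec Cv)) => _ [[x y] _ <-] /=.
  exists ((u x)%:C%C^-1 *: bvec B x); first by exists x.
  exists ((v y)%:C%C^-1 *: bvec C y); first by exists y.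
  by rewrite (linZ (l2 _)) (linZ (l1 _)) scalerA rmorphM invfM mulrC.
exists F; split.
  split=> // v w; apply: (basis_ext2 (B := B) (C := C) (b := fun v w => F (tmod v w))) => //.
    exact: blin_bbilin.
  by move=> x y; rewrite tmod_bvec FE.
move=> F' [bF' F'E]; apply: (basis_ext (B := model_basis prod_weights)) => //.
by move=> [x y]; rewrite FE -tmod_bvec [RHS]F'E.
Qed.

(** The model witnesses existence, so the description defining [tens] does not fall back to its
    default. *)
Lemma tens_tensor : is_tensor (tens V W).
Proof. by apply: theP; exists (Pretensor tmod); exact: model_tensor. Qed.

Let tens_iso : exists f : tens V W -> model prod_weights,
  exists g, [/\ blin f, blin g, cancel f g & cancel g f /\
     forall v w, f (ot v w) = tmod v w].
Proof.
have [cT bT uT] := tens_tensor; have [cM bM uM] := model_tensor.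
have [f [[bf fE] _]] := uT _ cM _ bM.
have [g [[bg gE] _]] := uM _ cT _ bT.
exists f, g; split=> //.
  have [i [_ iU]] := uT _ cT _ bT.
  move=> x; rewrite -[LHS]/((g \o f) x) -[RHS]/(idfun x); congr (_ x).
  transitivity i; [symmetry|]; apply: iU; split.
  - exact: blin_comp.
  - by move=> v w /=; rewrite fE; exact: gE.
  - exact: blin_id.
  - by [].
split=> // x; have [i [_ iU]] := uM _ cM _ bM.
rewrite -[LHS]/((f \o g) x) -[RHS]/(idfun x); congr (_ x).
transitivity i; [symmetry|]; apply: iU; split.
- exact: blin_comp.
- by move=> v w /=; rewrite gE; exact: fE.
- exact: blin_id.
- by [].
Qed.

Lemma tens_basis_ex : exists D : basis (X * Y)%type (tens V W),
  (forall p, D p <-> prodw p) /\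
  forall x y, bvec D (x, y) = ot (bvec B x) (bvec C y).
Proof.
have [f [g [bf bg fg [gf fE]]]] := tens_iso.
exists (basis_iso (model_basis prod_weights) bf bg fg gf); split=> // x y.
by apply: (can_inj fg); rewrite fE tmod_bvec /= gf.
Qed.

(** Obtained by choice: its weights and its basis vectors are accessible through the two lemmas
    below. *)
Definition tens_basis : basis (X * Y)%type (tens V W) := sval (cid tens_basis_ex).

Lemma tens_basisE x y : bvec tens_basis (x, y) = ot (bvec B x) (bvec C y).
Proof. by rewrite /tens_basis; case: cid => D [? h]; exact: h. Qed.

Lemma tens_basis_wt p : tens_basis p <-> prodw p.
Proof. by rewrite /tens_basis; case: cid => D [h ?]; exact: h. Qed.

End TensorBasis.

(** * The approximation property by uniform tail estimates *)

Section Approximation.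
Variables (R : realType) (X : choiceType) (V : bornSpace R) (B : basis X V).
Local Notation c := (coord B).

(** A finite subcover of a directed cover lies in one of its members; [i0] provides that member when
    the subcover is empty. *)
Lemma gauge_compact_directed (W : lmodType R[i]) (T S : set W) (I : Type) (i0 : I)
    (U : I -> set W) : gauge_compact T S -> (forall i, gauge_open T (U i)) ->
  (forall i j, exists k, U i `<=` U k /\ U j `<=` U k) ->
  (forall x, S x -> exists i, U i x) -> exists i, S `<=` U i.
Proof.
move=> [_ cS] oU dU SU.
have [_ [i _ <-]||E [/finite_seqP[s ->] EU SE]] := cS (range U); first exact: oU.
  by move=> x /SU[i xi]; exists (U i) => //; exists i.
suff [i hi] : exists i, forall A, A \in s -> A `<=` U i.
  by exists i => x /SE[A As Ax]; exact: hi As _ Ax.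
elim: s EU {SE} => [_|A s IH sU]; first by exists i0.
have [i hi] : exists i, forall A, A \in s -> A `<=` U i.
  by apply: IH => D /= Ds; apply: sU; rewrite /= inE Ds orbT.
have [j _ Aj] : range U A by apply: sU; rewrite /= mem_head.
have [k [ik jk]] := dU i j; exists k => D; rewrite inE => /orP[/eqP ->|/hi Di].
  by rewrite -Aj.
exact: subset_trans ik.
Qed.

Lemma outsideD (A : {fset X}) (f g : X -> R[i]^o) :
  outside A (f + g) = outside A f + outside A g.
Proof.
by apply/funext => t; rewrite !fctE /outside; case: ifP => //; rewrite addr0.
Qed.

Lemma nle_trunc v M A x : B v -> nle v (c x) M -> nle v (c (trunc B A x)) M.
Proof.
move=> Bv; apply: nle_dom => [t|t]; first exact/ltW/(wt_gt0 Bv).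
rewrite coord_trunc !fctE /outside; case: ifP => _; first by rewrite subr0.
by rewrite subrr ComplexField.Normc.normc0 cabs_ge0.
Qed.

Lemma trunc_blin A : blin (trunc B A).
Proof.
split=> [a x y|D /(smallP B)[v Bv [M hM]]].
  rewrite /trunc scaler_sumr -big_split /=; apply: eq_bigr => t _.
  by rewrite (coord_linear B) !fctE scalerDl scalerA.
apply/(smallP B); exists v => //; exists M => _ [x /hM hx <-].
exact: nle_trunc.
Qed.

Lemma trunc_finite_rank A : finite_rank (trunc B A).
Proof.
exists [seq bvec B t | t <- A] => x P AP.
rewrite /trunc big_seq; apply: (big_ind P); first exact: ss0.
  by move=> y z Py Pz; rewrite -[y]scale1r; exact: ssP.
move=> t tA; rewrite -[_ *: _]addr0; apply: ssP; last exact: ss0.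
by apply: AP => /=; apply: map_f.
Qed.

Section CompactDisk.
Variables (S T : set V) (v : X -> R) (M : R).
Hypotheses (Bv : B v) (TM : forall x, T x -> nle v (c x) M) (dT : disk T).
Hypothesis cS : gauge_compact T S.

Let v0 t : 0 <= v t. Proof. exact/ltW/(wt_gt0 Bv). Qed.

(** The strict inequality [d < e] makes the set open although [nle] is a weak bound. *)
Let U A (e : R) := [set x : V | exists2 d, d < e & nle v (outside A (c x)) d].

Let M0 : 0 <= M.
Proof. by case: dT => T0 _; exact: nle_ge0 (TM T0). Qed.

Let absorbed_nle r x : 0 <= r -> absorbed T r x -> nle v (c x) (r * M).
Proof.
move=> r0 [t /TM ht ->]; rewrite (linZ (coord_linear B)) -{2}(cabsR r0).
exact: nleZ.
Qed.

Let U_open A e : gauge_open T (U A e).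
Proof.
(* A move by this radius changes the tail norm by at most (e - d) M / (M + 1), which is less than e
   - d; the summand 1 covers M = 0. *)
move=> x xT [d de hd]; have ed : 0 < (e - d) / (M + 1).
  by rewrite divr_gt0 ?subr_gt0// ltr_wpDl.
exists ((e - d) / (M + 1)) => // y yT xy.
have /(absorbed_nle (ltW ed)) h : absorbed T ((e - d) / (M + 1)) (y - x).
  by apply: gauge_lt => //; rewrite -scaleN1r addrC; apply: ssP.
exists ((e - d) / (M + 1) * M + d).
  rewrite -ltrBrDr mulrAC ltr_pdivrMr ?ltr_wpDl// ltr_pM2l ?subr_gt0//.
  by rewrite ltrDl.
rewrite -[y](subrK x) (linD (coord_linear B)) outsideD.
by apply: nleD => //; exact: nle_outside.
Qed.

Let S_fin x : S x -> exists N, nle v (c x) N.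
Proof.
case: cS => ST _ /ST /(lspanE _ dT)[r r0 /(absorbed_nle (ltW r0)) h].
by exists (r * M).
Qed.

Lemma compact_bounded : exists N, forall x, S x -> nle v (c x) N.
Proof.
have o0 x : outside fset0 (c x) = c x by apply/funext.
have [||x Sx|e he] := gauge_compact_directed 0 (U := U fset0) cS.
- by move=> e; exact: U_open.
- move=> i j; exists (Num.max i j); split=> x [d di hd]; exists d => //.
    by rewrite lt_max di.
  by rewrite lt_max di orbT.
- have [N hN] := S_fin Sx; exists (N + 1), N; first by rewrite ltrDl.
  by rewrite o0.
exists e => x /he[d de]; rewrite o0; apply: nleW; exact: ltW.
Qed.

(** The open sets of points with tail less than e off A grow with A and cover S, so by compactness a
    single A serves all of S. *)
Lemma compact_tail (e : R) : 0 < e ->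
  exists A, forall x, S x -> nle v (c (x - trunc B A x)) e.
Proof.
move=> e0; have [||x Sx|A hA] := gauge_compact_directed fset0 (U := U^~ e) cS.
- by move=> A; exact: U_open.
- move=> i j; exists (i `|` j)%fset; split=> x [d di hd]; exists d => //.
    by apply: outside_sub hd => //; exact: fsubsetUl.
  by apply: outside_sub hd => //; exact: fsubsetUr.
- have [N hN] := S_fin Sx; have e20 : 0 < e / 2 by rewrite divr_gt0.
  have [A hA] := nle_tail v0 hN e20; exists A, (e / 2) => //.
  by rewrite ltr_pdivrMr// ltr_pMr// ltr1n.
exists A => x /hA[d de hd]; rewrite (linB (coord_linear B)) coord_trunc subKr.
by apply: nleW hd; exact: ltW.
Qed.

End CompactDisk.

Lemma to_homE (W Z : bornSpace R) (f : W -> Z) : blin f -> val (to_hom f) = f.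
Proof. by move=> h; rewrite /to_hom /ss_in insubdK//; apply/asboolP. Qed.

(** Take A n with tails at most 1/(n+1) uniformly on S. Convergence takes place in the disk H of
    maps that send S into the unit ball of v. *)
Lemma basis_approximation : approximation_property V.
Proof.
move=> S cS; have dS := proj1 cS; have [T [sT bT cT]] := proj2 cS.
have dT : disk T by case: bT.
have [v Bv [M hM]] := (smallP B T).1 sT.
have v0 t : 0 <= v t by apply/ltW/(wt_gt0 Bv).
have e0 n : 0 < n.+1%:R^-1 :> R by rewrite invr_gt0.
have /(_ _)/cid-/all_sig[A hA] n := compact_tail Bv hM dT cT (e0 n).
have [N hN] := compact_bounded Bv hM dT cT.
exists (fun n => trunc B (A n)); split.
  by move=> n; split; [exact: trunc_blin|exact: trunc_finite_rank].
set D := diskspan (proj1 cS).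
have inj_blin : blin (fun x : D => val x : V).
  split=> [a x y|F [r r0 hF]]; first by rewrite ss_valP.
  apply/(smallP B); exists v => //; exists (cabs r%:C%C * N) => _ [x /hF[s Ss ->] <-].
  by rewrite (linZ (coord_linear B)); apply: nleZ => //; exact: hN.
have tr_blin n : blin (fun x : D => trunc B (A n) (val x)).
  exact: (blin_comp (trunc_blin (A n)) inj_blin).
pose H := [set h : Hom D V | forall x : D, S (val x) -> nle v (c (val h x)) 1].
have hlin (h : Hom D V) : linear (val h).
  by have /asboolP[] := valP h.
have dH : disk H.
  split=> [x Sx|a b h k ab Hh Hk x Sx].
    by rewrite /= (lin0 (coord_linear B)); apply: nleW (nle0 v).
  rewrite ss_valD !ss_valZ !fctE (coord_linear B) (linZ (coord_linear B)).
  apply: nleW (nleP a v0 (Hh _ Sx) (nleZ b v0 (Hk _ Sx))).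
  by rewrite !mulr1.
(* A bounded set of the span of S lies in some multiple r S, so H maps it into the ball of radius
   r. *)
have sH : small H.
  move=> F [r r0 hF]; apply/(smallP B); exists v => //; exists (cabs r%:C%C * 1).
  move=> _ [_ [h Hh <-] [x /hF[s Ss xs] <-]].
  have rC : r%:C%C != 0 :> R[i] by rewrite fmorph_eq0 gt_eqF.
  rewrite -[x](scale1r) -(divff rC) -scalerA (linZ (hlin h)) (linZ (coord_linear B)).
  apply: nleZ => //; apply: Hh; rewrite ss_valZ xs scalerA mulVf// scale1r.
  exact: Ss.
have aH e (h : Hom D V) : 0 < e ->
    (forall x : D, S (val x) -> nle v (c (val h x)) e) -> absorbed H e h.
  move=> e1 hh; have eC : e%:C%C != 0 :> R[i] by rewrite fmorph_eq0 gt_eqF.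
  exists (e%:C%C^-1 *: h); last by rewrite scalerA divff// scale1r.
  move=> x Sx; rewrite ss_valZ fctE (linZ (coord_linear B)).
  have := nleZ (e%:C%C)^-1 v0 (hh _ Sx).
  by rewrite ComplexField.Normc.normcV cabsR ?(ltW e1)// mulVf// gt_eqF.
have lH e (h : Hom D V) :
    (forall x : D, S (val x) -> nle v (c (val h x)) e) -> lspan H h.
  move=> hh; apply/lspanE => //; exists (`|e| + 1); first by rewrite ltr_wpDl.
  apply: aH => [|x Sx]; first by rewrite ltr_wpDl.
  by apply: nleW (hh _ Sx); rewrite (le_trans (ler_norm e))// lerDl.
apply: (@bcvgP _ _ _ _ H) => //.
- by apply: (lH N) => x Sx; rewrite to_homE//; exact: hN.
- move=> e e1; have [K hK] := ex_invS e1; exists K => n Kn; apply: aH => // x Sx.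
  rewrite -scaleN1r ss_valD ss_valZ !to_homE// !fctE scaleN1r -opprB -scaleN1r.
  rewrite (linZ (coord_linear B)) scaleN1r; apply: nleN.
  by apply: nleW (hA n _ Sx); exact: hK.
- move=> n; apply: (lH N) => x Sx; rewrite to_homE//.
  by apply: nle_trunc => //; exact: hN.
Qed.

End Approximation.

Section TensorLift.
Variables (R : realType) (X Y : choiceType) (V W : bornSpace R).
Variables (B : basis X V) (C : basis Y W).

Lemma ot_bbilin : bbilin (@ot R V W).
Proof. by case: (tens_tensor B C). Qed.

Lemma tens_complete : bcomplete (tens V W).
Proof. by case: (tens_tensor B C). Qed.

Variables (Z : bornSpace R) (cZ : bcomplete Z).

Lemma tens_ext (f g : tens V W -> Z) : blin f -> blin g ->
  (forall x y, f (ot (bvec B x) (bvec C y)) = g (ot (bvec B x) (bvec C y))) -> f = g.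
Proof.
move=> bf bg fg; apply: (basis_ext (B := tens_basis B C)) => // -[x y].
by rewrite tens_basisE.
Qed.

Variables (b : V -> W -> Z) (hb : bbilin b).

Lemma lift_spec : blin (lift b) /\ forall v w, lift b (ot v w) = b v w.
Proof.
have [_ _ /(_ _ cZ _ hb)[f [hf _]]] := tens_tensor B C.
by apply: (@theP _ _ (fun f => blin f /\ _)); exists f.
Qed.

Lemma lift_blin : blin (lift b). Proof. by case: lift_spec. Qed.

Lemma lift_ot v w : lift b (ot v w) = b v w. Proof. by case: lift_spec. Qed.

Lemma lift_eq (f : tens V W -> Z) : blin f ->
  (forall x y, f (ot (bvec B x) (bvec C y)) = b (bvec B x) (bvec C y)) -> lift b = f.
Proof.
move=> bf fE; apply: tens_ext => //; first exact: lift_blin.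
by move=> x y; rewrite lift_ot fE.
Qed.

End TensorLift.

(** * A criterion for maps on balanced tensor products to be isomorphisms *)

Section Induced.
Variables (R : realType) (X Y : choiceType) (H : bornAlg R) (M V Z : bornSpace R).
Variables (B : basis X M) (C : basis Y V) (cZ : bcomplete Z).
Variables (ra : M -> H -> M) (la : H -> V -> V) (b : M -> V -> Z) (hb : bbilin b).
Hypothesis b_bal : forall m h v, b (ra m h) v = b m (la h v).
Variable s : Z -> tens M V.
Hypotheses (bs : blin s) (sK : forall z, lift b (s z) = z).
Hypothesis s_bal : forall m v, balanced ra la (s (b m v) - ot m v).
Local Notation P := (balanced ra la).

Let P_closed : bclosed P.
Proof.
move=> u x hu ux Q cQ AQ; apply: (cQ u) => // n; exact: hu.
Qed.

Let lift0 x : P x -> lift b x = 0.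
Proof.
have bl : blin (lift b) := lift_blin B C cZ hb.
have b0 : blin (fun _ : tens M V => 0 : Z) by exact: blin0.
move=> Px; apply: (Px (equalizer (proj1 bl) (proj1 b0))).
  exact: blin_ker_closed.
move=> _ [m [h [v ->]]] /=.
by rewrite (linB (proj1 bl)) !(lift_ot B C cZ hb) b_bal subrr.
Qed.

Let induced_pi x : induced (ra := ra) (la := la) b (ss_pi P x) = lift b x.
Proof.
have bl : blin (lift b) := lift_blin B C cZ hb.
apply/eqP; rewrite -subr_eq0 -(linB (proj1 bl)); apply/eqP/lift0.
by apply/asboolP; rewrite -ss_piE; apply/eqP; exact: ss_piK.
Qed.

(** The inverse is the class of the section s. That [s (lift b y)] and y have the same class is
    assumed for elementary tensors; [balanced] is closed, so it holds for all y by density. *)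
Lemma induced_biso : biso (induced (ra := ra) (la := la) b).
Proof.
have bl : blin (lift b) := lift_blin B C cZ hb.
apply: (@blin_can_biso _ _ _ _ (fun z => ss_pi P (s z) : tens_over ra la)).
- split=> [a p q|A [A' sA AA]].
    rewrite -[p]ss_piK -[q]ss_piK -(ss_pi_linear P) !induced_pi.
    exact: (proj1 bl).
  apply: sub_small (proj2 bl _ sA) => _ [_ /AA[x Ax <-] <-].
  by exists x => //; rewrite induced_pi.
- split=> [a p q|A sA]; first by rewrite (proj1 bs) ss_pi_linear.
  exists (s @` A); first exact: (proj2 bs).
  by move=> _ [x Ax <-]; exists (s x) => //; exists x.
- move=> q; rewrite -[q]ss_piK induced_pi; set x := repr q.
  apply/eqP; rewrite ss_piE; apply/asboolP.
  (* The preimage of P under the bounded map g is a closed subspace containing the basis vectors. *)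
  pose g y := s (lift b y) - y.
  have bg : blin g.
    have := blin_comb (-1) (blin_id (tens M V)) (blin_comp bs bl).
    suff -> : -1 *: idfun + (s \o lift b) = g by [].
    by apply/funext => y; rewrite !fctE scaleN1r addrC.
  have Q0 : P (g 0) by rewrite (lin0 (proj1 bg)); exact: ss0.
  have QP a y z : P (g y) -> P (g z) -> P (g (a *: y + z)).
    by move=> Py Pz; rewrite (proj1 bg); exact: ssP.
  pose Q := @Subspace _ _ (fun y => P (g y)) Q0 QP.
  apply: (dense_basis (B := tens_basis B C) (P := Q)).
    move=> u y hu uy; apply: (P_closed (u := g \o u)) => //; exact: bcvg_blin.
  by move=> [m v]; rewrite tens_basisE /= /g (lift_ot B C cZ hb); exact: s_bal.
- by move=> z; rewrite induced_pi sK.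
Qed.

End Induced.

(** * Multipliers and essential modules of unital algebras *)

Section Unital.
Variable R : realType.

Record unital (A : bornAlg R) (one : A) : Prop := Unital {
  unital_complete : bcomplete A;
  unital_assoc : associative (@bmul R A);
  unital_mul1 : forall a, bmul one a = a;
  unital_mulr1 : forall a, bmul a one = a }.

Section Multipliers.
Variables (A : bornAlg R) (one : A) (uA : unital one).

Lemma iota_multiplier (a : A) : is_multiplier (bmul a, (@bmul R A)^~ a).
Proof.
have mulA := unital_assoc uA; split; first split.
- exact: bbilin_blin_r (bmulP A).
- exact: bbilin_blin_l (bmulP A).
- by split=> f g /=; rewrite mulA.
Qed.

Lemma mL_iota (a x : A) : mL (iota a) x = bmul a x.
Proof. by rewrite /mL /iota to_multE//; exact: iota_multiplier. Qed.

Lemma mR_iota (a x : A) : mR (iota a) x = bmul x a.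
Proof. by rewrite /mR /iota to_multE//; exact: iota_multiplier. Qed.

Lemma mult_eq (m n : Mult A) : mL m =1 mL n -> mR m =1 mR n -> m = n.
Proof.
move=> eL eR; apply: val_inj; rewrite [val m]surjective_pairing [val n]surjective_pairing.
by congr pair; apply/funext.
Qed.

(** With a = L(1): L(x) = L(1 x) = a x, and x a = x L(1) = R(x) 1 = R(x). *)
Lemma mult_iota (m : Mult A) : m = iota (mL m one).
Proof.
have [_ [hL hR hM]] := multP m; apply: mult_eq => x.
  by rewrite mL_iota -[RHS]hL (unital_mul1 uA).
by rewrite mR_iota [RHS]hM (unital_mulr1 uA).
Qed.

Lemma iotaK (a : A) : mL (iota a) one = a.
Proof. by rewrite mL_iota (unital_mulr1 uA). Qed.

Lemma mL_linear a (m n : Mult A) x : mL (a *: m + n) x = a *: mL m x + mL n x.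
Proof. by rewrite /mL ss_valP. Qed.

Lemma mR_linear a (m n : Mult A) x : mR (a *: m + n) x = a *: mR m x + mR n x.
Proof. by rewrite /mR ss_valP. Qed.

Lemma eval_blin : blin (fun m : Mult A => mL m one).
Proof.
split=> [a m n|F [sF _]]; first exact: mL_linear.
apply: sub_small (sF _ (small1 one)) => _ [m Fm <-].
by exists (mL m); [exists m|exists one].
Qed.

Lemma iota_blin : blin (@iota R A).
Proof.
have [l1 l2 sm] := bmulP A.
split=> [a x y|F sF].
  apply: mult_eq => z.
    by rewrite mL_linear !mL_iota l1.
  by rewrite mR_linear !mR_iota l2.
split=> S sS.
  apply: sub_small (sm _ _ sF sS) => _ [_ [_ [x Fx <-] <-] [s Ss <-]].
  by exists x => //; exists s => //; rewrite -mL_iota.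
apply: sub_small (sm _ _ sS sF) => _ [_ [_ [x Fx <-] <-] [s Ss <-]].
by exists s => //; exists x => //; rewrite -mR_iota.
Qed.

Lemma mult_complete : bcomplete (Mult A).
Proof.
apply: (@biso_complete _ (Mult A) A (fun m => mL m one)); last exact: unital_complete uA.
apply: blin_can_biso eval_blin iota_blin _ iotaK => m; exact/esym/mult_iota.
Qed.

Lemma iota_inj : injective (@iota R A).
Proof. by move=> a b /(congr1 (fun m => mL m one)); rewrite !iotaK. Qed.

Lemma of_mult_iota (a : A) : of_mult (iota a) = a.
Proof. by apply: iota_inj; apply: (@theP _ _ (fun x => iota x = iota a)); exists a. Qed.

Lemma mL_mul (m n : Mult A) x : mL (bmul m n) x = mL m (mL n x).
Proof.
have := to_multE (mmul_multiplier m n); rewrite -/(mmul m n) => E.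
by rewrite -[LHS]/((val (mmul m n)).1 x) E.
Qed.

Lemma mR_mul (m n : Mult A) x : mR (bmul m n) x = mR n (mR m x).
Proof.
have := to_multE (mmul_multiplier m n); rewrite -/(mmul m n) => E.
by rewrite -[LHS]/((val (mmul m n)).2 x) E.
Qed.

Lemma iotaM (a b : A) : iota (bmul a b) = bmul (iota a : Mult A) (iota b).
Proof.
apply: mult_eq => x.
  by rewrite mL_mul !mL_iota (unital_assoc uA).
by rewrite mR_mul !mR_iota (unital_assoc uA).
Qed.

Lemma iota1 : iota one = mone A.
Proof.
have h : is_multiplier ((@idfun A), (@idfun A)).
  by split; [split; exact: blin_id|].
apply: mult_eq => x; rewrite ?mL_iota ?mR_iota /mL /mR /mone (to_multE h).
  exact: unital_mul1.
exact: unital_mulr1.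
Qed.

Lemma iota_hom (K : bornAlg R) (f : K -> A) : is_hom f -> is_hom (@iota R A \o f).
Proof.
move=> [bf fM]; split; first exact: blin_comp iota_blin bf.
by move=> x y /=; rewrite fM iotaM.
Qed.

(** The map m |-> f (m 1) satisfies the description of [mext], and whatever satisfies it takes the
    value [f a] at [iota a]. *)
Lemma mext_iota (K : bornAlg R) (f : A -> Mult K) (a : A) :
  is_hom f -> f one = mone K -> mext f (iota a) = f a.
Proof.
move=> [bf fM] f1.
suff [_ _ h] : [/\ is_hom (mext f), mext f (mone A) = mone K &
    forall a, mext f (iota a) = f a] by [].
apply: (@theP _ _ (fun F : Mult A -> Mult K =>
  [/\ is_hom F, F (mone A) = mone K & forall a, F (iota a) = f a])).
exists (fun m => f (mL m one)); split.
- split; first exact: (blin_comp bf eval_blin).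
  move=> m n; rewrite -fM; congr f.
  by rewrite {1}[m]mult_iota {1}[n]mult_iota -iotaM iotaK.
- by rewrite -iota1 iotaK.
- by move=> x; rewrite iotaK.
Qed.

End Multipliers.

Section Essential.
Variables (X Y : choiceType) (H : bornAlg R) (one : H) (uH : unital one).
Variables (B : basis X H) (V : bornSpace R) (C : basis Y V).

(** The section is v |-> 1 (x) v; the defect of m (x) v is, up to sign, the balancing relation of 1,
    m and v. *)
Lemma unital_essential_left (la : H -> V -> V) : is_lmodule la ->
  (forall v, la one v = v) -> essential_left la.
Proof.
move=> hla la1; split=> //; have [cV bla laM] := hla.
apply: (@induced_biso _ _ _ _ _ _ _ B C cV (@bmul R H) la la bla) (fun v => ot one v) _ _ _.
- by move=> m h v; rewrite laM.
- exact: bbilin_blin_r (ot_bbilin B C).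
- by move=> v; rewrite (lift_ot B C).
- move=> m v Q cQ AQ; rewrite -opprB -scaleN1r -[_ *: _]addr0.
  apply: ssP; last exact: ss0.
  by apply: AQ; exists one, m, v; rewrite (unital_mul1 uH).
Qed.

Lemma unital_essential_right (ra : V -> H -> V) : is_rmodule ra ->
  (forall v, ra v one = v) -> essential_right ra.
Proof.
move=> hra ra1; split=> //; have [cV bra raM] := hra.
apply: (@induced_biso _ _ _ _ _ _ _ C B cV ra (@bmul R H) ra bra) (fun v => ot v one) _ _ _.
- by move=> m h v; rewrite raM.
- exact: bbilin_blin_l (ot_bbilin C B).
- by move=> v; rewrite (lift_ot C B).
- move=> m h Q cQ AQ; apply: AQ; exists m, h, one.
  by rewrite (unital_mulr1 uH).
Qed.

End Essential.

Lemma unital_essential_alg (X : choiceType) (H : bornAlg R) (one : H)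
    (B : basis X H) : unital one -> one <> 0 -> essential_alg H.
Proof.
move=> uH one0; split; first by exists one.
have hH : is_lmodule (@bmul R H).
  split; [exact: unital_complete uH|exact: bmulP|].
  by move=> h k v; rewrite (unital_assoc uH).
by have [] := unital_essential_left uH B B hH (unital_mul1 uH).
Qed.

End Unital.

(** * Monoid algebras and their tensor products *)

Record monoid_law (X : Type) (op : X -> X -> X) (e : X) : Prop := MonoidLaw {
  monoid_assoc : associative op;
  monoid_left : left_id e op;
  monoid_right : right_id e op }.

Definition prod_op (X Y : Type) (opX : X -> X -> X) (opY : Y -> Y -> Y) :
  X * Y -> X * Y -> X * Y := fun p q => (opX p.1 q.1, opY p.2 q.2).

Lemma prod_monoid_law (X Y : Type) (opX : X -> X -> X) (opY : Y -> Y -> Y) e e' :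
  monoid_law opX e -> monoid_law opY e' -> monoid_law (prod_op opX opY) (e, e').
Proof.
move=> [a l r] [a' l' r']; split=> [[x x'] [y y'] [z z']|[x x']|[x x']];
  by rewrite /prod_op /= ?a ?a' ?l ?l' ?r ?r'.
Qed.

Section MonoidAlgebra.
Variables (R : realType) (X : choiceType) (op : X -> X -> X) (e : X).
Variables (A : bornAlg R) (B : basis X A).
Hypotheses (opP : monoid_law op e).
Hypothesis mulB : forall s t, bmul (bvec B s) (bvec B t) = bvec B (op s t).

Lemma monoid_alg_unital : unital (bvec B e).
Proof.
have cA := basis_complete B; have bm := bmulP A.
split=> // [a b c|a|a].
- have h1 s b' c' : bmul (bvec B s) (bmul b' c') = bmul (bmul (bvec B s) b') c'.
    apply: (basis_ext2 (B := B) (C := B) (b := fun b c => bmul (bvec B s) (bmul b c))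
      (b' := fun b c => bmul (bmul (bvec B s) b) c)) => //.
    + exact: blin_bbilin (bbilin_blin_r _ bm) bm.
    + exact: (bbilin_blin (bbilin_blin_r _ bm) (blin_id _) bm).
    + by move=> x y; rewrite !mulB (monoid_assoc opP).
  suff : (@bmul R A)^~ (bmul b c) = (fun a => bmul (bmul a b) c).
    by move=> /(congr1 (@^~ a)).
  apply: (basis_ext (B := B)) => //.
  + exact: bbilin_blin_l.
  + exact: (blin_comp (bbilin_blin_l c bm) (bbilin_blin_l b bm)).
- suff : bmul (bvec B e) = idfun by move=> /(congr1 (@^~ a)).
  apply: (basis_ext (B := B)) => //; [exact: bbilin_blin_r|exact: blin_id|].
  by move=> t; rewrite mulB (monoid_left opP).
- suff : (@bmul R A)^~ (bvec B e) = idfun by move=> /(congr1 (@^~ a)).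
  apply: (basis_ext (B := B)) => //; [exact: bbilin_blin_l|exact: blin_id|].
  by move=> t; rewrite mulB (monoid_right opP).
Qed.

(** Boundedness of the product is read back as an estimate of weights: products of scaled basis
    vectors form a small set, bounded for some p, and the coordinate at [op s t] gives the
    inequality. The product of a tensor algebra is built from such estimates. *)
Lemma monoid_alg_weight u v : B u -> B v -> exists2 p, B p &
  exists K, forall s t, p (op s t) <= K * (u s * v t).
Proof.
move=> Bu Bv; have [l1 l2 sm] := bmulP A.
have /(smallP B)[p Bp [K hK]] := sm _ _ (small_bvec Bu) (small_bvec Bv).
exists p => //; exists K => s t.
have us := wt_gt0 Bu s; have vt := wt_gt0 Bv t.
have /hK/(nle_point (op s t)) : [set bmul x y |
    x in [set ((u x)%:C%C)^-1 *: bvec B x | x in [set: X]] &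
    y in [set ((v x)%:C%C)^-1 *: bvec B x | x in [set: X]]]
    (((u s)%:C%C)^-1 *: (((v t)%:C%C)^-1 *: bvec B (op s t))).
  exists (((u s)%:C%C)^-1 *: bvec B s); first by exists s.
  exists (((v t)%:C%C)^-1 *: bvec B t); first by exists t.
  by rewrite (linZ (l1 _)) (linZ (l2 _)) mulB.
rewrite !(linZ (coord_linear B)) coord_bvec !fctE eqxx.
have scE (a : R[i]) (b : R[i]^o) : a *: b = a * b by [].
rewrite !scE mulr1 ComplexField.Normc.normcM.
rewrite !ComplexField.Normc.normcV (cabsR (ltW us)) (cabsR (ltW vt)).
by rewrite -invfM mulrC ler_pdivrMr// mulr_gt0.
Qed.

End MonoidAlgebra.

Section TensorAlgebra.
Variables (R : realType) (X Y : choiceType) (opX : X -> X -> X) (eX : X).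
Variables (opY : Y -> Y -> Y) (eY : Y) (A A' : bornAlg R).
Variables (B : basis X A) (C : basis Y A').
Hypotheses (opXP : monoid_law opX eX) (opYP : monoid_law opY eY).
Hypothesis mulB : forall s t, bmul (bvec B s) (bvec B t) = bvec B (opX s t).
Hypothesis mulC : forall s t, bmul (bvec C s) (bvec C t) = bvec C (opY s t).
Local Notation T := (tens_basis B C).

(** Existence of the product that [tens_alg] names by description: it extends the componentwise law
    on pairs of indices. *)
Let tmul_ex : exists m : tens A A' -> tens A A' -> tens A A', bbilin m /\
  forall a b a' b', m (ot a b) (ot a' b') = ot (bmul a a') (bmul b b').
Proof.
have [|F [bF FE]] := @basis_map R _ _ _ _ (tens_basis T T) T
    (fun z => prod_op opX opY z.1 z.2).
  move=> _ /tens_basis_wt[_ [_ [/tens_basis_wt[u [v [Bu Cv ->]]]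
    /tens_basis_wt[u' [v' [Bu' Cv' ->]]] ->]]].
  have [p Bp [K hK]] := monoid_alg_weight mulB Bu Bu'.
  have [q Cq [L hL]] := monoid_alg_weight mulC Cv Cv'.
  exists (fun z => p z.1 * q z.2); first by apply/tens_basis_wt; exists p, q.
  exists (K * L) => -[[s t] [s' t']] /=.
  have -> : K * L * (u s * v t * (u' s' * v' t')) =
      (K * (u s * u' s')) * (L * (v t * v' t')) by ring.
  by apply: ler_pM => //; apply/ltW; [exact: (wt_gt0 Bp)|exact: (wt_gt0 Cq)].
have bT := ot_bbilin T T; have bo := ot_bbilin B C; have cT := tens_complete B C.
have bm := bmulP A; have bm' := bmulP A'.
have bm2 : bbilin (fun x y => F (ot x y)) by exact: blin_bbilin.
exists (fun x y => F (ot x y)); split=> // a b a' b'.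
apply: (basis_ext2 (B := B) (C := C) (b := fun a b => F (ot (ot a b) (ot a' b')))
  (b' := fun a b => ot (bmul a a') (bmul b b'))) => //.
- exact: (blin_bbilin (bbilin_blin_l (ot a' b') bm2) bo).
- exact: (bbilin_blin (bbilin_blin_l a' bm) (bbilin_blin_l b' bm') bo).
move=> x y; apply: (basis_ext2 (B := B) (C := C)
  (b := fun a' b' => F (ot (ot (bvec B x) (bvec C y)) (ot a' b')))
  (b' := fun a' b' => ot (bmul (bvec B x) a') (bmul (bvec C y) b'))) => //.
- exact: (blin_bbilin (bbilin_blin_r (ot (bvec B x) (bvec C y)) bm2) bo).
- exact: (bbilin_blin (bbilin_blin_r _ bm) (bbilin_blin_r _ bm') bo).
by move=> x' y'; rewrite -!tens_basisE FE mulB mulC tens_basisE.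
Qed.

Lemma tens_mul (a a' : A) (b b' : A') :
  bmul (ot a b : tens_alg A A') (ot a' b') = ot (bmul a a') (bmul b b').
Proof.
suff [_ h] : bbilin (@bmul R (tens_alg A A')) /\ forall (a : A) (b : A') a' b',
    bmul (ot a b : tens_alg A A') (ot a' b') = ot (bmul a a') (bmul b b') by [].
by apply: (@theP _ _ (fun m : tens A A' -> tens A A' -> tens A A' => bbilin m /\ _)).
Qed.

Lemma tens_alg_bvec s t :
  bmul (bvec T s : tens_alg A A') (bvec T t) = bvec T (prod_op opX opY s t).
Proof.
by case: s t => [s s'] [t t']; rewrite !tens_basisE tens_mul mulB mulC.
Qed.

Lemma tens_unital : unital (ot (bvec B eX) (bvec C eY) : tens_alg A A').
Proof.
rewrite -tens_basisE.
exact: (@monoid_alg_unital R _ _ _ (tens_alg A A') T (prod_monoid_law opXP opYP)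
  tens_alg_bvec).
Qed.

(** On elementary tensors both components are multiplication by a (x) b, which brings tensor
    products of multipliers back to elements. *)
Lemma mtens_iota (a : A) (b : A') :
  mtens (iota a) (iota b) = iota (ot a b : tens_alg A A').
Proof.
have uA := monoid_alg_unital opXP mulB; have uA' := monoid_alg_unital opYP mulC.
have bo := ot_bbilin B C; have cT := tens_complete B C.
rewrite /mtens /tmap /iota; congr to_mult.
  apply: (lift_eq (B := B) (C := C)) => //.
  - apply: (@bbilin_blin _ _ _ _ _ _ (mL (iota a)) (mL (iota b)) _ _ _ bo).
      by have [[]] := multP (iota a).
    by have [[]] := multP (iota b).
  - exact: bbilin_blin_r (bmulP (tens_alg A A')).
  - by move=> x y; rewrite tens_mul (mL_iota uA) (mL_iota uA').
apply: (lift_eq (B := B) (C := C)) => //.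
- apply: (@bbilin_blin _ _ _ _ _ _ (mR (iota a)) (mR (iota b)) _ _ _ bo).
    by have [[]] := multP (iota a).
  by have [[]] := multP (iota b).
- exact: bbilin_blin_l (bmulP (tens_alg A A')).
- by move=> x y; rewrite tens_mul (mR_iota uA) (mR_iota uA').
Qed.

End TensorAlgebra.

Section LiftIota.
Variables (R : realType) (X Y : choiceType) (V W : bornSpace R).
Variables (B : basis X V) (C : basis Y W) (K : bornAlg R) (one : K).

(** Shows that a Galois map, defined with values in multipliers, factors through the tensor
    square. *)
Lemma lift_iota (b : V -> W -> K) : unital one -> bbilin b ->
  lift (fun v w => iota (b v w)) = @iota R K \o lift b.
Proof.
move=> uK hb; have cK := unital_complete uK.
apply: (lift_eq (B := B) (C := C)).
- exact: mult_complete uK.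
- exact: (blin_bbilin (iota_blin uK) hb).
- exact: (blin_comp (iota_blin uK) (lift_blin B C cK hb)).
- by move=> x y /=; rewrite (lift_ot B C).
Qed.

End LiftIota.

Section BasisMaps.
Variable R : realType.

Lemma hom_basis (X : choiceType) (A K : bornAlg R) (B : basis X A) (f : A -> K) :
  bcomplete K -> blin f ->
  (forall s t, f (bmul (bvec B s) (bvec B t)) = bmul (f (bvec B s)) (f (bvec B t))) ->
  is_hom f.
Proof.
move=> cK bf fM; split=> // x y.
apply: (basis_ext2 (B := B) (C := B) (b := fun x y => f (bmul x y))
  (b' := fun x y => bmul (f x) (f y))) => //.
- exact: blin_bbilin (bmulP A).
- exact: bbilin_blin (bmulP K).
Qed.

Lemma biso_basis (X Y : choiceType) (V W : bornSpace R) (B : basis X V) (C : basis Y W)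
    (f : V -> W) (g : W -> V) (h : X -> Y) (k : Y -> X) : blin f -> blin g ->
  (forall x, f (bvec B x) = bvec C (h x)) -> (forall y, g (bvec C y) = bvec B (k y)) ->
  cancel h k -> cancel k h -> biso f.
Proof.
move=> bf bg fE gE hk kh; apply: (blin_can_biso bf bg).
  move=> x; suff : g \o f = idfun by move=> /(congr1 (@^~ x)).
  apply: (basis_ext (B := B)); first exact: basis_complete B.
  - exact: blin_comp.
  - exact: blin_id.
  - by move=> t /=; rewrite fE gE hk.
move=> x; suff : f \o g = idfun by move=> /(congr1 (@^~ x)).
apply: (basis_ext (B := C)); first exact: basis_complete C.
- exact: blin_comp.
- exact: blin_id.
- by move=> t /=; rewrite gE fE kh.
Qed.

End BasisMaps.

(** * The axioms from bounded extensions of product, diagonal and inversion *)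

Section GroupQuantumGroup.
Variables (R : realType) (G : groupType) (H : bornAlg R) (B : basis G H).
Hypothesis mulB : forall s t, bmul (bvec B s) (bvec B t) = bvec B (s * t)%g.
Variables (D : H -> tens H H) (N : H -> H).
Hypotheses (bD : blin D) (DE : forall t, D (bvec B t) = ot (bvec B t) (bvec B t)).
Hypotheses (bN : blin N) (NE : forall t, N (bvec B t) = bvec B (t^-1)%g).

Local Notation d := (bvec B).
Local Notation mulG := (@monoid.mul G).
Local Notation one := (bvec B 1%g).
Local Notation HH := (tens_alg H H).
Local Notation B2 := (tens_basis B B).

Let mulg_law : monoid_law mulG 1%g.
Proof. by split; [exact: mulgA|exact: mul1g|exact: mulg1]. Qed.

Let cH : bcomplete H := basis_complete B.
Let cHH : bcomplete HH := tens_complete B B.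
Let uH : unital one := monoid_alg_unital mulg_law mulB.
Let uHH : unital (ot one one : HH) := tens_unital mulg_law mulg_law mulB mulB.

Let mulT (a a' b b' : H) : bmul (ot a b : HH) (ot a' b') = ot (bmul a a') (bmul b b').
Proof. exact: (tens_mul mulB mulB). Qed.

Let mulB2 (s t : G * G) : bmul (bvec B2 s : HH) (bvec B2 t) =
  bvec B2 (prod_op mulG mulG s t).
Proof. exact: (tens_alg_bvec mulB mulB). Qed.

Let law2 : monoid_law (prod_op mulG mulG) (1%g, 1%g).
Proof. exact: prod_monoid_law. Qed.

Let oHH : bbilin (@ot R H H) := ot_bbilin B B.

Let D_hom : is_hom (D : H -> HH).
Proof.
apply: (hom_basis (B := B)) => // s t.
by rewrite mulB !DE mulT mulB.
Qed.

Definition group_comul : H -> Mult HH := @iota R HH \o D.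
Local Notation Delta := group_comul.

Definition haar (x : H) : R[i] := coord B x 1%g.

Let mtensE (a b : H) : mtens (iota a) (iota b) = iota (ot a b : HH).
Proof. exact: (mtens_iota mulg_law mulg_law mulB mulB). Qed.

(** D(1) = 1 (x) 1, so both actions through D are unital. *)
Lemma group_comul_essential : essential_hom Delta.
Proof.
have bm := bmulP HH; have [_ DM] := D_hom; have mulA := unital_assoc uHH.
have D1 : D one = ot one one by rewrite DE.
split; first exact: (iota_hom uHH D_hom).
  have -> : (fun h (k : HH) => mL (Delta h) k) = fun h k => bmul (D h : HH) k.
    by apply/funext => h; apply/funext => k; exact: mL_iota uHH _ _.
  apply: (unital_essential_left uH B B2); first split=> //.
  - exact: (bbilin_blin bD (blin_id HH) bm).
  - by move=> h k v; rewrite DM mulA.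
  - by move=> v; rewrite D1; exact: unital_mul1 uHH _.
have -> : (fun (k : HH) h => mR (Delta h) k) = fun k h => bmul k (D h : HH).
  by apply/funext => k; apply/funext => h; exact: mR_iota uHH _ _.
apply: (unital_essential_right uH B B2); first split=> //.
- exact: (bbilin_blin (blin_id HH) bD bm).
- by move=> v h k; rewrite DM mulA.
- by move=> v; rewrite D1; exact: unital_mulr1 uHH _.
Qed.

Local Notation B3l := (tens_basis B2 B).
Local Notation B3r := (tens_basis B B2).
Local Notation H3l := (tens_alg HH H).
Local Notation H3r := (tens_alg H HH).

Let u3l : unital (ot (bvec B2 (1%g, 1%g)) one : H3l).
Proof. exact: (@tens_unital R _ _ _ _ _ _ HH H B2 B law2 mulg_law mulB2 mulB). Qed.

Let u3r : unital (ot one (bvec B2 (1%g, 1%g)) : H3r).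
Proof. exact: (@tens_unital R _ _ _ _ _ _ H HH B B2 mulg_law law2 mulB mulB2). Qed.

Let mul3l s t : bmul (bvec B3l s : H3l) (bvec B3l t) =
  bvec B3l (prod_op (prod_op mulG mulG) mulG s t).
Proof. exact: (@tens_alg_bvec R _ _ _ _ HH H B2 B mulB2 mulB). Qed.

Let mul3r s t : bmul (bvec B3r s : H3r) (bvec B3r t) =
  bvec B3r (prod_op mulG (prod_op mulG mulG) s t).
Proof. exact: (@tens_alg_bvec R _ _ _ _ H HH B B2 mulB mulB2). Qed.

Let Dl : HH -> H3l := lift (fun f g => ot (D f) g).
Let Dr : HH -> H3r := lift (fun f g => ot f (D g)).

Let o3l : bbilin (@ot R HH H) := ot_bbilin B2 B.
Let o3r : bbilin (@ot R H HH) := ot_bbilin B B2.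

Let bbDl : bbilin (fun f g => ot (D f : HH) g) := bbilin_blin bD (blin_id H) o3l.
Let bbDr : bbilin (fun f g => ot f (D g : HH)) := bbilin_blin (blin_id H) bD o3r.

Let DlE s t : Dl (bvec B2 (s, t)) = bvec B3l ((s, s), t).
Proof.
rewrite tens_basisE [LHS](lift_ot B B (tens_complete B2 B) bbDl) DE.
by rewrite !tens_basisE.
Qed.

Let DrE s t : Dr (bvec B2 (s, t)) = bvec B3r (s, (t, t)).
Proof.
rewrite tens_basisE [LHS](lift_ot B B (tens_complete B B2) bbDr) DE.
by rewrite !tens_basisE.
Qed.

Let Dl_hom : is_hom Dl.
Proof.
apply: (@hom_basis _ _ HH H3l B2); first exact: tens_complete B2 B.
  exact: (lift_blin B B (tens_complete B2 B) bbDl).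
by move=> [s s'] [t t']; rewrite mulB2 !DlE mul3l.
Qed.

Let Dr_hom : is_hom Dr.
Proof.
apply: (@hom_basis _ _ HH H3r B2); first exact: tens_complete B B2.
  exact: (lift_blin B B (tens_complete B B2) bbDr).
by move=> [s s'] [t t']; rewrite mulB2 !DrE mul3r.
Qed.

Let Delta_idE : Delta_id Delta = @iota R H3l \o Dl.
Proof.
rewrite /Delta_id -(lift_iota B B u3l bbDl); congr lift.
apply/funext => f; apply/funext => g.
exact: (@mtens_iota R _ _ _ _ _ _ HH H B2 B law2 mulg_law mulB2 mulB).
Qed.

Let id_DeltaE : id_Delta Delta = @iota R H3r \o Dr.
Proof.
rewrite /id_Delta -(lift_iota B B u3r bbDr); congr lift.
apply/funext => f; apply/funext => g.
exact: (@mtens_iota R _ _ _ _ _ _ H HH B B2 mulg_law law2 mulB mulB2).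
Qed.

(** Joint boundedness of the inner lift of [tens_assoc] in x and c is not visible from its form. It
    follows by identifying that lift with [F (ot x c)], where F is the bounded extension of
    rebracketing indices. *)
Let assoc_spec : blin (@tens_assoc R H) /\
  forall s t r, tens_assoc (bvec B3l ((s, t), r)) = bvec B3r (s, (t, r)).
Proof.
have [|F [bF FE]] := @basis_map R _ _ _ _ B3l B3r (fun z => (z.1.1, (z.1.2, z.2))).
  move=> _ /tens_basis_wt[_ [w [/tens_basis_wt[u [v [Bu Bv ->]]] Bw ->]]].
  exists (fun z => u z.1 * (v z.2.1 * w z.2.2)).
    apply/tens_basis_wt; exists u, (fun z => v z.1 * w z.2); split=> //.
    by apply/tens_basis_wt; exists v, w.
  by exists 1 => -[[s t] r] /=; rewrite mul1r mulrA.
have c3 := tens_complete B B2.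
have bb c : bbilin (fun a b : H => ot a (ot b c : HH)).
  exact: (bbilin_blin (blin_id H) (bbilin_blin_l c oHH) o3r).
have E x c : F (ot (x : HH) c) = lift (fun a b : H => ot a (ot b c : HH)) x.
  suff : (fun x : HH => F (ot x c)) = lift (fun a b : H => ot a (ot b c : HH)).
    by move=> /(congr1 (@^~ x)).
  apply: (tens_ext (B := B) (C := B)) => //.
  - exact: (blin_comp bF (bbilin_blin_l c o3l)).
  - exact: (lift_blin B B c3 (bb c)).
  move=> s t; rewrite (lift_ot B B c3 (bb c)).
  suff : (fun c => F (ot (ot (d s) (d t) : HH) c)) =
      (fun c => ot (d s) (ot (d t) c : HH)) by move=> /(congr1 (@^~ c)).
  apply: (basis_ext (B := B)) => //.
  - exact: (blin_comp bF (bbilin_blin_r (ot (d s) (d t) : HH) o3l)).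
  - exact: (blin_comp (bbilin_blin_r (d s) o3r) (bbilin_blin_r (d t) oHH)).
  - by move=> r; rewrite -!tens_basisE FE.
suff -> : @tens_assoc R H = F by split=> // s t r; rewrite FE.
rewrite /tens_assoc.
have -> : (fun (x : tens H H) c => lift (fun a b : H => ot a (ot b c)) x) =
    (fun x c => F (ot x c)).
  by apply/funext => x; apply/funext => c; rewrite E.
by apply: (lift_eq (B := B2) (C := B)) => //; exact: (blin_bbilin bF o3l).
Qed.

Let assocM (x y : H3l) : (tens_assoc (bmul x y) : H3r) =
  bmul (tens_assoc x : H3r) (tens_assoc y).
Proof.
have [ba aE] := assoc_spec.
suff [_ h] : is_hom (@tens_assoc R H : H3l -> H3r) by exact: h.
apply: (@hom_basis R _ H3l H3r B3l); [exact: tens_complete B B2|exact: ba|].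
by move=> [[s1 s2] s3] [[t1 t2] t3]; rewrite mul3l !aE mul3r.
Qed.

Let assoc_coassoc f : tens_assoc (Dl (D f)) = Dr (D f).
Proof.
have [ba aE] := assoc_spec; have [bl _] := Dl_hom; have [br _] := Dr_hom.
suff : (@tens_assoc R H \o (Dl \o D)) = Dr \o D by move=> /(congr1 (@^~ f)).
apply: (basis_ext (B := B)); first exact: tens_complete B B2.
- exact: blin_comp ba (blin_comp bl bD).
- exact: blin_comp br bD.
- by move=> t /=; rewrite DE -tens_basisE DlE DrE aE.
Qed.

(** Both extended multipliers are multiplications by elements; what remains is that [tens_assoc] is
    multiplicative and carries [Dl (D f)] to [Dr (D f)]. *)
Lemma group_comul_coassociative : coassociative Delta.
Proof.
have one2 : bvec B2 (1%g, 1%g) = ot one one by rewrite tens_basisE.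
have extl f : mext (Delta_id Delta) (Delta f) = iota (Dl (D f)).
  rewrite Delta_idE; apply: (mext_iota uHH); first exact: (iota_hom u3l Dl_hom).
  by rewrite -(iota1 u3l) /= -one2 DlE tens_basisE.
have extr f : mext (id_Delta Delta) (Delta f) = iota (Dr (D f)).
  rewrite id_DeltaE; apply: (mext_iota uHH); first exact: (iota_hom u3r Dr_hom).
  by rewrite -(iota1 u3r) /= -one2 DrE tens_basisE.
move=> f x; rewrite extl extr; split.
  by rewrite (mL_iota u3l) (mL_iota u3r) -assoc_coassoc; exact: assocM.
by rewrite (mR_iota u3l) (mR_iota u3r) -assoc_coassoc; exact: assocM.
Qed.

(** A Galois map permutes pairs of group elements by h. For its inverse to be bounded, h^-1 must be
    realized by a bounded bilinear map b', which is where the inversion N enters. *)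
Let galois (b b' : H -> H -> HH) (h h' : G * G -> G * G) :
  bbilin b -> bbilin b' ->
  (forall s t, b (d s) (d t) = bvec B2 (h (s, t))) ->
  (forall s t, b' (d s) (d t) = bvec B2 (h' (s, t))) ->
  cancel h h' -> cancel h' h -> galois_iso (lift (fun f g => iota (b f g))).
Proof.
move=> hb hb' bE bE' hh hh'; exists (lift b) => [|x]; last first.
  by rewrite (lift_iota B B uHH hb).
apply: (@biso_basis R _ _ _ HH B2 B2 _ (lift b') h h') => //.
- exact: (lift_blin B B cHH hb).
- exact: (lift_blin B B cHH hb').
- by move=> [s t]; rewrite tens_basisE [LHS](lift_ot B B cHH hb) bE.
- by move=> [s t]; rewrite tens_basisE [LHS](lift_ot B B cHH hb') bE'.
Qed.

Let NIb : bbilin (fun v w : H => ot (N v) w) := bbilin_blin bN (blin_id H) oHH.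
Let INb : bbilin (fun v w : H => ot v (N w)) := bbilin_blin (blin_id H) bN oHH.
Let NI : HH -> HH := lift (fun v w : H => ot (N v) w).
Let IN : HH -> HH := lift (fun v w : H => ot v (N w)).
Let bNI : blin NI := lift_blin B B cHH NIb.
Let bIN : blin IN := lift_blin B B cHH INb.

Let NIE t : NI (D (d t)) = bvec B2 (t^-1, t)%g.
Proof. by rewrite DE [LHS](lift_ot B B cHH NIb) NE tens_basisE. Qed.

Let INE t : IN (D (d t)) = bvec B2 (t, t^-1)%g.
Proof. by rewrite DE [LHS](lift_ot B B cHH INb) NE tens_basisE. Qed.

Let bmHH : bbilin (@bmul R HH) := bmulP HH.
Let o1l : blin (fun g : H => ot g one : HH) := bbilin_blin_l one oHH.
Let o1r : blin (fun g : H => ot one g : HH) := bbilin_blin_r one oHH.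

Let bmul_gl : bbilin (fun f g => bmul (D f : HH) (ot g one)) := bbilin_blin bD o1l bmHH.
Let bmul_gr : bbilin (fun f g => bmul (D f : HH) (ot one g)) := bbilin_blin bD o1r bmHH.
Let bmul_rl : bbilin (fun f g => bmul (ot f one : HH) (D g)) := bbilin_blin o1l bD bmHH.
Let bmul_rr : bbilin (fun f g => bmul (ot one f : HH) (D g)) := bbilin_blin o1r bD bmHH.

Let gamma_lE : gamma_l Delta = lift (fun f g => iota (bmul (D f : HH) (ot g one))).
Proof.
congr lift; apply/funext => f; apply/funext => g.
by rewrite (iotaM uHH) -mtensE (iota1 uH).
Qed.

Let rho_lE : rho_l Delta = lift (fun f g => iota (bmul (ot f one : HH) (D g))).
Proof.
congr lift; apply/funext => f; apply/funext => g.
by rewrite (iotaM uHH) -mtensE (iota1 uH).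
Qed.

Lemma galois_gamma_l : galois_iso (gamma_l Delta).
Proof.
(* (s, t) goes to (st, s). The inverse (x, y) |-> (y, y^-1 x) is the product of (id (x) N) D(y) with
   1 (x) x. *)
rewrite gamma_lE; apply: (@galois _ (fun x y => bmul (IN (D y)) (ot one x))
  (fun z => (z.1 * z.2, z.1)%g) (fun z => (z.2, z.2^-1 * z.1)%g)) => //.
- exact: (bbilin_swap (bbilin_blin (blin_comp bIN bD) o1r bmHH)).
- by move=> s t; rewrite DE mulT !mulB mulg1 tens_basisE.
- by move=> s t; rewrite INE tens_basisE mulT !mulB mulg1 tens_basisE.
- by move=> [s t] /=; rewrite mulKg.
- by move=> [s t] /=; rewrite mulVKg.
Qed.

Lemma galois_gamma_r : galois_iso (gamma_r Delta).
Proof.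
have -> : gamma_r Delta = lift (fun f g => iota (bmul (D f : HH) (ot one g))).
  congr lift; apply/funext => f; apply/funext => g.
  by rewrite (iotaM uHH) -mtensE (iota1 uH).
apply: (@galois _ (fun x y => bmul (IN (D x)) (ot one y))
  (fun z => (z.1, z.1 * z.2)%g) (fun z => (z.1, z.1^-1 * z.2)%g)) => //.
- exact: (bbilin_blin (blin_comp bIN bD) o1r bmHH).
- by move=> s t; rewrite DE mulT !mulB mulg1 tens_basisE.
- by move=> s t; rewrite INE tens_basisE mulT !mulB mulg1 tens_basisE.
- by move=> [s t] /=; rewrite mulKg.
- by move=> [s t] /=; rewrite mulVKg.
Qed.

Lemma galois_rho_l : galois_iso (rho_l Delta).
Proof.
rewrite rho_lE; apply: (@galois _ (fun x y => bmul (ot x one : HH) (NI (D y)))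
  (fun z => (z.1 * z.2, z.2)%g) (fun z => (z.1 * z.2^-1, z.2)%g)) => //.
- exact: (bbilin_blin o1l (blin_comp bNI bD) bmHH).
- by move=> s t; rewrite DE mulT !mulB mul1g tens_basisE.
- by move=> s t; rewrite NIE tens_basisE mulT !mulB mul1g tens_basisE.
- by move=> [s t] /=; rewrite mulgK.
- by move=> [s t] /=; rewrite mulgVK.
Qed.

Lemma galois_rho_r : galois_iso (rho_r Delta).
Proof.
have -> : rho_r Delta = lift (fun f g => iota (bmul (ot one f : HH) (D g))).
  congr lift; apply/funext => f; apply/funext => g.
  by rewrite (iotaM uHH) -mtensE (iota1 uH).
(* (s, t) goes to (t, st). The inverse (x, y) |-> (y x^-1, x) is the product of y (x) 1 with (N (x)
   id) D(x). *)
apply: (@galois _ (fun x y => bmul (ot y one : HH) (NI (D x)))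
  (fun z => (z.2, z.1 * z.2)%g) (fun z => (z.2 * z.1^-1, z.1)%g)) => //.
- exact: (bbilin_swap (bbilin_blin o1l (blin_comp bNI bD) bmHH)).
- by move=> s t; rewrite DE mulT !mulB mul1g tens_basisE.
- by move=> s t; rewrite NIE tens_basisE mulT !mulB mul1g tens_basisE.
- by move=> [s t] /=; rewrite mulgK.
- by move=> [s t] /=; rewrite mulgVK.
Qed.

Lemma haar_linear a x y : haar (a *: x + y) = a * haar x + haar y.
Proof. by rewrite /haar (coord_linear B). Qed.

Lemma haar_bvec t : haar (d t) = (t == 1%g)%:R.
Proof. by rewrite /haar coord_bvec eq_sym. Qed.

Lemma haar_bounded : bfunctional haar.
Proof.
split=> [a x y|A /(smallP B)[v Bv [M hM]]]; first exact: haar_linear.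
exists (M / v 1%g) => x /hM/(nle_point 1%g).
by rewrite ler_pdivlMr// (wt_gt0 Bv).
Qed.

Let haar_bbilin : bbilin (fun f g : H => haar g *: f).
Proof.
split=> [w a x y|v a x y|A E /(smallP B)[v Bv [M hM]] sE].
- by rewrite scalerDr !scalerA mulrC.
- by rewrite haar_linear scalerDl scalerA.
have [K hK] := proj2 haar_bounded _ sE.
have v0 t : 0 <= v t by apply/ltW/(wt_gt0 Bv).
apply/(smallP B); exists v => //; exists (K * M) => _ [x /hM hx [y /hK hy <-]].
rewrite (linZ (coord_linear B)); apply: nleW (nleZ _ v0 hx).
by rewrite ler_wpM2r// (nle_ge0 hx).
Qed.

(** Density is stated for maps between bornological spaces, so functionals are multiplied by the
    unit and compared as maps into H. *)
Let haar_blin : blin (fun f : H => haar f *: one).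
Proof. exact: (bbilin_blin_r one haar_bbilin). Qed.

Let scale_one_inj a b : a *: one = b *: one -> a = b.
Proof.
move=> /(congr1 haar); rewrite -[_ *: one]addr0 -[b *: one]addr0 !haar_linear.
by rewrite haar_bvec eqxx !mulr1 => /addIr.
Qed.

Let coord_blin t : blin (fun f : H => coord B f t *: one).
Proof.
split=> [a x y|A /(smallP B)[v Bv [M hM]]].
  by rewrite (coord_linear B) !fctE scalerDl scalerA.
have v0 s : 0 <= v s by apply/ltW/(wt_gt0 Bv).
apply/(smallP B); exists v => //; exists (M / v t * v 1%g) => _ [x /hM hx <-].
rewrite (linZ (coord_linear B)) coord_bvec; apply: nleW (nleZ _ v0 (nle_delta _ v0)).
rewrite ler_wpM2r//; have := nle_point t hx.
by rewrite ler_pdivlMr// (wt_gt0 Bv).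
Qed.

(** The coordinates of f are values of the Haar functional on products with f; hence its
    faithfulness. *)
Let haar_mulr f t : haar (bmul f (d t^-1%g)) = coord B f t.
Proof.
apply: scale_one_inj.
suff : (fun f => haar (bmul f (d t^-1%g)) *: one) = (fun f => coord B f t *: one).
  by move=> /(congr1 (@^~ f)).
apply: (basis_ext (B := B)) => //.
  exact: (blin_comp haar_blin (bbilin_blin_l _ (bmulP H))).
by move=> s; rewrite mulB haar_bvec coord_bvec divg_eq1 eq_sym.
Qed.

Let haar_mull f t : haar (bmul (d t^-1%g) f) = coord B f t.
Proof.
apply: scale_one_inj.
suff : (fun f => haar (bmul (d t^-1%g) f) *: one) = (fun f => coord B f t *: one).
  by move=> /(congr1 (@^~ f)).
apply: (basis_ext (B := B)) => //.
  exact: (blin_comp haar_blin (bbilin_blin_r _ (bmulP H))).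
by move=> s; rewrite mulB haar_bvec coord_bvec mulg_eq1 (inj_eq invg_inj).
Qed.

Lemma haar_faithful : faithful haar.
Proof.
have c0 : coord B 0 = 0 by rewrite (lin0 (coord_linear B)).
split=> f hf; apply: (coord_eq (B := B)) => t; rewrite c0.
  by rewrite -haar_mulr hf.
by rewrite -haar_mull hf.
Qed.

(** On basis vectors the left side is [haar (d s)] times the basis vector at st. It vanishes unless
    s = 1, and then st = t. *)
Let id_haar_l f g : id_tens haar (bmul (D f : HH) (ot g one)) = haar f *: g.
Proof.
have bl := lift_blin B B cH haar_bbilin.
apply: (basis_ext2 (B := B) (C := B)
  (b := fun f g => id_tens haar (bmul (D f : HH) (ot g one)))
  (b' := fun f g => haar f *: g)) => //.
- exact: (blin_bbilin bl bmul_gl).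
- exact: (bbilin_swap haar_bbilin).
move=> s t; rewrite DE mulT !mulB mulg1 [LHS](lift_ot B B cH haar_bbilin).
by rewrite haar_bvec; case: eqP => [->|]; rewrite ?mul1g// !scale0r.
Qed.

Let id_haar_r f g : id_tens haar (bmul (ot g one : HH) (D f)) = haar f *: g.
Proof.
have bl := lift_blin B B cH haar_bbilin.
apply: (basis_ext2 (B := B) (C := B)
  (b := fun f g => id_tens haar (bmul (ot g one : HH) (D f)))
  (b' := fun f g => haar f *: g)) => //.
- exact: (blin_bbilin bl (bbilin_swap bmul_rl)).
- exact: (bbilin_swap haar_bbilin).
move=> s t; rewrite DE mulT !mulB mul1g [LHS](lift_ot B B cH haar_bbilin).
by rewrite haar_bvec; case: eqP => [->|]; rewrite ?mulg1// !scale0r.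
Qed.

Lemma haar_invariant : left_invariant Delta haar.
Proof.
move=> f; have [l1 l2 _] := bmulP H.
have -> : haar f *: mone H = iota (haar f *: one).
  by rewrite -(iota1 uH) (linZ (proj1 (iota_blin uH))).
rewrite /slice /iota; congr to_mult; apply/funext => g.
  rewrite gamma_lE (lift_iota B B uHH bmul_gl) /= (lift_ot B B cHH bmul_gl).
  rewrite (of_mult_iota uHH) id_haar_l (linZ (l1 _)).
  by rewrite (unital_mul1 uH).
rewrite rho_lE (lift_iota B B uHH bmul_rl) /= (lift_ot B B cHH bmul_rl).
rewrite (of_mult_iota uHH) id_haar_r (linZ (l2 _)).
by rewrite (unital_mulr1 uH).
Qed.

Theorem group_quantum_group : extends_group_ring d Delta haar /\
  bornological_quantum_group Delta haar.
Proof.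
split; first by split=> [s t|t|t]; rewrite ?mulB ?haar_bvec// /Delta /= DE.
split.
- by split=> //; exact: unital_assoc uH.
- apply: (unital_essential_alg B uH) => one0.
  have := scale_one_inj (a := 0) (b := 1); rewrite one0 !scaler0 => /(_ erefl)/eqP.
  by rewrite eq_sym oner_eq0.
- exact: basis_approximation B.
- split; [exact: group_comul_essential|exact: group_comul_coassociative].
- exact: galois_gamma_l.
- exact: galois_gamma_r.
- exact: galois_rho_l.
- exact: galois_rho_r.
- exact: haar_bounded.
- exact: haar_faithful.
- exact: haar_invariant.
Qed.

End GroupQuantumGroup.

(** Product and inversion take values in H, where smallness may be tested on the defining norms, so
    their hypotheses ask for small sets. The diagonal lands in the tensor square, described by
    weights, so its hypothesis is an inequality. *)
Lemma weighted_quantum_group (R : realType) (G : groupType) (H : bornSpace R)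
    (B : basis G H) :
  (forall u v, B u -> B v ->
     small [set ((u z.1 * v z.2)%:C%C)^-1 *: bvec B (z.1 * z.2)%g | z in [set: G * G]]) ->
  (forall v, B v -> small [set ((v t)%:C%C)^-1 *: bvec B t^-1%g | t in [set: G]]) ->
  (forall v, B v -> exists2 u, B u & exists K, forall t, u t * u t <= K * v t) ->
  ext_quantum_group (bvec B).
Proof.
move=> hmul hinv hdiag; have cH := basis_complete B.
have [|m [bm mE]] := @basis_extend _ _ _ (tens_basis B B) H cH
    (fun z => bvec B (z.1 * z.2)%g).
  by move=> _ /tens_basis_wt[u [v [Bu Bv ->]]]; exact: hmul.
have [N [bN NE]] := @basis_extend _ _ _ B H cH (fun t => bvec B t^-1%g) hinv.
have [|D [bD DE]] := @basis_map _ _ _ _ _ B (tens_basis B B) (fun t => (t, t)).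
  move=> v /hdiag[u Bu [K hK]]; exists (fun z => u z.1 * u z.2).
    by apply/tens_basis_wt; exists u, u.
  by exists K.
have muP : bbilin (fun x y => m (ot x y)) := blin_bbilin bm (ot_bbilin B B).
exists (fun x y => m (ot x y)), muP => A.
have mulB s t : bmul (bvec B s : A) (bvec B t) = bvec B (s * t)%g.
  by rewrite /bmul /= -tens_basisE mE.
exists (group_comul (H := A) D), (haar (H := A) B).
apply: (@group_quantum_group R G A B mulB D N bD _ bN NE) => t.
by rewrite DE tens_basisE.
Qed.

(** * The Frechet spaces as unions of weighted spaces *)

Section FrechetBasis.
Variables (R : realType) (G : groupType) (I : Type) (w : I -> G -> R).
Hypothesis w0 : forall i t, 0 <= w i t.

Let dom (v : G -> R) := (forall t, 0 < v t) /\
  forall i, exists2 C, 0 <= C & forall t, w i t <= C * v t.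

(** A set with bounds [m i] in all the norms is bounded in one space l^1(G, v); v and K depend on m
    alone. *)
Hypothesis w_dom : forall m : I -> R, exists2 v, dom v & exists K, forall f,
  (forall i, nle (w i) f (m i)) -> nle v f K.

Let dom_nonempty : exists v, dom v.
Proof. by have [v ? _] := w_dom (fun=> 0); exists v. Qed.

Let dom_directed u v : dom u -> dom v ->
  exists p, [/\ dom p, forall x, p x <= u x & forall x, p x <= v x].
Proof.
move=> [u0 hu] [v0 hv]; exists (fun x => Num.min (u x) (v x)).
split=> [|x|x]; [|by rewrite ge_min lexx|by rewrite ge_min lexx orbT].
split=> [t|i]; first by rewrite lt_min u0 v0.
have [C C0 hC] := hu i; have [K K0 hK] := hv i.
(* The minimum equals u or v at each point, so the sum of the two constants serves in either
   case. *)
exists (C + K); first by rewrite addr_ge0.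
move=> t; rewrite /Num.min; case: ifP => _.
  by apply: le_trans (hC t) _; rewrite ler_pM2r// lerDl.
by apply: le_trans (hK t) _; rewrite ler_pM2r// lerDr.
Qed.

Definition frechet_weights : weights R G :=
  Weights (fun v (hv : dom v) => proj1 hv) dom_nonempty dom_directed.

Lemma frechet_subP f : frechet_sub w0 f <-> forall i, exists M, nle (w i) f M.
Proof.
split=> [h i|h i]; last by apply/wnorm_fin; have [M /wnorm_leP hM] := h i; exists M.
by have /wnorm_fin[M /wnorm_leP hM] := h i; exists M.
Qed.

Let fcoord (x : frechet w0) : G -> R[i]^o := val x.

Let fcoord_linear : linear fcoord. Proof. exact: ss_valP. Qed.

Let fcoord_inj : injective fcoord. Proof. exact: val_inj. Qed.

Let fcoord_surj v f M : frechet_weights v -> nle v f M -> exists x, fcoord x = f.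
Proof.
move=> [v0 hv] hf.
have fP : frechet_sub w0 f.
  apply/frechet_subP => i; have [C C0 hC] := hv i; exists (C * M).
  exact: nle_weight hC hf.
by exists (Sub f (asboolT fP)); exact: SubK.
Qed.

Let fcoord_delta x : fcoord (frechet_delta w0 x) = fun y => (y == x)%:R.
Proof. exact: SubK. Qed.

Let fsmallP (A : set (frechet w0)) : small A <-> exists2 v, frechet_weights v &
  exists M, forall x, A x -> nle v (fcoord x) M.
Proof.
split=> [sA|[v [v0 hv] [M hM]] i].
  have /(_ _)/cid-/all_sig[m hm] i := sA i.
  have [v dv [K hK]] := w_dom m; exists v => //; exists K => x Ax.
  by apply: hK => i; apply/wnorm_leP/hm.
have [C C0 hC] := hv i; exists (C * M) => x /hM hx.
by apply/wnorm_leP; exact: nle_weight hC hx.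
Qed.

Definition frechet_basis : basis G (frechet w0) :=
  @MkBasis R G (frechet w0) frechet_weights fcoord (frechet_delta w0)
    fcoord_linear fcoord_inj fcoord_surj fcoord_delta fsmallP.

Lemma frechet_small_scaled (X : Type) (h : X -> G) (v : X -> R) :
  (forall x, 0 < v x) -> (forall i, exists K, forall x, w i (h x) <= K * v x) ->
  small [set ((v x)%:C%C)^-1 *: frechet_delta w0 (h x) | x in [set: X]].
Proof.
move=> v0 hv i; have [K hK] := hv i; exists K => _ [x _ <-]; apply/wnorm_leP.
have vx := v0 x; rewrite ss_valZ.
apply: nleW (nleZ _ (w0 i) (nle_delta (h x) (w0 i))).
by rewrite ComplexField.Normc.normcV (cabsR (ltW vx)) mulrC ler_pdivrMr.
Qed.

(** From w_i^2 <= w_j <= C v one gets w_i <= sqrt C sqrt v, so sqrt v again dominates all the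
    weights and can be used for the diagonal. *)
Lemma frechet_quantum_group :
  (forall i s t, w i (s * t)%g <= w i s * w i t) ->
  (forall i t, w i t^-1%g <= w i t) ->
  (forall i, exists j, forall t, w i t ^+ 2 <= w j t) ->
  ext_quantum_group (frechet_delta w0).
Proof.
move=> wM wV w2; apply: (weighted_quantum_group (B := frechet_basis)).
- move=> u v [u0 hu] [v0 hv]; apply: frechet_small_scaled => [[s t]|i].
    by rewrite mulr_gt0.
  have [C C0 hC] := hu i; have [K K0 hK] := hv i; exists (C * K) => -[s t] /=.
  rewrite mulrACA; apply: (le_trans (wM i s t)).
  by apply: ler_pM.
- move=> v [v0 hv]; apply: frechet_small_scaled => // i.
  by have [C C0 hC] := hv i; exists C => t; exact: le_trans (hC t).
- move=> v [v0 hv]; exists (fun t => Num.sqrt (v t)); last first.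
    by exists 1 => t; rewrite mul1r -expr2 sqr_sqrtr// ltW.
  split=> [t|i]; first by rewrite sqrtr_gt0.
  have [j hj] := w2 i; have [C C0 hC] := hv j.
  exists (Num.sqrt C) => // t; rewrite -sqrtrM// -[leLHS]ger0_norm// -sqrtr_sqr.
  by apply: ler_wsqrtr; exact: le_trans (hC t).
Qed.

End FrechetBasis.

(* A set bounded for all the weights w k is bounded for v t, the sum of the
   eps k * w k t over k <= L t, if eps decreases fast enough; since w k is bounded
   on the t with L t < k, this v dominates each w k up to a constant. *)
Section LengthWeights.
Variables (R : realType) (G : groupType) (L : G -> nat) (w : nat -> nat -> R).
Hypothesis w_ge1 : forall k n, 1 <= w k n.
Hypothesis w_mono : forall k m n, (m <= n)%N -> w k m <= w k n.

Lemma length_weights_dom (m : nat -> R) : exists2 v : G -> R,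
  (forall t, 0 < v t) /\
    (forall k, exists2 C, 0 <= C & forall t, w k (L t) <= C * v t) &
  exists K, forall f, (forall k, nle (fun t => w k (L t)) f (m k)) -> nle v f K.
Proof.
have w0 k n : 0 < w k n by exact: lt_le_trans (w_ge1 k n).
(* Then eps k (1 + |m k|) = 2^-k: the k-th norm contributes at most 2^-k to the v-norm, and the
   total is at most 2. *)
pose eps k := 2^-1 ^+ k / (1 + `|m k|).
have m1 k : 0 < 1 + `|m k| by rewrite ltr_wpDr.
have eps0 k : 0 < eps k by rewrite divr_gt0// exprn_gt0.
pose v t := \sum_(0 <= k < (L t).+1) eps k * w k (L t).
have ew0 k n : 0 <= eps k * w k n by rewrite mulr_ge0// ltW.
have v_ge k t : (k <= L t)%N -> eps k * w k (L t) <= v t.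
  move=> kL; rewrite /v (bigD1_seq k) ?iota_uniq//=; last by rewrite mem_index_iota.
  by rewrite lerDl sumr_ge0.
have v0 t : eps 0%N <= v t.
  by apply: le_trans (v_ge 0%N t _) => //; rewrite ler_peMr// ltW.
exists v; [split=> [t|k]|].
- exact: lt_le_trans (v0 t).
(* The first summand serves the t with k <= L t; the second the remaining t, where w k (L t) <= w k
   k and v t >= eps 0. *)
- exists ((eps k)^-1 + w k k / eps 0%N).
    by rewrite addr_ge0// ?divr_ge0// ?invr_ge0 ltW.
  move=> t; have vt : 0 <= v t by apply: le_trans (v0 t); exact: ltW.
  rewrite mulrDl; have [kL|kL] := leqP k (L t).
    apply: (@le_trans _ _ ((eps k)^-1 * v t)).
      by rewrite mulrC ler_pdivlMr// mulrC v_ge.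
    by rewrite lerDl mulr_ge0// divr_ge0// ltW.
  apply: (@le_trans _ _ (w k k / eps 0%N * v t)); last first.
    by rewrite lerDr mulr_ge0// invr_ge0 ltW.
  apply: (le_trans (w_mono k (ltnW kL))).
  by rewrite mulrAC -mulrA ler_peMr// ?(ltW (w0 _ _))// ler_pdivlMr// mul1r.
exists 2 => f hf A.
(* Beyond all lengths in A, so that the sums defining v have a common range and can be exchanged
   with the sum over A. *)
pose n := \max_(t <- A) (L t).+1.
have vn t : t \in A -> v t <= \sum_(0 <= k < n) eps k * w k (L t).
  move=> tA; have Ln : ((L t).+1 <= n)%N by rewrite /n; apply: leq_bigmax_seq.
  by rewrite /v (big_cat_nat (leq0n _) Ln)/= lerDl sumr_ge0.
apply: (@le_trans _ _ (\sum_(0 <= k < n) 2^-1 ^+ k)).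
  apply: (@le_trans _ _ (\sum_(t <- A) \sum_(0 <= k < n)
      eps k * (cabs (f t) * w k (L t)))).
    rewrite big_seq [leRHS]big_seq; apply: ler_sum => t tA.
    under eq_bigr do rewrite mulrCA.
    by rewrite -mulr_sumr ler_wpM2l ?cabs_ge0// vn.
  rewrite exchange_big /=; apply: ler_sum => k _; rewrite -mulr_sumr.
  apply: (@le_trans _ _ (eps k * (1 + `|m k|))); last first.
    by rewrite /eps divfK// gt_eqF.
  apply: ler_wpM2l; first exact: ltW.
  by apply: le_trans (hf k A) _; rewrite (le_trans (ler_norm _))// lerDr.
have geo j : \sum_(0 <= k < j) 2^-1 ^+ k = 2 - 2 * 2^-1 ^+ j :> R.
  elim: j => [|j IH]; first by rewrite big_geq// expr0 mulr1 subrr.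
  by rewrite big_nat_recr//= IH exprS mulrA divff// mul1r; ring.
by rewrite geo lerBlDr lerDl mulr_ge0// exprn_ge0.
Qed.

End LengthWeights.

(** * The direct limit of the exponentially weighted spaces *)

Section LimitBasis.
Variables (R : realType) (G : groupType) (L : G -> nat).
Hypothesis L_mul : forall s t, (L (s * t)%g <= L s + L t)%N.
Hypothesis L_inv : forall t, (L t^-1%g <= L t)%N.

Let ew (v : G -> R) := exists2 alpha, 1 < alpha & v = expw L alpha.

Let expw_gt0 alpha t : 1 < alpha -> 0 < expw L alpha t :> R.
Proof. by move=> a1; rewrite exprn_gt0// (lt_trans ltr01). Qed.

Let expw_le alpha beta t : 1 < alpha -> alpha <= beta ->
  expw L alpha t <= expw L beta t :> R.
Proof.
move=> a1 ab; have a0 : 0 <= alpha by rewrite ltW// (lt_trans _ a1).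
by rewrite lerXn2r// nnegrE// (le_trans a0).
Qed.

Definition limit_weights : weights R G.
Proof.
apply: (@Weights _ _ ew).
- by move=> _ [alpha a1 ->] t; exact: expw_gt0.
- by exists (expw L 2), 2 => //; rewrite ltr1n.
- move=> _ _ [alpha a1 ->] [beta b1 ->]; have m1 : 1 < Num.min alpha beta by rewrite lt_min a1.
  exists (expw L (Num.min alpha beta)); split; first by exists (Num.min alpha beta).
    by move=> t; apply: expw_le => //; rewrite ge_min lexx.
  by move=> t; apply: expw_le => //; rewrite ge_min lexx orbT.
Defined.

Let lcoord (x : limit R L) : G -> R[i]^o := val x.

Let lcoord_linear : linear lcoord. Proof. exact: ss_valP. Qed.

Let lcoord_inj : injective lcoord. Proof. exact: val_inj. Qed.

Let lcoord_surj v f M : limit_weights v -> nle v f M -> exists x, lcoord x = f.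
Proof.
move=> [alpha a1 ->] hf; have fP : limit_sub R L f.
  by exists alpha => //; apply/wnorm_fin; exists M; exact/wnorm_leP.
by exists (Sub f (asboolT fP)); exact: SubK.
Qed.

Let lcoord_delta x : lcoord (limit_delta R L x) = fun y => (y == x)%:R.
Proof. exact: SubK. Qed.

Let lsmallP (A : set (limit R L)) : small A <-> exists2 v, limit_weights v &
  exists M, forall x, A x -> nle v (lcoord x) M.
Proof.
split=> [[alpha a1 [M hM]]|[_ [alpha a1 ->] [M hM]]].
  by exists (expw L alpha); [exists alpha|exists M => x /hM/wnorm_leP].
by exists alpha => //; exists M => x /hM hx; apply/wnorm_leP.
Qed.

Definition limit_basis : basis G (limit R L) :=
  @MkBasis R G (limit R L) limit_weights lcoord (limit_delta R L)
    lcoord_linear lcoord_inj lcoord_surj lcoord_delta lsmallP.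

Lemma limit_quantum_group : ext_quantum_group (limit_delta R L).
Proof.
apply: (weighted_quantum_group (B := limit_basis)).
- move=> _ _ [alpha a1 ->] [beta b1 ->].
  have m1 : 1 < Num.min alpha beta by rewrite lt_min a1.
  apply: (@small_bvec_map _ _ _ _ limit_basis (fun z : G * G => (z.1 * z.2)%g) _
    (expw L (Num.min alpha beta)) 1).
  + by move=> z; rewrite mulr_gt0// expw_gt0.
  + by exists (Num.min alpha beta).
  move=> [s t]; rewrite mul1r /=.
  apply: (@le_trans _ _ (expw L (Num.min alpha beta) s * expw L (Num.min alpha beta) t)).
    by rewrite /expw -exprD ler_weXn2l// ltW.
  apply: ler_pM; rewrite ?(ltW (expw_gt0 _ _))//; apply: expw_le => //.
    by rewrite ge_min lexx.
  by rewrite ge_min lexx orbT.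
- move=> _ [alpha a1 ->].
  apply: (@small_bvec_map _ _ _ _ limit_basis (fun t => t^-1%g) _ (expw L alpha) 1).
  + by move=> t; exact: expw_gt0.
  + by exists alpha.
  by move=> t; rewrite mul1r /expw ler_weXn2l// ltW.
(* The square root of alpha is still greater than 1, so its weight stays in the family. *)
- move=> _ [alpha a1 ->]; exists (expw L (Num.sqrt alpha)).
    by exists (Num.sqrt alpha) => //; rewrite -[ltLHS]sqrtr1 ltr_sqrt// (lt_trans ltr01).
  exists 1 => t; rewrite mul1r /expw -exprMn -expr2 sqr_sqrtr//.
  by rewrite ltW// (lt_trans ltr01).
Qed.

End LimitBasis.

(** * Word length: subadditivity and symmetry *)

Section WordLength.
Variables (G : groupType) (S : seq G) (gS : generates S).
Local Notation L := (word_length gS).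

Lemma word_lengthP t : is_word S (L t) t.
Proof. by rewrite /word_length; case: ex_minnP => n /asboolP. Qed.

Lemma word_length_min n t : is_word S n t -> (L t <= n)%N.
Proof. by move=> h; rewrite /word_length; case: ex_minnP => m _; apply; exact/asboolP. Qed.

Lemma word_lengthM s t : (L (s * t)%g <= L s + L t)%N.
Proof.
have [p [ps pS Ep]] := word_lengthP s; have [q [qs qS Eq]] := word_lengthP t.
apply: word_length_min; exists (p ++ q); split.
- by rewrite size_cat ps qs.
- by rewrite all_cat pS qS.
- by rewrite big_cat /= -Ep -Eq.
Qed.

(** Reverse a shortest word and invert its letters; the alphabet is closed under inversion. *)
Lemma word_lengthV t : (L t^-1%g <= L t)%N.
Proof.
have [p [ps pS Ep]] := word_lengthP t.
apply: word_length_min; exists [seq x^-1%g | x <- rev p]; split.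
- by rewrite size_map size_rev.
- rewrite all_map all_rev; apply: sub_all pS => x /=.
  by rewrite invgK orbC.
- by rewrite {1}Ep big_map prodgV revK.
Qed.

End WordLength.

Theorem proposition10p5 (R : realType) (G : groupType) (S : seq G)
    (gS : generates S) :
  [/\ ext_quantum_group (@l1_delta R G S gS),
      ext_quantum_group (@schwartz_delta R G S gS),
      ext_quantum_group (@entire_delta R G S gS)
    & ext_quantum_group (@schwartz_omega_delta R G S gS)].
Proof.
have L_mul := word_lengthM gS; have L_inv := word_lengthV gS.
set L := word_length gS in L_mul L_inv.
have polyM k s t : (1 + (L (s * t)%g)%:R) ^+ k <=
    (1 + (L s)%:R) ^+ k * (1 + (L t)%:R) ^+ k :> R.
  rewrite -exprMn lerXn2r ?nnegrE ?mulr_ge0 ?addr_ge0//.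
  rewrite mulrDl mul1r -addrA lerD2l mulrDr mulr1 addrA -addrA addrCA.
  apply: (@le_trans _ _ ((L s)%:R + (L t)%:R)); first by rewrite -natrD ler_nat.
  by rewrite lerD2l lerDl mulr_ge0.
have polyV k t : (1 + (L t^-1%g)%:R) ^+ k <= (1 + (L t)%:R) ^+ k :> R.
  by rewrite lerXn2r ?nnegrE ?addr_ge0// lerD2l ler_nat.
have n1 n : 1 <= n.+2%:R :> R by rewrite ler1n.
split.
- apply: frechet_quantum_group => //.
    (* All norms of the family are the plain l^1 norm, so the constant weight 1 dominates. *)
    move=> m; exists (fun=> 1); last first.
      exists (m tt) => f /(_ tt) h A; apply: le_trans (h A).
      by apply: ler_sum => t _; rewrite expr0.
    by split=> // i; exists 1 => // t; rewrite expr0 mulr1.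
  by move=> i; exists i => t; rewrite expr0 expr1n.
- apply: frechet_quantum_group => //.
    apply: (@length_weights_dom R G L (fun k n => (1 + n%:R) ^+ k)) => k n.
      by rewrite exprn_ege1// lerDl.
    by move=> n' nn; rewrite lerXn2r ?nnegrE ?addr_ge0// lerD2l ler_nat.
  by move=> k; exists (k * 2)%N => t; rewrite exprM.
- apply: frechet_quantum_group.
  + apply: (@length_weights_dom R G L (fun k n => k.+2%:R ^+ n)) => k n.
      by rewrite exprn_ege1.
    by move=> n' nn; rewrite ler_weXn2l.
  + by move=> k s t; rewrite -exprD ler_weXn2l.
  + by move=> k t; rewrite ler_weXn2l.
  (* The weight with index j has base j + 2; for this index the base is (k + 2)^2 + 2, at least the
     required (k + 2)^2. *)
  + move=> k; exists (k.+2 * k.+2)%N => t.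
    rewrite -exprM mulnC exprM lerXn2r ?nnegrE//.
    by rewrite -natrX ler_nat expnS expn1 -[leqRHS]addn2 leq_addr.
- exact: limit_quantum_group.
Qed.
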